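(* Let $n\ge 1$ be an integer, $\gamma>0$, $1\le q<\infty$, $\alpha>-1$, and $0<p<\infty$. Then for any holomorphic function $f$ on $\mathbb{B}_n$, the following conditions are equivalent: (1) $f\in\mathcal{A}^p_\alpha$; (2) $A^{(q)}_\gamma(f)\in L^p(\mathbb{B}_n,dv_\alpha)$; (3) $M^{(q)}_\gamma(f)\in L^p(\mathbb{B}_n,dv_\alpha)$. Moreover, $$\|f\|_{p,\alpha}\approx\|A^{(q)}_\gamma(f)\|_{p,\alpha}\approx\|M^{(q)}_\gamma(f)\|_{p,\alpha},$$ where the comparison constants depend only on $\gamma,q,\alpha,p$ and $n$ (not on $f$).
   Context: $\mathbb{B}_n=\{z\in\mathbb{C}^n:|z|<1\}$ is the open unit ball with $\langle z,w\rangle=\sum_k z_k\overline{w}_k$, and $dv$ is Lebesgue measure on $\mathbb{B}_n$ normalized to have total mass $1$. For $\alpha>-1$, $dv_\alpha(z)=c_\alpha(1-|z|^2)^\alpha dv(z)$ with $c_\alpha=\Gamma(n+\alpha+1)/[n!\,\Gamma(\alpha+1)]$, a probability measure. $\|g\|_{p,\alpha}=\left(\int_{\mathbb{B}_n}|g|^p\,dv_\alpha\right)^{1/p}$ for measurable $g$. The Bergman space $\mathcal{A}^p_\alpha$ is the set of holomorphic $f$ on $\mathbb{B}_n$ with $\|f\|_{p,\alpha}<\infty$. The invariant measure is $d\tau(z)=(1-|z|^2)^{-(n+1)}dv(z)$. The Bergman metric is $\beta(z,w)=\frac12\log\frac{1+|\varphi_z(w)|}{1-|\varphi_z(w)|}$,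 where $\varphi_z$ is the involutive holomorphic automorphism of $\mathbb{B}_n$ with $\varphi_z(0)=z$, $\varphi_z(z)=0$, $\varphi_z\circ\varphi_z=\mathrm{id}$. Bergman balls are $D(z,\gamma)=\{w\in\mathbb{B}_n:\beta(z,w)<\gamma\}$. For $z\in\mathbb{B}_n$ define $$A^{(q)}_\gamma(f)(z)=\left(\int_{D(z,\gamma)}|f(w)|^q\,d\tau(w)\right)^{1/q},$$ $$M^{(q)}_\gamma(f)(z)=\sup_{w\in\mathbb{B}_n:\ z\in D(w,\gamma)}\left(\frac{1}{v_\alpha(D(w,\gamma))}\int_{D(w,\gamma)}|f|^q\,dv_\alpha\right)^{1/q}.$$ The quantity $\|A^{(q)}_\gamma(f)\|_{p,\alpha}$ is the (quasi-)norm of $f$ in the holomorphic space of tent type $T^p_{q,\alpha}$, the set of holomorphic $f$ for which it is finite. $X\approx Y$ means $C^{-1}Y\le X\le CY$ for a constant $C>0$ (quantities may be infinite). *)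

(* Defs.v *)
From HB Require Import structures.
From mathcomp Require Import all_boot all_order all_algebra.
From mathcomp Require Import all_classical all_reals all_analysis.
From mathcomp Require Import measurable_realfun complex ring.

Set Implicit Arguments.
Unset Strict Implicit.
Unset Printing Implicit Defensive.

Import Order.TTheory GRing.Theory Num.Theory.
Import numFieldNormedType.Exports.

Local Open Scope classical_set_scope.
Local Open Scope complex_scope.
Local Open Scope ring_scope.

(* [Cn R n] carries the topology of 'rV[R[i]]_n, as a normed module over R[i].
   Beware: [`|z|] is then the sup norm; the Euclidean norm is [enorm] below. *)
Definition Cn (R : realType) (n : nat) : Type := 'rV[R[i]]_n.

HB.instance Definition _ (R : realType) (n : nat) :=
  NormedModule.copy (Cn R n) 'rV[R[i]]_n.

Section measurable_structure.
Variables (R : realType) (n : nat).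
Local Notation R2 := (measurableTypeR R * measurableTypeR R)%type.

Definition Cn_coords (z : Cn R n) : n.-tuple R2 :=
  [tuple (complex.Re (z 0 k), complex.Im (z 0 k)) | k < n].

Definition Cn_of_coords (x : n.-tuple R2) : Cn R n :=
  \row_k ((tnth x k).1 +i* (tnth x k).2).

(* The sigma-algebra generated by the real and imaginary parts of the
   coordinates, that is, the Borel sets of C^n. *)
HB.instance Definition _ :=
  Measurable.copy (Cn R n) (g_sigma_algebra_preimageType Cn_coords).

Lemma Cn_coordsK : cancel Cn_coords Cn_of_coords.
Proof.
move=> z; apply/rowP => k; rewrite mxE tnth_mktuple /=.
by case: (z 0 k).
Qed.

Lemma Cn_of_coordsK : cancel Cn_of_coords Cn_coords.
Proof.
move=> x; apply/eq_from_tnth => k.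
by rewrite tnth_mktuple !mxE /=; case: (tnth x k).
Qed.

Lemma measurable_Cn_coords : measurable_fun setT Cn_coords.
Proof. by move=> _ A mA; exists A. Qed.

Lemma measurable_Cn_of_coords : measurable_fun setT Cn_of_coords.
Proof.
move=> _ A [B mB <-]; rewrite !setTI -comp_preimage.
rewrite (_ : _ \o _ = id); first by rewrite preimage_id.
by apply/funext => x /=; rewrite Cn_of_coordsK.
Qed.

Lemma measurable_Re_coord (k : 'I_n) :
  measurable_fun setT (fun z : Cn R n => complex.Re (z 0 k)).
Proof.
rewrite (_ : (fun _ => _) = fst \o (@tnth _ _ ^~ k) \o Cn_coords); last first.
  by apply/funext => z /=; rewrite tnth_mktuple.
apply: measurableT_comp measurable_Cn_coords.
by apply: measurableT_comp => //; exact: measurable_tnth.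
Qed.

Lemma measurable_Im_coord (k : 'I_n) :
  measurable_fun setT (fun z : Cn R n => complex.Im (z 0 k)).
Proof.
rewrite (_ : (fun _ => _) = snd \o (@tnth _ _ ^~ k) \o Cn_coords); last first.
  by apply/funext => z /=; rewrite tnth_mktuple.
apply: measurableT_comp measurable_Cn_coords.
by apply: measurableT_comp => //; exact: measurable_tnth.
Qed.

End measurable_structure.

(* The library's sigma-finite instance of [\x] is restricted to
   subprobabilities. *)
Lemma sigma_finite_product d1 d2 (T1 : measurableType d1)
    (T2 : measurableType d2) (R : realType) (m1 : {measure set T1 -> \bar R})
    (m2 : {sigma_finite_measure set T2 -> \bar R}) :
  sigma_finite setT m1 -> sigma_finite setT (m1 \x m2)%E.
Proof.
move=> /sigma_finiteP[F [TF ndF Foo]].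
have /sigma_finiteP[G [TG ndG Goo]] := sigma_finiteT m2.
exists (fun n => F n `*` G n).
  rewrite -setXTT TF TG predeqE => -[x y]; split.
    move=> [/= [n _ Fnx] [k _ Gky]]; exists (maxn n k) => //; split.
    - by move: x Fnx; exact/subsetPset/ndF/leq_maxl.
    - by move: y Gky; exact/subsetPset/ndG/leq_maxr.
  by move=> [n _ []/= ? ?]; split; exists n.
move=> k; have [? ?] := Foo k; have [? ?] := Goo k.
split; first exact: measurableX.
by rewrite product_measure1E// lte_mul_pinfty// ge0_fin_numE.
Qed.

Section lebesgue_measure_Cn.
Variable R : realType.
Local Notation R2 := (measurableTypeR R * measurableTypeR R)%type.
Local Open Scope ereal_scope.

Let cons_pair n (x : R2 * n.-tuple R2) : n.+1.-tuple R2 :=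
  [the n.+1.-tuple R2 of x.1 :: x.2].

Let measurable_cons_pair n : measurable_fun setT (@cons_pair n).
Proof. exact: measurable_cons. Qed.

Let uncons n (x : n.+1.-tuple R2) : R2 * n.-tuple R2 :=
  (tnth x ord0, [tuple of behead x]).

Let measurable_uncons n : measurable_fun setT (@uncons n).
Proof.
apply/measurable_fun_pairP; split => /=.
  exact: measurable_tnth.
exact: measurable_behead.
Qed.

Let cons_pairK n : cancel (@cons_pair n) (@uncons n).
Proof. by move=> [x y]; congr (_, _); apply: val_inj. Qed.


Local Notation lebesgue2 := (@lebesgue_measure R \x @lebesgue_measure R).

Section lebesgue_cons.
Variables (n : nat).
Variable m : {sigma_finite_measure set (n.-tuple R2) -> \bar R}.

Definition lebesgue_cons : set (n.+1.-tuple R2) -> \bar R :=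
  pushforward (lebesgue2 \x m) (@cons_pair n).

Let lebesgue_cons0 : lebesgue_cons set0 = 0.
Proof. by rewrite /lebesgue_cons /pushforward preimage_set0 measure0. Qed.

Let lebesgue_cons_ge0 A : 0 <= lebesgue_cons A.
Proof. by rewrite /lebesgue_cons /pushforward measure_ge0. Qed.

Let lebesgue_cons_sigma_additive : semi_sigma_additive lebesgue_cons.
Proof.
apply: measure_semi_sigma_additive; exact: measurable_cons_pair.
Qed.

HB.instance Definition _ := isMeasure.Build _ _ _ lebesgue_cons
  lebesgue_cons0 lebesgue_cons_ge0 lebesgue_cons_sigma_additive.

Let lebesgue_cons_sigma_finite : sigma_finite setT lebesgue_cons.
Proof.
have [F FT Foo] : sigma_finite setT (lebesgue2 \x m).
  apply: sigma_finite_product; apply: sigma_finite_product.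
  exact: sigma_finiteT.
exists (fun i => @uncons n @^-1` F i).
  by rewrite -preimage_bigcup -FT preimage_setT.
move=> i; have [mF Fi] := Foo i; split.
  by rewrite -[X in measurable X]setTI; exact: measurable_uncons.
rewrite /lebesgue_cons /pushforward -comp_preimage.
rewrite (_ : _ \o _ = id) ?preimage_id//.
by apply/funext => x /=; rewrite cons_pairK.
Qed.

HB.instance Definition _ := Measure_isSigmaFinite.Build _ _ _ lebesgue_cons
  lebesgue_cons_sigma_finite.

End lebesgue_cons.

(* Lebesgue measure on R^2n: the n-th power of the product measure on R * R. *)
Fixpoint lebesgue_tuple (n : nat) :
    {sigma_finite_measure set (n.-tuple R2) -> \bar R} :=
  if n is n'.+1 then @lebesgue_cons n' (lebesgue_tuple n')
  else \d_ [tuple].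

End lebesgue_measure_Cn.

Definition lebesgue_Cn (R : realType) (n : nat) : set (Cn R n) -> \bar R :=
  pushforward (@lebesgue_tuple R n) (@Cn_of_coords R n).

Section lebesgue_Cn_measure.
Variables (R : realType) (n : nat).
Local Open Scope ereal_scope.
Local Notation leb := (@lebesgue_Cn R n).

Let lebesgue_Cn0 : leb set0 = 0.
Proof. by rewrite /lebesgue_Cn /pushforward preimage_set0 measure0. Qed.

Let lebesgue_Cn_ge0 A : 0 <= leb A.
Proof. by rewrite /lebesgue_Cn /pushforward measure_ge0. Qed.

Let lebesgue_Cn_sigma_additive : semi_sigma_additive leb.
Proof.
apply: measure_semi_sigma_additive; exact: measurable_Cn_of_coords.
Qed.

HB.instance Definition _ := isMeasure.Build _ _ _ leb
  lebesgue_Cn0 lebesgue_Cn_ge0 lebesgue_Cn_sigma_additive.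
End lebesgue_Cn_measure.

Section unit_ball.
Variables (R : realType) (n : nat).
Implicit Types a z w : Cn R n.

Definition cdot z w : R[i] := \sum_(k < n) z 0 k * (w 0 k)^*%C.

Definition enorm z : R := Num.sqrt (\sum_(k < n) Normc.normc (z 0 k) ^+ 2).

Definition unit_ball : set (Cn R n) := [set z | enorm z < 1].

(* The involutive automorphism of the ball exchanging 0 and [a] (see
   [moebius_facts] below). [P] is the orthogonal projection of [w] onto the line
   spanned by [a]; when [a = 0] the quotient is 0 by convention, so that [P = 0]
   and [moebius 0 w = - w]. *)
Definition moebius a w : Cn R n :=
  let P : Cn R n := (cdot w a / cdot a a) *: a in
  (1 - cdot w a)^-1 *: (a - P - (Num.sqrt (1 - enorm a ^+ 2))%:C *: (w - P)).

Definition bergman_dist z w : R :=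
  2^-1 * ln ((1 + enorm (moebius z w)) / (1 - enorm (moebius z w))).

Definition bergman_ball z (gamma : R) : set (Cn R n) :=
  [set w | unit_ball w /\ bergman_dist z w < gamma].

(* Complex (Frechet) differentiability: the scalar field of [Cn R n] and of
   [R[i]^o] is R[i]. *)
Definition holomorphic (f : Cn R n -> R[i]) : Prop :=
  forall z, unit_ball z -> differentiable (f : Cn R n -> R[i]^o) z.

Lemma measurable_enorm : measurable_fun setT enorm.
Proof.
rewrite (_ : enorm = @Num.sqrt R \o (fun z => \sum_(k < n)
  (complex.Re (z 0 k) ^+ 2 + complex.Im (z 0 k) ^+ 2))); last first.
  apply/funext => z; rewrite /enorm /=; congr Num.sqrt; apply: eq_bigr => k _.
  by case: (z 0 k) => x y; rewrite /Normc.normc /= sqr_sqrtr ?addr_ge0 ?sqr_ge0.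
apply: measurableT_comp.
  apply: continuous_measurable_fun; exact: sqrt_continuous.
apply: measurable_sum => k; apply: measurable_funD; apply: measurable_funX.
  exact: measurable_Re_coord.
exact: measurable_Im_coord.
Qed.

Lemma measurable_unit_ball : measurable unit_ball.
Proof.
rewrite (_ : unit_ball = enorm @^-1` `]-oo, 1[).
  rewrite -[X in measurable X]setTI; exact: measurable_enorm.
by apply/seteqP; split => z /=; rewrite in_itv.
Qed.

End unit_ball.

Section moebius_facts.
Variables (R : realType) (n : nat).
Implicit Types a z w u : Cn R n.

Lemma cdotDl u z w : cdot (u + z) w = cdot u w + cdot z w.
Proof. by rewrite -big_split; apply: eq_bigr => k _; rewrite mxE mulrDl. Qed.

Lemma cdotZl (c : R[i]) z w : cdot (c *: z) w = c * cdot z w.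
Proof. by rewrite mulr_sumr; apply: eq_bigr => k _; rewrite mxE mulrA. Qed.

Lemma cdotNl z w : cdot (- z) w = - cdot z w.
Proof. by rewrite -scaleN1r cdotZl mulN1r. Qed.

Lemma cdotC z w : cdot z w = (cdot w z)^*%C.
Proof.
rewrite /cdot rmorph_sum; apply: eq_bigr => k _.
by rewrite rmorphM /= conjcK mulrC.
Qed.

Lemma cdotDr u z w : cdot u (z + w) = cdot u z + cdot u w.
Proof. by rewrite cdotC cdotDl rmorphD /= -!cdotC. Qed.

Lemma cdotZr (c : R[i]) z w : cdot z (c *: w) = c^*%C * cdot z w.
Proof. by rewrite cdotC cdotZl rmorphM /= -cdotC. Qed.

Lemma cdotNr z w : cdot z (- w) = - cdot z w.
Proof. by rewrite cdotC cdotNl rmorphN /= -cdotC. Qed.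

Lemma normc_sqrE (c : R[i]) : c * c^*%C = (Normc.normc c ^+ 2)%:C.
Proof.
case: c => x y; rewrite /Normc.normc sqr_sqrtr ?addr_ge0 ?sqr_ge0//.
by apply/eqP; rewrite eq_complex /=; apply/andP; split; apply/eqP; ring.
Qed.

Lemma cdotE z : cdot z z = (enorm z ^+ 2)%:C.
Proof.
rewrite /enorm sqr_sqrtr; last by apply: sumr_ge0 => k _; exact: sqr_ge0.
rewrite rmorph_sum; apply: eq_bigr => k _.
by rewrite normc_sqrE.
Qed.

Lemma enorm_eq0 z : enorm z = 0 -> z = 0.
Proof.
move=> /eqP; rewrite sqrtr_eq0 => z0.
have := @psumr_eq0P _ _ (fun=> true) (fun k => Normc.normc (z 0 k) ^+ 2).
move=> /(_ (fun k _ => sqr_ge0 _)) H; apply/rowP => k; rewrite mxE.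
apply/Normc.eq0_normc/eqP; rewrite -sqrf_eq0; apply/eqP; apply: H => //.
by apply/eqP; rewrite eq_le z0/= sumr_ge0// => i _; exact: sqr_ge0.
Qed.

Lemma cdot0r z : cdot z 0 = 0.
Proof. by rewrite -(scale0r 0) cdotZr conjc0 mul0r. Qed.

Lemma cdot0l z : cdot 0 z = 0.
Proof. by rewrite -(scale0r 0) cdotZl mul0r. Qed.

Lemma cauchy_schwarz z w : Normc.normc (cdot z w) <= enorm z * enorm w.
Proof.
have [->|/eqP w0] := eqVneq w 0.
  by rewrite cdot0r Normc.normc0 mulr_ge0// sqrtr_ge0.
have W0 : 0 < enorm w ^+ 2.
  by rewrite exprn_gt0// lt_def sqrtr_ge0 andbT; apply/eqP => /enorm_eq0.
set c := cdot z w.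
have : 0 <= enorm ((enorm w ^+ 2)%:C *: z + (- c) *: w) ^+ 2 by exact: sqr_ge0.
have cc := normc_sqrE c.
suff -> : enorm ((enorm w ^+ 2)%:C *: z + (- c) *: w) ^+ 2 =
    enorm w ^+ 2 * (enorm z ^+ 2 * enorm w ^+ 2 - Normc.normc c ^+ 2).
  rewrite pmulr_rge0// subr_ge0 -exprMn.
  by rewrite ler_pXn2r// nnegrE ?mulr_ge0 ?sqrtr_ge0//; case: (c) => *; exact: sqrtr_ge0.
apply: (@complexI R); set u := (X in enorm X).
rewrite -(cdotE u) /u !(cdotDl, cdotZl, cdotDr, cdotZr).
rewrite (cdotC w z) -/c !cdotE conjc_real rmorphN /=.
have -> (x y t : R) : (x * (y * x - t))%:C = x%:C * (y%:C * x%:C - t%:C).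
  by rewrite -!rmorphM -rmorphB -rmorphM.
rewrite -cc.
by ring.
Qed.

Lemma moebius0 a : moebius a 0 = a.
Proof.
by rewrite /moebius cdot0l mul0r scale0r !subr0 invr1 scaler0 subr0 scale1r.
Qed.

Let s_ a : R := Num.sqrt (1 - enorm a ^+ 2).

Lemma ball_defect_gt0 a : unit_ball a -> 0 < 1 - enorm a ^+ 2.
Proof. by move=> a1; rewrite subr_gt0 exprn_ilt1// sqrtr_ge0. Qed.

Lemma ball_cdot_neq0 a w : unit_ball a -> unit_ball w -> 1 - cdot w a != 0.
Proof.
move=> a1 w1; rewrite subr_eq0; apply/eqP => e.
have := cauchy_schwarz w a; rewrite -e Normc.normc1.
by apply/negP; rewrite -ltNge mulr_ilt1// ?sqrtr_ge0.
Qed.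

Lemma moebius_self a : moebius a a = 0.
Proof.
have [->|a0] := eqVneq a 0; first by rewrite moebius0.
have aa : cdot a a != 0.
  by rewrite cdotE; apply: contraNN a0 => /eqP/complexI/eqP; rewrite sqrf_eq0 => /eqP/enorm_eq0 ->.
by rewrite /moebius divff// scale1r subrr scaler0 subr0 scaler0.
Qed.

Let proj_cdot a w : cdot w a / cdot a a * cdot a a = cdot w a.
Proof.
have [->|a0] := eqVneq a 0; first by rewrite cdot0r !mul0r.
rewrite divfK// cdotE; apply: contraNN a0 => /eqP/complexI/eqP.
by rewrite sqrf_eq0 => /eqP/enorm_eq0 ->.
Qed.

Let scale_proj a w : cdot a a *: ((cdot w a / cdot a a) *: a : Cn R n) = cdot w a *: a.
Proof. by rewrite scalerA mulrC proj_cdot. Qed.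

Let sqr_s a : unit_ball a -> (s_ a)%:C * (s_ a)%:C = 1 - cdot a a.
Proof.
move=> a1; rewrite -rmorphM /= -expr2 sqr_sqrtr; last exact/ltW/ball_defect_gt0.
by rewrite cdotE rmorphB rmorph1.
Qed.

Let cdot_moebius a w :
  cdot (moebius a w) a = (cdot a a - cdot w a) / (1 - cdot w a).
Proof.
by rewrite /moebius !(cdotDl, cdotNl, cdotZl) proj_cdot; ring.
Qed.

Lemma moebiusK a w : unit_ball a -> unit_ball w -> moebius a (moebius a w) = w.
Proof.
move=> a1 w1; have c1 := ball_cdot_neq0 a1 w1.
have A1 : 1 - cdot a a != 0 by exact: ball_cdot_neq0.
rewrite {1}/moebius cdot_moebius -/(s_ a).
have -> : 1 - (cdot a a - cdot w a) / (1 - cdot w a) =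
  (1 - cdot a a) / (1 - cdot w a) by field.
set P := (cdot w a / cdot a a) *: a.
have PE : cdot a a *: P = cdot w a *: a by exact: scale_proj.
have aE : (cdot a a / cdot a a) *: a = a :> Cn R n.
  have [->|a0] := eqVneq a 0; first by rewrite scaler0.
  rewrite divff ?scale1r// cdotE; apply: contraNN a0 => /eqP/complexI/eqP.
  by rewrite sqrf_eq0 => /eqP/enorm_eq0 ->.
have -> : ((cdot a a - cdot w a) / (1 - cdot w a) / cdot a a) *: a =
   (1 - cdot w a)^-1 *: (a - P) :> Cn R n.
  transitivity ((1 - cdot w a)^-1 *: ((cdot a a / cdot a a) *: a - P) : Cn R n).
    by rewrite /P -scalerBl scalerA; congr (_ *: _); ring.
  by rewrite aE.
have -> : moebius a w - (1 - cdot w a)^-1 *: (a - P) =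
   (- (1 - cdot w a)^-1 * (s_ a)%:C) *: (w - P).
  by rewrite /moebius -/P -/(s_ a) scalerBr addrAC subrr add0r scalerA mulNr scaleNr.
rewrite scalerA.
have -> : (s_ a)%:C * (- (1 - cdot w a)^-1 * (s_ a)%:C) =
   - ((1 - cdot a a) / (1 - cdot w a)).
  by rewrite -(sqr_s a1); ring.
apply: (scalerI A1); apply/rowP => k; move/rowP/(_ k): PE; rewrite !mxE.
set p := cdot w a / cdot a a * a 0 k => PE.
transitivity ((1 - cdot a a) * w 0 k + (cdot a a * p - cdot w a * a 0 k)).
  by field; rewrite A1 c1.
by rewrite PE subrr addr0.
Qed.

Lemma moebius_defect a w : unit_ball a -> unit_ball w ->
  (1 - enorm (moebius a w) ^+ 2) * Normc.normc (1 - cdot w a) ^+ 2 =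
  (1 - enorm a ^+ 2) * (1 - enorm w ^+ 2).
Proof.
move=> a1 w1; have c1 := ball_cdot_neq0 a1 w1.
apply: (@complexI R).
have E (x y : R) : ((1 - x) * y)%:C = (1 - x%:C) * y%:C.
  by rewrite rmorphM rmorphB rmorph1.
rewrite !E -normc_sqrE [in RHS]rmorphB rmorph1 /= -!cdotE /moebius -/(s_ a).
set k := cdot w a / cdot a a.
have ck : cdot w a = k * cdot a a by rewrite proj_cdot.
have s2 := sqr_s a1.
have s2' : cdot a a = 1 - (s_ a)%:C * (s_ a)%:C by rewrite s2; ring.
have aR : (cdot a a)^*%C = cdot a a by rewrite -cdotC.
have c1' : (1 - cdot w a)^*%C != 0 by rewrite fmorph_eq0.
set N := (X in cdot (_ *: X)).
have NN : (1 - cdot w a) * (1 - cdot w a)^*%C - cdot N N =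
    (1 - cdot a a) * (1 - cdot w w).
  rewrite /N !(cdotDl, cdotNl, cdotZl, cdotDr, cdotNr, cdotZr) conjc_real.
  rewrite (cdotC a w) rmorphB rmorph1 /= ck rmorphM /= aR s2'.
  by ring.
rewrite cdotZl cdotZr fmorphV /= -/N -NN.
by field; apply/andP; split=> //; rewrite -(rmorph1 (conjc (R := R))) -rmorphB.
Qed.

Lemma moebius_ball a w :
  unit_ball a -> unit_ball w -> unit_ball (moebius a w).
Proof.
move=> a1 w1; have := moebius_defect a1 w1.
have d0 : 0 < Normc.normc (1 - cdot w a) ^+ 2.
  rewrite exprn_gt0// lt_def; apply/andP; split.
    by apply: contraNN (ball_cdot_neq0 a1 w1) => /eqP/Normc.eq0_normc ->.
  by case: (1 - _) => *; exact: sqrtr_ge0.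
have : 0 < (1 - enorm a ^+ 2) * (1 - enorm w ^+ 2).
  by rewrite mulr_gt0// ball_defect_gt0.
move=> /[swap] <-; rewrite pmulr_lgt0// subr_gt0 /unit_ball /= => H.
by rewrite -(@ltr_pXn2r _ 2)// ?nnegrE ?sqrtr_ge0// expr1n.
Qed.

End moebius_facts.

Section density.
Local Open Scope ereal_scope.
Variables (d : measure_display) (T : measurableType d) (R : realType).
Variables (mu : {measure set T -> \bar R}) (h : T -> R).

Definition density (A : set T) : \bar R := \int[mu]_(x in A) (h x)%:E.

Hypothesis h_ge0 : forall x, (0 <= h x)%R.
Hypothesis measurable_h : measurable_fun setT h.

Let density0 : density set0 = 0.
Proof. by rewrite /density integral_set0. Qed.

Let density_ge0 A : 0 <= density A.
Proof. by apply: integral_ge0 => x _; rewrite lee_fin. Qed.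

Let density_sigma_additive : semi_sigma_additive density.
Proof.
move=> F mF tF mUF; rewrite /density ge0_integral_bigcup//=.
- apply: is_cvg_ereal_nneg_natsum_cond => k _ _.
  by apply: integral_ge0 => x _; rewrite lee_fin.
- by apply/measurable_EFinP; apply: measurable_funTS.
- by move=> x _; rewrite lee_fin.
Qed.

HB.instance Definition _ := isMeasure.Build _ _ _
  density density0 density_ge0 density_sigma_additive.

Definition density_measure : {measure set T -> \bar R} := density.

End density.

Definition Gamma (R : realType) (x : R) : R :=
  \int[@lebesgue_measure R]_(t in `]0, +oo[) (t `^ (x - 1) * expR (- t)).

Lemma Gamma_ge0 (R : realType) (x : R) : 0 <= Gamma x.
Proof.
by apply: Rintegral_ge0 => t _; rewrite mulr_ge0 ?powR_ge0 ?expR_ge0.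
Qed.

Section measures_on_unit_ball.
Variables (R : realType) (n : nat).
Notation B := (@unit_ball R n).

Let vol_inv_ge0 : 0 <= (fine (@lebesgue_Cn R n B))^-1.
Proof. by rewrite invr_ge0 fine_ge0. Qed.

(* Normalized Lebesgue measure on the ball, extended by 0 to C^n. *)
Definition dv : {measure set (Cn R n) -> \bar R} :=
  mscale (NngNum vol_inv_ge0)
    (mrestr (@lebesgue_Cn R n) (@measurable_unit_ball R n)).

Definition c_alpha (alpha : R) : R :=
  Gamma (n%:R + alpha + 1) / (n`!%:R * Gamma (alpha + 1)).

(* The real power is total ([x `^ r = 1] for [x < 0], [r != 0]), but [dv] does
   not charge the complement of the ball, where [1 - enorm z ^+ 2 <= 0]. *)
Definition dv_density (alpha : R) (z : Cn R n) : R :=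
  c_alpha alpha * (1 - enorm z ^+ 2) `^ alpha.

Definition tau_density (z : Cn R n) : R :=
  (1 - enorm z ^+ 2) `^ (- n.+1%:R).

Lemma measurable_defect_powR (r : R) :
  measurable_fun setT (fun z : Cn R n => (1 - enorm z ^+ 2) `^ r).
Proof.
apply: (measurableT_comp (measurable_powR r)).
apply: measurable_funB => //; apply: measurable_funX; exact: measurable_enorm.
Qed.

Lemma dv_density_ge0 alpha z : 0 <= dv_density alpha z.
Proof. by rewrite !(mulr_ge0, invr_ge0, Gamma_ge0, powR_ge0). Qed.

Lemma measurable_dv_density alpha : measurable_fun setT (dv_density alpha).
Proof. apply: measurable_funM => //; exact: measurable_defect_powR. Qed.

Lemma tau_density_ge0 z : 0 <= tau_density z.
Proof. exact: powR_ge0. Qed.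

Lemma measurable_tau_density : measurable_fun setT tau_density.
Proof. exact: measurable_defect_powR. Qed.

Definition dv_alpha (alpha : R) : {measure set (Cn R n) -> \bar R} :=
  density_measure dv (dv_density_ge0 alpha) (measurable_dv_density alpha).

Definition tau : {measure set (Cn R n) -> \bar R} :=
  density_measure dv tau_density_ge0 measurable_tau_density.

End measures_on_unit_ball.

Section norms_and_operators.
Variables (R : realType) (n : nat).
Local Open Scope ereal_scope.
Implicit Types (g : Cn R n -> \bar R) (f : Cn R n -> R[i]) (z w : Cn R n).
Implicit Types gamma q alpha p : R.
Notation B := (@unit_ball R n).

Definition norm_alpha p alpha g : \bar R :=
  (\int[dv_alpha n alpha]_(z in B) (`|g z| `^ p)) `^ p^-1.

Definition in_Lp p alpha g : Prop :=
  measurable_fun B g /\ norm_alpha p alpha g < +oo.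

Definition modulus f z : \bar R := (Normc.normc (f z))%:E.

Definition bergman_space p alpha f : Prop :=
  holomorphic f /\ norm_alpha p alpha (modulus f) < +oo.

Definition A_op gamma q f z : \bar R :=
  (\int[tau R n]_(w in bergman_ball z gamma) (modulus f w `^ q)) `^ q^-1.

Definition M_op alpha gamma q f z : \bar R :=
  ereal_sup [set ((dv_alpha n alpha (bergman_ball w gamma))^-1 *
      \int[dv_alpha n alpha]_(u in bergman_ball w gamma) (modulus f u `^ q)) `^ q^-1
    | w in [set w | B w /\ bergman_ball w gamma z]].

Definition comparable_with (C : R) (X Y : \bar R) : Prop :=
  (C^-1)%:E * Y <= X <= C%:E * Y.

End norms_and_operators.

(* Main.v *)
(* Pointwise, [|f z| <= C A f z <= C' M f z], and [M] is dominated in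
   norm by [f], so the three norms are comparable in a cycle.
   - The sub-mean value property [|f z|^p <= C \int_(D(z,gamma)) |f|^p dtau] holds
     for every [p > 0]; with [p = q] it gives the first inequality.
   - On [D(z,gamma)] the weight [1 - |w|^2] is comparable to [1 - |z|^2], and
     [v (D(z,gamma)) <= C (1 - |z|^2)^(n+1)]; hence [dtau] is at most a multiple of
     [dv_alpha / v_alpha (D(z,gamma))] there, which is the second inequality.
   - If [z \in D(w,gamma)] and [u \in D(w,gamma)], the sub-mean value property at
     [u] and the quasi-triangle inequality bound [|f u|^p] by the integral of
     [|f|^p dtau] over a larger ball around [z]; this bounds [(M f z)^p], and
     integrating in [z] with Tonelli's theorem gives [||M f|| <= C ||f||].
   The sub-mean value property comes from one variable. Goursat's bisection
   shows that a complex differentiable [g] has zero flux through the boundary of a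
   square, even with an exceptional point of continuity, so Cauchy's formula
   bounds [|g c|] by means of [|g|] over squares; exponents [p] other than [1] are
   then reached by real-variable arguments. Iterating over the coordinates,
   after a linear shear, gives means over regions of size [sqrt (1 - |z|^2)] in
   the directions orthogonal to [z] and [1 - |z|^2] in the direction of [z]. *)

From HB Require Import structures.
Require Import Defs.
From mathcomp Require Import all_boot all_order all_algebra.
From mathcomp Require Import all_classical all_reals all_analysis complex.
From mathcomp Require Import measurable_realfun ring lra zify.

Set Implicit Arguments.
Unset Strict Implicit.
Unset Printing Implicit Defensive.

Import Order.TTheory GRing.Theory Num.Theory.
Import numFieldNormedType.Exports.

Local Open Scope classical_set_scope.
Local Open Scope complex_scope.
Local Open Scope ring_scope.

(** * Flux through the boundary of a square *)

(** Two obstacles shape the proof. The derivative of a holomorphic function is not assumed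
    continuous, so Green's formula is out of reach. Goursat's estimate is run instead on the
    difference quotient [(g w - g c) / (w - c)], which is differentiable away from [c] but only
    continuous at [c]: hence the exceptional point. The other obstacle is that [M] averages [|f|^q]
    while the norm has exponent [p]; the maximal theorem applied to [|f|^q] would require [p > q].
    The averages are therefore bounded by a supremum of [|f|], and the mean value property with
    exponent [p] itself, however small, turns this supremum into an integral of [|f|^p]. This is
    what forces the exponents below 1. Bergman balls enter through the relation [near]: since [1 -
    |phi_z(w)|^2 = (1 - |z|^2)(1 - |w|^2) / |1 - <z,w>|^2], their geometry reduces to estimates of
    [|1 - <z,w>|], which satisfies a quasi-triangle inequality. Each ball contains a box of known
    volume and is contained in another one of comparable size: the inner box carries the mean value
    property, the outer one bounds the volume. *)

Section bisection.
Variable R : realType.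
Implicit Types x y s : R.

(** A bad square has a bad quarter, and so on; the nested squares shrink to one point, where the
    local hypothesis is contradicted. This is compactness of the square in a form that serves both
    for Goursat's theorem and for [cdiff_bounded]. *)
Lemma square_bisection (P : R -> R -> R -> Prop) x0 y0 s0 : 0 < s0 ->
  (forall x y s, 0 < s -> P x y (s / 2) -> P (x + s / 2) y (s / 2) ->
     P x (y + s / 2) (s / 2) -> P (x + s / 2) (y + s / 2) (s / 2) -> P x y s) ->
  (forall p q, x0 <= p <= x0 + s0 -> y0 <= q <= y0 + s0 ->
     exists2 d, 0 < d & forall x y s, 0 < s < d ->
       x <= p <= x + s -> y <= q <= y + s -> P x y s) ->
  P x0 y0 s0.
Proof.
move=> s0_gt0 Pglue Ploc; apply: contrapT => nP.
(* The choice is made total, with a dummy [(0, 0, 0)] when [t] is not bad, so that it can be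
   iterated as a function. *)
have step (t : R * R * R) : exists u : R * R * R,
    0 < t.2 -> ~ P t.1.1 t.1.2 t.2 ->
    [/\ ~ P u.1.1 u.1.2 u.2, u.2 = t.2 / 2, t.1.1 <= u.1.1 <= t.1.1 + t.2 / 2 &
        t.1.2 <= u.1.2 <= t.1.2 + t.2 / 2].
  case: t => [[x y] s] /=.
  have [s_gt0|s_le0] := ltP 0 s; last by exists (0, 0, 0).
  have h : 0 <= s / 2 by rewrite divr_ge0// ltW.
  have [nPxy|/contrapT Pxy] := pselect (~ P x y s); last by exists (0, 0, 0).
  have [P1|P1] := pselect (P x y (s / 2)); last first.
    by exists (x, y, s / 2) => _ _ /=; split => //; lra.
  have [P2|P2] := pselect (P (x + s / 2) y (s / 2)); last first.
    by exists (x + s / 2, y, s / 2) => _ _ /=; split => //; lra.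
  have [P3|P3] := pselect (P x (y + s / 2) (s / 2)); last first.
    by exists (x, y + s / 2, s / 2) => _ _ /=; split => //; lra.
  have [P4|P4] := pselect (P (x + s / 2) (y + s / 2) (s / 2)); last first.
    by exists (x + s / 2, y + s / 2, s / 2) => _ _ /=; split => //; lra.
  by case: nPxy; exact: Pglue.
pose next t := projT1 (cid (step t)).
pose u n := iter n next (x0, y0, s0).
have uP n : [/\ ~ P (u n).1.1 (u n).1.2 (u n).2 & (u n).2 = s0 / 2 ^+ n].
  elim: n => [|n [nPn sn]]; first by split; rewrite ?expr0 ?divr1.
  have [] := projT2 (cid (step (u n))) _ nPn.
    by rewrite sn divr_gt0// exprn_gt0.
  move=> nP' sE _ _; split=> //.
  by rewrite [LHS]sE sn exprSr invfM mulrA.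
have s_gt0 n : 0 < (u n).2 by rewrite (uP n).2 divr_gt0// exprn_gt0.
have uS n : (u n).1.1 <= (u n.+1).1.1 <= (u n).1.1 + (u n).2 / 2 /\
            (u n).1.2 <= (u n.+1).1.2 <= (u n).1.2 + (u n).2 / 2.
  by have [] := projT2 (cid (step (u n))) (s_gt0 n) (uP n).1.
have sS n : (u n.+1).2 = (u n).2 / 2.
  by rewrite (uP n.+1).2 (uP n).2 exprSr invfM mulrA.
(* The left ends are nondecreasing and every right end [a n + (u n).2] bounds them all, so their
   supremum lies in all the intervals. *)
have limit (a : nat -> R) : (forall n, a n <= a n.+1 <= a n + (u n).2 / 2) ->
    exists p, forall n, a n <= p <= a n + (u n).2.
  move=> aS.
  have amono n k : a n <= a (n + k)%N.
    elim: k => [|k IH]; first by rewrite addn0.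
    by rewrite addnS (le_trans IH)//; case/andP: (aS (n + k)%N).
  have aup n k : a (n + k)%N + (u (n + k)%N).2 <= a n + (u n).2.
    elim: k => [|k IH]; first by rewrite addn0.
    by rewrite addnS; apply: le_trans IH; rewrite sS; have := aS (n + k)%N; lra.
  have aub n m : a m <= a n + (u n).2.
    have := s_gt0 (n + m)%N; have := aup n m; have := amono m n.
    by rewrite addnC; lra.
  exists (sup (range a)) => n; apply/andP; split.
    apply: ub_le_sup; last by exists n.
    by exists (a n + (u n).2) => _ [m _ <-].
  by apply: ge_sup; [exists (a n), n|move=> _ [m _ <-]].
have [p pP] := limit (fun n => (u n).1.1) (fun n => (uS n).1).
have [q qP] := limit (fun n => (u n).1.2) (fun n => (uS n).2).
have [d d0 Pd] := Ploc p q (pP 0%N) (qP 0%N).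
have [n sn] : exists n, (u n).2 < d.
  have [n nP'] : exists n : nat, s0 / d < n%:R.
    by exists (Num.bound (s0 / d)); rewrite archi_boundP// divr_ge0// ltW.
  exists n; rewrite (uP n).2 ltr_pdivrMr ?exprn_gt0//.
  rewrite mulrC -ltr_pdivrMr//; apply: lt_trans nP' _.
  by rewrite -natrX ltr_nat ltn_expl.
have [nPn _] := uP n; apply: nPn; apply: Pd => //.
by rewrite s_gt0.
Qed.

End bisection.

Section flux.
Variable R : realType.
Implicit Types (F : R -> R -> R) (x y s p q : R).
Local Notation mu := (@lebesgue_measure R).

Definition cont2 F p q := forall e, 0 < e -> exists2 d, 0 < d &
  forall x y, `|x - p| < d -> `|y - q| < d -> `|F x y - F p q| < e.

(* Frechet differentiability at [(p, q)] of the field [(F1, F2)], with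
   vanishing divergence there. *)
Definition divfree F1 F2 p q := exists A B C, forall e, 0 < e ->
  exists2 d, 0 < d & forall x y, `|x - p| < d -> `|y - q| < d ->
    `|F1 x y - F1 p q - A * (x - p) - B * (y - q)| <= e * (`|x - p| + `|y - q|) /\
    `|F2 x y - F2 p q - C * (x - p) + A * (y - q)| <= e * (`|x - p| + `|y - q|).

Definition edge (f : R -> R) x s : R := \int[mu]_(t in `[x, x + s]) f t.

(** Outward flux of [(F1, F2)] through the boundary of a square. For [F1 = Re h] and [F2 = - Im h]
    it is the imaginary part of the integral of [h dz] along the boundary. *)
Definition flux F1 F2 x y s : R :=
  edge (F1 (x + s)) y s - edge (F1 x) y s +
  (edge (F2^~ (y + s)) x s - edge (F2^~ y) x s).

Definition cont1 (f : R -> R) x s := {within `[x, x + s], continuous f}.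

Lemma edge_integrable f x s : cont1 f x s ->
  mu.-integrable `[x, x + s] (EFin \o f).
Proof.
by move=> cf; apply: continuous_compact_integrable => //; exact: segment_compact.
Qed.

Lemma edge_split f x s : 0 < s -> cont1 f x s ->
  edge f x s = edge f x (s / 2) + edge f (x + s / 2) (s / 2).
Proof.
move=> s0 cf; have fi := edge_integrable cf; rewrite /edge.
have ax : (BLeft x <= BRight (x + s / 2))%O by rewrite bnd_simp; lra.
have xb : (BRight (x + s / 2) <= BRight (x + s))%O by rewrite bnd_simp; lra.
rewrite -(subrK (\int[mu]_(t in `[x, x + s / 2]) f t) (\int[mu]_(t in `[x, x + s]) f t)).
rewrite addrC; congr (_ + _).
rewrite (Rintegral_itvB fi ax xb) Rintegral_itv_obnd_cbnd.
  by have -> : x + s / 2 + s / 2 = x + s by lra.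
apply: integrableS fi => // t /=; rewrite !in_itv/=; lra.
Qed.

Lemma edge_norm_le f x s c : 0 <= s -> cont1 f x s ->
  (forall t, x <= t <= x + s -> `|f t| <= c) -> `|edge f x s| <= c * s.
Proof.
move=> s0 cf fc; have fi := edge_integrable cf.
apply: (le_trans (le_normr_Rintegral _ fi)) => //.
have -> : c * s = \int[mu]_(t in `[x, x + s]) c.
  rewrite Rintegral_cst//= lebesgue_measure_itv/= lte_fin.
  case: ltP => xs /=; first by congr (_ * _); lra.
  by have -> : s = 0 by lra.
apply: le_Rintegral => //.
- exact: integrable_norm fi.
- apply: continuous_compact_integrable; first exact: segment_compact.
  by apply: continuous_subspaceT => t; exact: cvg_cst.
Qed.

Lemma edgeB f g x s : cont1 f x s -> cont1 g x s ->
  edge f x s - edge g x s = edge (fun t => f t - g t) x s.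
Proof.
by move=> cf cg; rewrite /edge RintegralB//; exact: edge_integrable.
Qed.

Lemma edge_cst c x s : 0 <= s -> edge (fun=> c) x s = c * s.
Proof.
move=> s0; rewrite /edge Rintegral_cst//= lebesgue_measure_itv/= lte_fin.
case: ltP => xs /=; first by congr (_ * _); lra.
by have -> : s = 0 by lra.
Qed.

Lemma edge_diff_le f g a x s c : 0 <= s -> cont1 f x s -> cont1 g x s ->
  (forall t, x <= t <= x + s -> `|f t - g t - a| <= c) ->
  `|edge f x s - edge g x s - a * s| <= c * s.
Proof.
move=> s0 cf cg fgc; rewrite edgeB// -(edge_cst a x s0) edgeB.
- apply: edge_norm_le => //.
  move=> t; apply: cvgB; last exact: cvg_cst.
  by apply: cvgB; [exact: cf|exact: cg].
- by move=> t; apply: cvgB; [exact: cf|exact: cg].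
- by move=> t; exact: cvg_cst.
Qed.

Lemma cont2_cont1l F x s y : (forall t, x <= t <= x + s -> cont2 F t y) ->
  cont1 (F^~ y) x s.
Proof.
move=> cF; apply: continuous_in_subspaceT => t.
rewrite inE/= in_itv/= => /cF cFt; apply/cvgrPdist_lt => e e0.
have [d d0 dF] := cFt _ e0; exists d => //= u tu.
by rewrite distrC dF ?subrr ?normr0// distrC.
Qed.

Lemma cont2_cont1r F x y s : (forall t, y <= t <= y + s -> cont2 F x t) ->
  cont1 (F x) y s.
Proof.
move=> cF; apply: continuous_in_subspaceT => t.
rewrite inE/= in_itv/= => /cF cFt; apply/cvgrPdist_lt => e e0.
have [d d0 dF] := cFt _ e0; exists d => //= u tu.
by rewrite distrC dF ?subrr ?normr0// distrC.
Qed.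

Section flux_square.
Variables (F1 F2 : R -> R -> R).

Lemma flux_split x y s : 0 < s ->
  (forall p q, x <= p <= x + s -> y <= q <= y + s -> cont2 F1 p q /\ cont2 F2 p q) ->
  flux F1 F2 x y s =
    flux F1 F2 x y (s / 2) + flux F1 F2 (x + s / 2) y (s / 2) +
    (flux F1 F2 x (y + s / 2) (s / 2) + flux F1 F2 (x + s / 2) (y + s / 2) (s / 2)).
Proof.
move=> s0 cF; rewrite /flux.
have c1 p : x <= p <= x + s -> cont1 (F1 p) y s.
  by move=> xp; apply: cont2_cont1r => t yt; have [] := cF p t xp yt.
have c2 q : y <= q <= y + s -> cont1 (F2^~ q) x s.
  by move=> yq; apply: cont2_cont1l => t xt; have [] := cF t q xt yq.
have h (u : R) : u + s / 2 + s / 2 = u + s by lra.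
rewrite !h !(@edge_split _ _ s)//; try by [apply: c1; lra|apply: c2; lra].
ring.
Qed.

(** Both pairs of opposite sides are compared with the same [A]: the contributions [A * s] and
    [- A * s] cancel, which is where a vanishing divergence acts. *)
Lemma flux_small x y s e A : 0 <= s ->
  (forall u v, x <= u <= x + s -> y <= v <= y + s -> cont2 F1 u v /\ cont2 F2 u v) ->
  (forall t, y <= t <= y + s -> `|F1 (x + s) t - F1 x t - A| <= e) ->
  (forall t, x <= t <= x + s -> `|F2 t (y + s) - F2 t y + A| <= e) ->
  `|flux F1 F2 x y s| <= 2 * e * s.
Proof.
move=> s0 cF F1e F2e.
have k1 u : x <= u <= x + s -> cont1 (F1 u) y s.
  by move=> xp; apply: cont2_cont1r => t yt; have [] := cF u t xp yt.
have k2 v : y <= v <= y + s -> cont1 (F2^~ v) x s.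
  by move=> yq; apply: cont2_cont1l => t xt; have [] := cF t v xt yq.
have := @edge_diff_le (F1 (x + s)) (F1 x) A y s e s0.
have := @edge_diff_le (F2^~ (y + s)) (F2^~ y) (- A) x s e s0.
move=> /(_ (k2 _ _) (k2 _ _)) H2 /(_ (k1 _ _) (k1 _ _)) H1.
have {}H1 := H1 ltac:(lra) ltac:(lra) F1e.
have {}H2 := H2 ltac:(lra) ltac:(lra).
have {H2} := H2 ltac:(by move=> t xt; rewrite opprK; exact: F2e).
move: H1; rewrite /flux !ler_norml; lra.
Qed.

Lemma itv_dist_le x s u p : x <= u <= x + s -> x <= p <= x + s -> `|u - p| <= s.
Proof. by move=> xu xp; rewrite ler_norml; lra. Qed.

Let itv_left x s : 0 < s -> x <= x <= x + s.
Proof. by move=> s0; rewrite lexx lerDl ltW. Qed.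

Let itv_right x s : 0 < s -> x <= x + s <= x + s.
Proof. by move=> s0; rewrite lexx andbT lerDl ltW. Qed.

(** At a point of mere continuity the flux is only known to be of order [s], not of order [s ^+ 2];
    this is the estimate for squares at the exceptional point. *)
Lemma flux_cont2_le p q : cont2 F1 p q -> cont2 F2 p q ->
  exists2 d, 0 < d & forall x y s, 0 < s < d ->
    x <= p <= x + s -> y <= q <= y + s ->
    (forall u v, x <= u <= x + s -> y <= v <= y + s -> cont2 F1 u v /\ cont2 F2 u v) ->
    `|flux F1 F2 x y s| <= 4 * s.
Proof.
move=> cF1 cF2; have [d1 d1_gt0 D1] := cF1 _ ltr01; have [d2 d2_gt0 D2] := cF2 _ ltr01.
exists (Num.min d1 d2); first by rewrite lt_min d1_gt0.
move=> x y s; rewrite lt_min => /and3P[s0 sd1 sd2] xp yq cF.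
have near1 u v : x <= u <= x + s -> y <= v <= y + s ->
    `|F1 u v - F1 p q| < 1 /\ `|F2 u v - F2 p q| < 1.
  by move=> xu yv; split; [apply: D1|apply: D2];
    apply: le_lt_trans (itv_dist_le _ _) _; eauto.
have xl := itv_left x s0; have xr := itv_right x s0.
have yl := itv_left y s0; have yr := itv_right y s0.
have diff2 (a b c : R) : `|a - c| < 1 -> `|b - c| < 1 -> `|a - b| <= 2.
  by rewrite ler_norml !ltr_norml; clear; lra.
have -> : 4 * s = 2 * 2 * s by congr (_ * _); rewrite -natrM.
apply: (@flux_small _ _ _ _ 0) => //; first exact: ltW.
- move=> t yt; rewrite subr0; apply: diff2 (near1 _ _ xr yt).1 (near1 _ _ xl yt).1.
- move=> t xt; rewrite addr0; apply: diff2 (near1 _ _ xt yr).2 (near1 _ _ xt yl).2.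
Qed.

(** The affine part of the field has no flux, and the remainder is a small multiple of [s] along
    sides of length [s]. *)
Lemma flux_divfree_le p q e : 0 < e -> divfree F1 F2 p q ->
  exists2 d, 0 < d & forall x y s, 0 < s < d ->
    x <= p <= x + s -> y <= q <= y + s ->
    (forall u v, x <= u <= x + s -> y <= v <= y + s -> cont2 F1 u v /\ cont2 F2 u v) ->
    `|flux F1 F2 x y s| <= e * s ^+ 2.
Proof.
move=> e0 [A [B [C D]]]; have e8 : 0 < e / 8 by rewrite divr_gt0.
have [d d0 Dd] := D _ e8; exists d => // x y s /andP[s0 sd] xp yq cF.
have H u v : x <= u <= x + s -> y <= v <= y + s ->
    `|F1 u v - F1 p q - A * (u - p) - B * (v - q)| <= e / 4 * s /\
    `|F2 u v - F2 p q - C * (u - p) + A * (v - q)| <= e / 4 * s.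
  move=> xu yv; have up := itv_dist_le xu xp; have vq := itv_dist_le yv yq.
  have [] := Dd u v (le_lt_trans up sd) (le_lt_trans vq sd).
  have : e / 8 * (`|u - p| + `|v - q|) <= e / 4 * s.
    have -> : e / 4 * s = e / 8 * (s + s) by field.
    by apply: ler_wpM2l; [exact: ltW|exact: lerD].
  by move=> h h1 h2; split; [exact: le_trans h1 h|exact: le_trans h2 h].
have xl := itv_left x s0; have xr := itv_right x s0.
have yl := itv_left y s0; have yr := itv_right y s0.
have -> : e * s ^+ 2 = 2 * (e / 2 * s) * s by field.
apply: (@flux_small _ _ _ _ (A * s)) => //; first exact: ltW.
- move=> t yt; have := (H _ _ xr yt).1; have := (H _ _ xl yt).1.
  by move: (F1 (x + s) t) (F1 x t) (F1 p q) => f1 f2 f3; rewrite !ler_norml; clear; lra.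
- move=> t xt; have := (H _ _ xt yr).2; have := (H _ _ xt yl).2.
  by move: (F2 t (y + s)) (F2 t y) (F2 p q) => f1 f2 f3; rewrite !ler_norml; clear; lra.
Qed.

Let w (p x s : R) : R := (x <= p < x + s)%R%:R + (x < p <= x + s)%R%:R.

Let w_split p x s : 0 < s -> w p x s = w p x (s / 2) + w p (x + s / 2) (s / 2).
Proof.
move=> s0; have s20 : 0 < s / 2 by rewrite divr_gt0.
have sE : x + s / 2 + s / 2 = x + s by rewrite -addrA -splitr.
have xm : x < x + s / 2 by rewrite ltrDl.
have ms : x + s / 2 < x + s by rewrite -sE ltrDl.
rewrite /w sE; case: (ltrgtP p (x + s / 2)) => [pm|mp|->].
- by have ps := lt_trans pm ms; rewrite ps (ltW ps) !andbT /= !addr0.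
- by have xp := lt_trans xm mp; rewrite xp (ltW xp) /= ?(addr0, add0r).
- by rewrite xm ms !ltW//= ?(addr0, add0r).
Qed.

Let w_ge0 p x s : 0 <= w p x s.
Proof. by rewrite addr_ge0. Qed.

Let w_le2 p x s : w p x s <= 2.
Proof. by rewrite /w; do 2 case: (_ && _); rewrite /= ?addr0 ?add0r ?ler_nat ?ler1n. Qed.

Let w_ge1 p x s : 0 < s -> x <= p <= x + s -> 1 <= w p x s.
Proof.
move=> s0 /andP[xp ps]; rewrite /w xp ps !andbT /=.
have [ps'|sp] := ltP p (x + s); first by rewrite lerDl.
by rewrite (lt_le_trans _ sp) ?ltrDl// add0r.
Qed.

(* [w] weighs the bisected squares that contain the exceptional point, by 1 at
   an end of a side and by 2 inside: it is additive under bisection. *)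
Lemma flux_eq0 x0 y0 s0 a b : 0 < s0 ->
  (forall p q, x0 <= p <= x0 + s0 -> y0 <= q <= y0 + s0 ->
     [/\ cont2 F1 p q, cont2 F2 p q & (p, q) != (a, b) -> divfree F1 F2 p q]) ->
  flux F1 F2 x0 y0 s0 = 0.
Proof.
move=> s0_gt0 HF; apply/eqP; rewrite -normr_le0.
apply/ler_addgt0Pr => e e0; rewrite add0r.
pose inS x y s := [/\ x0 <= x, x + s <= x0 + s0, y0 <= y & y + s <= y0 + s0].
have cF x y s : inS x y s -> forall u v, x <= u <= x + s -> y <= v <= y + s ->
    cont2 F1 u v /\ cont2 F2 u v.
  move=> [xx ss yy tt] u v /andP[xu us] /andP[yv vs].
  have [] // := HF u v _ _.
    by rewrite (le_trans xx xu) (le_trans us ss).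
  by rewrite (le_trans yy yv) (le_trans vs tt).
have s2 : 0 < s0 ^+ 2 by rewrite exprn_gt0.
(* On the whole square the area is [s0 ^+ 2] and the two weights multiply to at most 4. *)
have [e1 e1_gt0 e1E] : exists2 e1, 0 < e1 & e1 * (s0 ^+ 2 + 4) = e.
  exists (e / (s0 ^+ 2 + 4)); first by rewrite divr_gt0// addr_gt0.
  by rewrite divfK// gt_eqF// addr_gt0.
(* Regular squares pay with their area, squares containing [(a, b)] with their weight; both budgets
   are additive under bisection. *)
pose P x y s := inS x y s ->
  `|flux F1 F2 x y s| <= e1 * s ^+ 2 + e1 * (w a x s * w b y s).
suff /(_ _) : P x0 y0 s0.
  move=> /(_ ltac:(by split)) /le_trans; apply.
  rewrite -e1E -mulrDr ler_wpM2l ?(ltW e1_gt0)// lerD2l.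
  by apply: le_trans (ler_pM (w_ge0 _ _ _) (w_ge0 _ _ _) (w_le2 _ _ _) (w_le2 _ _ _)) _;
    rewrite -natrM.
apply: square_bisection => //.
- move=> x y s sgt0 H1 H2 H3 H4 xS; have [xx ss yy tt] := xS.
  rewrite flux_split//; last exact: cF.
  have s20 : 0 <= s / 2 by rewrite divr_ge0// ltW.
  have sE z : z + s / 2 + s / 2 = z + s by rewrite -addrA -splitr.
  have half z c : z + s <= c -> z + s / 2 <= c by rewrite -sE; apply: le_trans; rewrite lerDl.
  have shift z c : c <= z -> c <= z + s / 2 by move=> /le_trans; apply; rewrite lerDl.
  have /H1 {}H1 : inS x y (s / 2) by split; auto.
  have /H2 {}H2 : inS (x + s / 2) y (s / 2) by split; rewrite ?sE; auto.
  have /H3 {}H3 : inS x (y + s / 2) (s / 2) by split; rewrite ?sE; auto.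
  have /H4 {}H4 : inS (x + s / 2) (y + s / 2) (s / 2) by split; rewrite ?sE; auto.
  apply: (le_trans (ler_normD _ _)).
  apply: (le_trans (lerD (ler_normD _ _) (ler_normD _ _))).
  apply: (le_trans (lerD (lerD H1 H2) (lerD H3 H4))).
  rewrite (w_split a x sgt0) (w_split b y sgt0) le_eqVlt; apply/orP; left; apply/eqP.
  by field.
- move=> p q x0p y0q; have [cF1 cF2 dF] := HF _ _ x0p y0q.
  have [[pa qb]|/dF] := eqVneq (p, q) (a, b); last first.
    move=> /(flux_divfree_le e1_gt0)[d d0 Hd]; exists d => // x y s sd xp yq xS.
    apply: (le_trans (Hd x y s sd xp yq (cF _ _ _ xS))).
    by rewrite lerDl mulr_ge0 ?(ltW e1_gt0)// mulr_ge0.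
  subst p q; have [d d0 Hd] := flux_cont2_le cF1 cF2.
  (* Then the linear bound [4 * s] is at most [e1], hence at most [e1] times the weight, which is at
     least 1 here. *)
  exists (Num.min d (e1 / 4)); first by rewrite lt_min d0 divr_gt0.
  move=> x y s; rewrite lt_min => /and3P[s0' sd se] xp yq xS.
  apply: (le_trans (Hd x y s _ xp yq (cF _ _ _ xS))); first by rewrite s0'.
  apply: (@le_trans _ _ e1); first by rewrite mulrC -ler_pdivlMr// ltW.
  have AB : 1 <= w a x s * w b y s by rewrite mulr_ege1// w_ge1.
  rewrite -[leLHS]add0r lerD//; first by rewrite mulr_ge0 ?sqr_ge0// ltW.
  by rewrite ler_peMr// ltW.
Qed.

End flux_square.
End flux.

(** * Mean value inequalities in one variable *)

Section complex_modulus.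
Variable R : realType.
Implicit Types (z w : R[i]) (x y : R).
Local Notation nc := (@Normc.normc R).

Lemma nc_ge0 z : 0 <= nc z.
Proof. by case: z => x y; exact: sqrtr_ge0. Qed.

Lemma ncD z w : nc (z + w) <= nc z + nc w.
Proof. exact: le_normcD. Qed.

Lemma ncN z : nc (- z) = nc z.
Proof. exact: normcN. Qed.

Lemma ncB z w : nc (z - w) <= nc z + nc w.
Proof. by rewrite -(ncN w) ncD. Qed.

Lemma ncBC z w : nc (z - w) = nc (w - z).
Proof. by rewrite -ncN opprB. Qed.

Lemma nc_real x : nc x%:C = `|x|.
Proof. by rewrite /= expr0n addr0 sqrtr_sqr. Qed.

Lemma nc_sqr z : nc z ^+ 2 = complex.Re z ^+ 2 + complex.Im z ^+ 2.
Proof. by case: z => x y /=; rewrite sqr_sqrtr// addr_ge0 ?sqr_ge0. Qed.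

Lemma nc_eq0 z : (nc z == 0) = (z == 0).
Proof.
by apply/eqP/eqP => [/Normc.eq0_normc//|->]; exact: Normc.normc0.
Qed.

Lemma nc_gt0 z : (0 < nc z) = (z != 0).
Proof. by rewrite lt_def nc_ge0 andbT nc_eq0. Qed.

Lemma nc_Re z : `|complex.Re z| <= nc z.
Proof.
rewrite -(@ler_pXn2r _ 2)// ?nnegrE ?nc_ge0// nc_sqr real_normK ?num_real//.
by rewrite lerDl sqr_ge0.
Qed.

Lemma nc_Im z : `|complex.Im z| <= nc z.
Proof.
rewrite -(@ler_pXn2r _ 2)// ?nnegrE ?nc_ge0// nc_sqr real_normK ?num_real//.
by rewrite lerDr sqr_ge0.
Qed.

Lemma nc_le z : nc z <= `|complex.Re z| + `|complex.Im z|.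
Proof.
rewrite -(@ler_pXn2r _ 2)// ?nnegrE ?nc_ge0 ?addr_ge0// nc_sqr sqrrD.
rewrite !real_normK ?num_real// lerD2r lerDl.
by rewrite mulrn_wge0// mulr_ge0.
Qed.

Lemma nc_J z : nc z^*%C = nc z.
Proof. by case: z => x y /=; rewrite sqrrN. Qed.

Lemma Re_add z w : complex.Re (z + w) = complex.Re z + complex.Re w.
Proof. by case: z w => a b []. Qed.

Lemma Im_add z w : complex.Im (z + w) = complex.Im z + complex.Im w.
Proof. by case: z w => a b []. Qed.

Lemma Re_sub z w : complex.Re (z - w) = complex.Re z - complex.Re w.
Proof. by case: z w => a b []. Qed.

Lemma Im_sub z w : complex.Im (z - w) = complex.Im z - complex.Im w.
Proof. by case: z w => a b []. Qed.

End complex_modulus.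

(** * Complex differentiability and Cauchy's formula on squares *)

Section complex_differentiability.
Variable R : realType.
Implicit Types (g h : R[i] -> R[i]) (z w c d : R[i]) (x y e : R).
Local Notation nc := (@Normc.normc R).

Definition ccont g z := forall e, 0 < e -> exists2 del, 0 < del &
  forall w, nc (w - z) < del -> nc (g w - g z) < e.

Definition cderiv g z d := forall e, 0 < e -> exists2 del, 0 < del &
  forall w, nc (w - z) < del -> nc (g w - g z - d * (w - z)) <= e * nc (w - z).

Definition cdiff g z := exists d, cderiv g z d.

Lemma cdiff_ccont g z : cdiff g z -> ccont g z.
Proof.
move=> [d dg] e e0; have [del del0 D] := dg 1 ltr01.
have M0 : 0 < 1 + nc d by rewrite ltr_wpDr// nc_ge0.
exists (Num.min del (e / (1 + nc d))); first by rewrite lt_min del0 divr_gt0.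
move=> w; rewrite lt_min ltr_pdivlMr// => /andP[/D wz we].
rewrite (le_lt_trans _ we)//.
have -> : g w - g z = (g w - g z - d * (w - z)) + d * (w - z) by ring.
rewrite mul1r in wz.
by rewrite (le_trans (ncD _ _))// Normc.normcM [nc _ * (1 + _)]mulrDr mulr1 [nc d * _]mulrC lerD2r.
Qed.

Lemma cdiff_mulc g z c : cdiff g z -> cdiff (fun w => c * g w) z.
Proof.
move=> [d dg]; exists (c * d) => e e0.
have M0 : 0 < 1 + nc c by rewrite ltr_wpDr// nc_ge0.
have [del del0 D] := dg (e / (1 + nc c)) (divr_gt0 e0 M0).
exists del => // w wz.
have -> : c * g w - c * g z - c * d * (w - z) = c * (g w - g z - d * (w - z)) by ring.
rewrite Normc.normcM (le_trans (ler_wpM2l (nc_ge0 _) (D _ wz)))//.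
rewrite mulrA ler_wpM2r ?nc_ge0// mulrA ler_pdivrMr// mulrC ler_wpM2l ?(ltW e0)//.
by rewrite lerDr.
Qed.

(** With the derivative of [g] at [c] for [d], the quotient is continuous at [c], which is thus an
    admissible exceptional point for [flux_eq0]. *)
Definition quot g c d w := if w == c then d else (g w - g c) / (w - c).

Lemma quot_ccont g c d : cderiv g c d -> ccont (quot g c d) c.
Proof.
move=> dg e e0; have e2 : 0 < e / 2 by rewrite divr_gt0.
have [del del0 D] := dg _ e2; exists del => // w wz.
rewrite /quot eqxx; case: eqVneq => [_|wc]; first by rewrite subrr Normc.normc0.
have wc0 : w - c != 0 by rewrite subr_eq0.
have -> : (g w - g c) / (w - c) - d = (g w - g c - d * (w - c)) / (w - c).
  by field.
rewrite Normc.normcM Normc.normcV ltr_pdivrMr ?nc_gt0//.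
rewrite (le_lt_trans (D _ wz))// ltr_pM2r ?nc_gt0//; lra.
Qed.

Lemma quot_cdiff g c d z : z != c -> cdiff g z -> cdiff (quot g c d) z.
Proof.
move=> zc [d' dg].
have zc0 : z - c != 0 by rewrite subr_eq0.
set h0 := (g z - g c) / (z - c).
exists ((d' - h0) / (z - c)) => e e0.
set m := nc (z - c); have m0 : 0 < m by rewrite nc_gt0.
have e1 : 0 < e * m / 4 by rewrite divr_gt0// mulr_gt0.
have [del del0 D] := dg _ e1.
set K := 1 + nc (d' - h0); have K0 : 0 < K by rewrite ltr_wpDr// nc_ge0.
exists (Num.min del (Num.min (m / 2) (e * m ^+ 2 / (4 * K)))).
  by rewrite !lt_min del0 !divr_gt0// !mulr_gt0// exprn_gt0.
move=> w; rewrite !lt_min => /and3P[wdel wm we].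
have wc2 : m / 2 <= nc (w - c).
  have : m <= nc (w - c) + nc (w - z).
    have -> : m = nc ((w - c) - (w - z)) by congr nc; ring.
    exact: ncB.
  by move: wm; lra.
have wc0 : w - c != 0 by rewrite -nc_gt0; move: wc2 m0; lra.
have wc : w != c by rewrite -subr_eq0.
rewrite /quot (negbTE wc) (negbTE zc) -/h0.
(* The remainder of [g] divided by [w - c], and a term quadratic in [w - z]; each receives half of
   [e], thanks to [m / 2 <= nc (w - c)]. *)
have -> : (g w - g c) / (w - c) - h0 - (d' - h0) / (z - c) * (w - z) =
  (g w - g z - d' * (w - z)) / (w - c) -
  (d' - h0) * (w - z) * (w - z) / ((w - c) * (z - c)).
  by rewrite /h0; field; rewrite wc0 zc0.
apply: (le_trans (ncB _ _)); rewrite !(Normc.normcM, Normc.normcV) -/m.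
set W := nc (w - z); set V := nc (w - c); have V0 : 0 < V by rewrite nc_gt0.
have W0 : 0 <= W by exact: nc_ge0.
have -> : e * W = e / 2 * W + e / 2 * W by field.
apply: lerD.
  rewrite ler_pdivrMr//; apply: le_trans (D _ wdel) _; rewrite -/W.
  have -> : e / 2 * W * V = e / 2 * V * W by ring.
  apply: ler_wpM2r => //.
  have -> : e * m / 4 = e / 2 * (m / 2) by field.
  by apply: ler_wpM2l => //; rewrite divr_ge0// ltW.
rewrite ler_pdivrMr ?mulr_gt0//.
have -> : e / 2 * W * (V * m) = e / 2 * (V * m) * W by ring.
apply: ler_wpM2r => //.
apply: (@le_trans _ _ (K * W)).
  by rewrite ler_wpM2r// /K lerDr.
apply: (@le_trans _ _ (e * m ^+ 2 / 4)).
  move: we; rewrite -/W ltr_pdivlMr ?mulr_gt0// => /ltW.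
  by clear; lra.
have -> : e * m ^+ 2 / 4 = e / 2 * (m / 2 * m) by field.
apply: ler_wpM2l; first by rewrite divr_ge0// ltW.
by apply: ler_wpM2r => //; exact: ltW.
Qed.

Lemma ccont_cont2 h p q : ccont h (p +i* q)%C ->
  cont2 (fun x y => complex.Re (h (x +i* y)%C)) p q /\
  cont2 (fun x y => - complex.Im (h (x +i* y)%C)) p q /\
  cont2 (fun x y => nc (h (x +i* y)%C)) p q.
Proof.
move=> ch; suff H (f : R -> R -> R) : (forall x y,
    `|f x y - f p q| <= nc (h (x +i* y)%C - h (p +i* q)%C)) -> cont2 f p q.
  split; [|split]; apply: H => x y.
  - by rewrite -Re_sub nc_Re.
  - by rewrite opprK addrC -Im_sub ncBC nc_Im.
  - rewrite ler_norml; apply/andP; split.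
      rewrite lerNl opprB lerBlDr ncBC -[X in nc X <= _](subrK (h (x +i* y)%C)).
      exact: ncD.
    by rewrite lerBlDr -[X in nc X <= _](subrK (h (p +i* q)%C)) ncD.
move=> fh e e0; have [del del0 D] := ch _ e0.
exists (del / 2); first by rewrite divr_gt0.
move=> x y xp yq; apply: (le_lt_trans (fh x y)); apply: D.
apply: (le_lt_trans (nc_le _)); rewrite /=; move: xp yq; clear; lra.
Qed.

(** Cauchy-Riemann: if the derivative is [A + iB], then [Re h] has partial derivatives [A, - B] and
    [- Im h] has [- B, - A], so the divergence is [A - A]. *)
Lemma cdiff_divfree h p q : cdiff h (p +i* q)%C ->
  divfree (fun x y => complex.Re (h (x +i* y)%C))
          (fun x y => - complex.Im (h (x +i* y)%C)) p q.
Proof.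
move=> [[A B] dh]; exists A, (- B), (- B) => e e0.
have [del del0 D] := dh _ e0.
exists (del / 2); first by rewrite divr_gt0.
move=> x y xp yq.
have small : nc ((x +i* y)%C - (p +i* q)%C) <= `|x - p| + `|y - q| by exact: nc_le.
have xyd : `|x - p| + `|y - q| < del by move: xp yq; clear; lra.
have {}D := le_trans (D _ (le_lt_trans small xyd)) (ler_wpM2l (ltW e0) small).
move: D; set u := (X in nc X <= _) => D.
have uE : u = ((complex.Re (h (x +i* y)%C) - complex.Re (h (p +i* q)%C) - A * (x - p) - - B * (y - q))
   +i* (complex.Im (h (x +i* y)%C) - complex.Im (h (p +i* q)%C) - B * (x - p) - A * (y - q)))%C.
  rewrite /u; case: (h _) => a b; case: (h _) => a' b'.
  by apply/eqP; rewrite eq_complex /=; apply/andP; split; apply/eqP; ring.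
split; apply: le_trans D.
  by apply: le_trans (nc_Re u); rewrite uE.
apply: le_trans (nc_Im u); rewrite -[leRHS]normrN uE /= le_eqVlt.
by apply/orP; left; apply/eqP; congr `|_|; ring.
Qed.

Lemma edge_le f m x s k b : 0 <= s -> cont1 f x s -> cont1 m x s ->
  (forall t, x <= t <= x + s -> f t <= m t * k - b) ->
  edge f x s <= edge m x s * k - b * s.
Proof.
move=> s0 cf cm fm; have mi := edge_integrable cm.
rewrite -(edge_cst b x s0) /edge -RintegralZr//.
have cmk : cont1 (fun t => m t * k) x s by move=> t; apply: cvgM; [exact: cm|exact: cvg_cst].
have cb : cont1 (fun=> b) x s by move=> t; exact: cvg_cst.
rewrite -RintegralB//; [|exact: edge_integrable..].
apply: le_Rintegral => //; first exact: edge_integrable.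
  by apply: edge_integrable => t; apply: cvgB; [exact: cmk|exact: cb].
Qed.

Lemma edgeN_le f m x s k b : 0 <= s -> cont1 f x s -> cont1 m x s ->
  (forall t, x <= t <= x + s -> - f t <= m t * k - b) ->
  - edge f x s <= edge m x s * k - b * s.
Proof.
move=> s0 cf cm fm; have c0 : cont1 (fun=> 0) x s by move=> t; exact: cvg_cst.
have -> : - edge f x s = edge (fun t => 0 - f t) x s.
  by rewrite -edgeB// edge_cst// mul0r add0r.
apply: edge_le => //; first by move=> t; apply: cvgB; [exact: c0|exact: cf].
by move=> t xt; rewrite add0r; exact: fm.
Qed.

(* Cauchy's formula, for the boundary of a square centred at [c1 +i* c2]: the
   closed form [(g - g c) / (z - c) dz] has integral 0, and each side contributes
   at least [a] to the imaginary part of the integral of [a / (z - c) dz]. *)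
Lemma square_boundary_mean g (c1 c2 s a : R) : 0 < s -> 0 <= a ->
  g (c1 +i* c2)%C = a%:C ->
  (forall p q, `|p - c1| <= s -> `|q - c2| <= s -> cdiff g (p +i* q)%C) ->
  4 * a * s <= edge (fun t => nc (g ((c1 + s) +i* t)%C)) (c2 - s) (2 * s) +
             edge (fun t => nc (g ((c1 - s) +i* t)%C)) (c2 - s) (2 * s) +
             (edge (fun t => nc (g (t +i* (c2 + s))%C)) (c1 - s) (2 * s) +
             edge (fun t => nc (g (t +i* (c2 - s))%C)) (c1 - s) (2 * s)).
Proof.
move=> s0 a0 ga dg.
have s20 : 0 < 2 * s by rewrite mulr_gt0.
have s20' := ltW s20.
have sq t u : u - s <= t <= u - s + 2 * s -> `|t - u| <= s.
  by move=> h; rewrite ler_norml; move: h; clear; lra.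
have [d dgc] : cdiff g (c1 +i* c2)%C by apply: dg; rewrite subrr normr0 ltW.
pose h := quot g (c1 +i* c2)%C d.
pose F1 x y := complex.Re (h (x +i* y)%C).
pose F2 x y := - complex.Im (h (x +i* y)%C).
have ch p q : `|p - c1| <= s -> `|q - c2| <= s -> ccont h (p +i* q)%C.
  move=> pc qc; have [->|pqc] := eqVneq (p +i* q)%C (c1 +i* c2)%C.
    exact: quot_ccont.
  by apply: cdiff_ccont; apply: quot_cdiff => //; exact: dg.
have /(_ _)/esym fl := @flux_eq0 R F1 F2 (c1 - s) (c2 - s) (2 * s) c1 c2 s20.
have {fl} : 0 = flux F1 F2 (c1 - s) (c2 - s) (2 * s).
  apply: fl => p q /sq pc /sq qc.
  have [k1 [k2 _]] := ccont_cont2 (ch _ _ pc qc); split=> // pqc.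
  apply: cdiff_divfree; apply: quot_cdiff; last exact: dg.
  by move: pqc; rewrite eq_complex /= xpair_eqE.
have h2 (u : R) : u - s + 2 * s = u + s by ring.
rewrite /flux !h2.
have ss : `|s| <= s by rewrite ger0_norm// ltW.
have ssN : `|- s| <= s by rewrite normrN.
have [cp cm cp' cm'] : [/\ `|c1 + s - c1| <= s, `|c1 - s - c1| <= s,
    `|c2 + s - c2| <= s & `|c2 - s - c2| <= s].
  have uvu (u v : R) : u + v - u = v by ring.
  by rewrite !uvu.
have cF1 u : `|u - c1| <= s -> cont1 (F1 u) (c2 - s) (2 * s).
  by move=> us; apply: cont2_cont1r => t /sq /(ch _ _ us) /ccont_cont2[].
have cF2 u : `|u - c2| <= s -> cont1 (F2^~ u) (c1 - s) (2 * s).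
  by move=> us; apply: cont2_cont1l => t /sq /ch /(_ us) /ccont_cont2[_ []].
have cg p q : `|p - c1| <= s -> `|q - c2| <= s ->
    cont2 (fun x y => nc (g (x +i* y)%C)) p q.
  by move=> pc qc; have /cdiff_ccont/ccont_cont2[_ []] := dg _ _ pc qc.
have cm1 u : `|u - c1| <= s -> cont1 (fun t => nc (g (u +i* t)%C)) (c2 - s) (2 * s).
  move=> us; apply: (@cont2_cont1r _ (fun x y => nc (g (x +i* y)%C))) => t /sq.
  exact: cg.
have cm2 u : `|u - c2| <= s -> cont1 (fun t => nc (g (t +i* u)%C)) (c1 - s) (2 * s).
  move=> us; apply: (@cont2_cont1l _ (fun x y => nc (g (x +i* y)%C))) => t /sq.
  by move=> tc; exact: cg.
(* on each side [h = g / (z - c) - a / (z - c)] with [s <= |z - c|] *)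
have key (u v : R) (z := ((c1 + u) +i* (c2 + v))%C) : `|u| <= s -> `|v| <= s ->
    `|u| = s \/ `|v| = s ->
    [/\ complex.Re (h z) <= nc (g z) * s^-1 - a * u / (u ^+ 2 + v ^+ 2),
        - complex.Re (h z) <= nc (g z) * s^-1 + a * u / (u ^+ 2 + v ^+ 2),
        complex.Im (h z) <= nc (g z) * s^-1 + a * v / (u ^+ 2 + v ^+ 2) &
        - complex.Im (h z) <= nc (g z) * s^-1 - a * v / (u ^+ 2 + v ^+ 2)].
  move=> us vs uvs.
  have zc : z - (c1 +i* c2)%C = (u +i* v)%C.
    by apply/eqP; rewrite eq_complex /=; apply/andP; split; apply/eqP; ring.
  have uvs2 : s ^+ 2 <= u ^+ 2 + v ^+ 2.
    rewrite -(real_normK (num_real u)) -(real_normK (num_real v)).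
    by case: uvs => ->; rewrite ?lerDl ?lerDr sqr_ge0.
  have uv0 : (u +i* v)%C != 0.
    rewrite -nc_gt0 /= sqrtr_gt0; apply: lt_le_trans uvs2.
    by rewrite exprn_gt0.
  have zc' : z != (c1 +i* c2)%C by rewrite -subr_eq0 zc.
  have hz : h z = g z / (u +i* v)%C - a%:C / (u +i* v)%C.
    by rewrite /h /quot (negbTE zc') zc ga mulrBl.
  have gz : nc (g z / (u +i* v)%C) <= nc (g z) * s^-1.
    rewrite Normc.normcM ler_wpM2l ?nc_ge0// Normc.normcV lef_pV2 ?posrE ?nc_gt0//.
    rewrite -(@ler_pXn2r _ 2)// ?nnegrE ?nc_ge0 ?(ltW s0)//.
    by rewrite nc_sqr.
  have aE : a%:C / (u +i* v)%C = (a * u / (u ^+ 2 + v ^+ 2) +i* - (a * v / (u ^+ 2 + v ^+ 2)))%C.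
    by apply/eqP; rewrite eq_complex /=; apply/andP; split; apply/eqP; rewrite ?mul0r ?subr0 ?addr0; ring.
  rewrite hz aE Re_sub Im_sub /=.
  have := le_trans (nc_Re _) gz; have := le_trans (nc_Im _) gz.
  rewrite !ler_norml => /andP[i1 i2] /andP[r1 r2].
  by move: i1 i2 r1 r2; clear; set X := a * u / _; set Y := a * v / _; split; lra.
(* Here [s ^+ 2 + v ^+ 2 <= 2 * s ^+ 2]. The exact integral of the right-hand side over a side of
   length [2 * s] is [a * pi / 2]; this bound gives [a]. *)
have low (v : R) : `|v| <= s -> a / (2 * s) <= a * s / (s ^+ 2 + v ^+ 2).
  move=> vs; rewrite -mulrA ler_wpM2l//.
  have v2 : v ^+ 2 <= s ^+ 2.
    by rewrite -(real_normK (num_real v)) ler_pXn2r// ?nnegrE ?(ltW s0).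
  have s2 : 0 < s ^+ 2 + v ^+ 2 by rewrite ltr_wpDr ?sqr_ge0// exprn_gt0.
  rewrite ler_pdivlMr// mulrC ler_pdivrMr//; move: v2; rewrite !expr2; clear; lra.
have low' (v : R) : `|v| <= s -> a / (2 * s) <= a * s / (v ^+ 2 + s ^+ 2).
  by move=> vs; rewrite [v ^+ 2 + _]addrC; exact: low.
have tE (u t : R) : t = u + (t - u) by ring.
have c1E : c1 - s = c1 + - s by [].
have E1 := @edge_le (F1 (c1 + s)) _ (c2 - s) (2 * s) s^-1 (a / (2 * s)) s20' (cF1 _ cp) (cm1 _ cp).
have E2 := @edgeN_le (F1 (c1 - s)) _ (c2 - s) (2 * s) s^-1 (a / (2 * s)) s20' (cF1 _ cm) (cm1 _ cm).
have E3 := @edge_le (F2^~ (c2 + s)) _ (c1 - s) (2 * s) s^-1 (a / (2 * s)) s20' (cF2 _ cp') (cm2 _ cp').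
have E4 := @edgeN_le (F2^~ (c2 - s)) _ (c1 - s) (2 * s) s^-1 (a / (2 * s)) s20' (cF2 _ cm') (cm2 _ cm').
have {}E1 := E1 _; have {}E2 := E2 _; have {}E3 := E3 _; have {}E4 := E4 _.
have {}E1 := E1 ltac:(move=> t /sq tc; have [+ _ _ _] := key s (t - c2) ss tc (or_introl (ger0_norm (ltW s0)));
  rewrite -tE /F1; have := low _ tc; set A := a * s / _; set B := a / _; clear; lra).
have {}E2 := E2 ltac:(move=> t /sq tc; have [_ + _ _] := key (- s) (t - c2) ssN tc (or_introl (etrans (normrN _) (ger0_norm (ltW s0))));
  rewrite -tE /F1 sqrrN mulrN mulNr; have := low _ tc; set A := a * s / _; set B := a / _; clear; lra).
have {}E3 := E3 ltac:(move=> t /sq tc; have [_ _ _ +] := key (t - c1) s tc ss (or_intror (ger0_norm (ltW s0)));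
  rewrite -tE /F2; have := low' _ tc; set A := a * s / _; set B := a / _; clear; lra).
have {}E4 := E4 ltac:(move=> t /sq tc; have [_ _ + _] := key (t - c1) (- s) tc ssN (or_intror (etrans (normrN _) (ger0_norm (ltW s0))));
  rewrite -tE /F2 sqrrN mulrN mulNr opprK; have := low' _ tc; set A := a * s / _; set B := a / _; clear; lra).
have aa : a / (2 * s) * (2 * s) = a by rewrite divfK// gt_eqF.
rewrite !aa in E1 E2 E3 E4.
set e1 := edge _ _ _ in E1 *; set e2 := edge _ _ _ in E2 *.
set e3 := edge _ _ _ in E3 *; set e4 := edge _ _ _ in E4 *.
move: E1 E2 E3 E4; set m1 := edge _ _ _; set m2 := edge _ _ _.
set m3 := edge _ _ _; set m4 := edge _ _ _ => E1 E2 E3 E4 fl0.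
have : 4 * a <= (m1 + m2 + (m3 + m4)) / s.
  by rewrite !mulrDl; move: E1 E2 E3 E4 fl0; clear; lra.
by rewrite ler_pdivlMr.
Qed.

End complex_differentiability.

(** * Translations and reflections of the line *)

Section lebesgue_isometries.
Variable R : realType.
Local Notation mu := (@lebesgue_measure R).
Local Open Scope ereal_scope.

Lemma lebesgue_shift (c : R) (A : set R) : measurable A ->
  pushforward mu ((fun t => c + t)%R : measurableTypeR R -> measurableTypeR R) A = mu A.
Proof.
move=> mA; have mf : measurable_fun setT
    ((fun t => c + t)%R : measurableTypeR R -> measurableTypeR R).
  exact: measurable_funD.
pose f : {mfun measurableTypeR R >-> measurableTypeR R} :=
  HB.pack ((fun t => c + t)%R : measurableTypeR R -> measurableTypeR R)
    (isMeasurableFun.Build _ _ _ _ _ mf).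
apply/esym; rewrite -[LHS]/(mu A).
apply: (@lebesgue_measure_unique _ (pushforward mu f)) => //= _ [[a b]] _ <-.
rewrite /pushforward (_ : _ @^-1` _ = `](a - c)%R, (b - c)%R]%classic).
  rewrite !lebesgue_measure_itv/= !lte_fin ltrD2r.
  by case: ifP => // _; rewrite -!EFinD; congr EFin; ring.
by apply/seteqP; split => t /=; rewrite !in_itv/= => /andP[? ?]; apply/andP; split; lra.
Qed.

Lemma ge0_integral_shift (c : R) (h : R -> \bar R) :
  measurable_fun setT h -> (forall t, 0 <= h t) ->
  \int[mu]_t h (c + t)%R = \int[mu]_t h t.
Proof.
move=> mh h0; have mf : measurable_fun setT
    ((fun t => c + t)%R : measurableTypeR R -> measurableTypeR R).
  exact: measurable_funD.
transitivity (\int[pushforward mu ((fun t => c + t)%R : measurableTypeR R -> measurableTypeR R)]_t h t).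
  by rewrite ge0_integral_pushforward.
by apply: eq_measure_integral => //= A mA _; exact: lebesgue_shift.
Qed.

Lemma ge0_integral_reflect (c : R) (h : R -> \bar R) :
  measurable_fun setT h -> (forall t, 0 <= h t) ->
  \int[mu]_t h (c - t)%R = \int[mu]_t h t.
Proof.
move=> mh h0; rewrite -(ge0_integral_shift c mh h0).
have mc : measurable_fun setT (fun t : measurableTypeR R => h (c + t)%R).
  by apply: measurableT_comp => //; exact: measurable_funD.
have := @ge0_integral_pushforward _ _ _ _ R (-%R : measurableTypeR R -> measurableTypeR R) _ mu setT _ measurableT mc.
move=> <- //; apply: eq_measure_integral => //= A mA _.
exact: lebesgue_measureN.
Qed.

End lebesgue_isometries.

(** * Means over squares, for every positive exponent *)

Section area_mean.
Variable R : realType.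
Local Notation mu := (@lebesgue_measure R).
Local Notation nc := (@Normc.normc R).
Local Notation R2 := (measurableTypeR R * measurableTypeR R)%type.
Local Notation leb2 := (mu \x mu)%E.

Definition r2c (x : R2) : R[i] := (x.1 : R) +i* (x.2 : R).

Definition sq (c : R[i]) (r : R) : set R2 :=
  [set x | `|(x.1 : R) - complex.Re c| <= r /\ `|(x.2 : R) - complex.Im c| <= r].

Lemma sqE c r : sq c r = `[complex.Re c - r, complex.Re c + r] `*`
                         `[complex.Im c - r, complex.Im c + r].
Proof.
by apply/seteqP; split => -[x y]; rewrite /sq /= !in_itv/= !ler_distl.
Qed.

Lemma measurable_sq c r : measurable (sq c r).
Proof. by rewrite sqE; apply: measurableX. Qed.

Lemma leb2_sq c r : 0 <= r -> leb2 (sq c r) = (4 * r ^+ 2)%:E.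
Proof.
move=> r0; rewrite sqE product_measure1E//=.
have H (t : R) : mu `[t - r, t + r] = (2 * r)%:E.
  rewrite lebesgue_measure_itv/= lte_fin; case: ltP => h.
    by rewrite -EFinD; congr EFin; ring.
  by congr EFin; move: h r0; clear; lra.
by rewrite !H -EFinM; congr EFin; ring.
Qed.

Local Open Scope ereal_scope.

Lemma edge_integral_le (f : R -> R) (h : R -> \bar R) (x s : R) :
  cont1 f x s -> measurable_fun setT h -> (forall t, 0 <= h t) ->
  (forall t, (x <= t <= x + s)%R -> (0 <= f t)%R /\ (f t)%:E <= h t) ->
  (edge f x s)%:E <= \int[mu]_t h t.
Proof.
move=> cf mh h0 fh; have fi := edge_integrable cf.
rewrite /edge /Rintegral fineK; last exact: integrable_fin_num fi.
have H1 : \int[mu]_(t in `[x, (x + s)%R]) (f t)%:E <= \int[mu]_(t in `[x, (x + s)%R]) h t.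
  apply: ge0_le_integral => //.
  - by move=> t /=; rewrite in_itv/= lee_fin => /fh[].
  - exact: measurable_int fi.
  - exact: measurable_funTS.
  - by move=> t /=; rewrite in_itv/= => /fh[].
by apply: le_trans H1 _; apply: ge0_subset_integral.
Qed.

Lemma ge0_integral_sum4 (f1 f2 f3 f4 : R -> \bar R) :
  measurable_fun setT f1 -> measurable_fun setT f2 ->
  measurable_fun setT f3 -> measurable_fun setT f4 ->
  (forall t, 0 <= f1 t) -> (forall t, 0 <= f2 t) ->
  (forall t, 0 <= f3 t) -> (forall t, 0 <= f4 t) ->
  \int[mu]_t (f1 t + f2 t + (f3 t + f4 t)) =
    \int[mu]_t f1 t + \int[mu]_t f2 t + (\int[mu]_t f3 t + \int[mu]_t f4 t).
Proof.
move=> m1 m2 m3 m4 p1 p2 p3 p4; rewrite ge0_integralD//; last 4 first.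
- by move=> t _; exact: adde_ge0.
- exact: emeasurable_funD.
- by move=> t _; exact: adde_ge0.
- exact: emeasurable_funD.
by congr (_ + _); rewrite ge0_integralD.
Qed.

(** When the half-side [s] of [square_boundary_mean] runs over [[r / 2, r]], each side sweeps out a
    part of the plane, so by Tonelli each of the four terms integrates to at most the integral of
    [M]. The measurable majorant [M] stands in for the modulus of [g]; in several variables it
    becomes an integral over the other coordinates. *)
Lemma area_mean (g : R[i] -> R[i]) c (r : R) (M : R2 -> \bar R) : (0 < r)%R ->
  (forall x, sq c r x -> cdiff g (r2c x)) ->
  measurable_fun setT M -> (forall x, 0 <= M x) ->
  (forall x, sq c r x -> (nc (g (r2c x)))%:E <= M x) ->
  (r ^+ 2 * nc (g c))%:E <= 4%:E * \int[leb2]_x M x.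
Proof.
move=> r0 dg mM M0 gM.
pose a := nc (g c).
have [a0|a0] := eqVneq a 0%R.
  by rewrite -/a a0 mulr0 mule_ge0 ?lee_fin// integral_ge0.
have a_gt0 : (0 < a)%R by rewrite lt_def a0 nc_ge0.
(* A unimodular factor makes the value at the centre real and nonnegative, as [square_boundary_mean]
   requires. *)
pose th : R[i] := ((g c)^*%C / a%:C)%R.
have nth : nc th = 1%R.
  by rewrite /th Normc.normcM nc_J Normc.normcV nc_real gtr0_norm// divff.
have ga : (th * g c = a%:C)%R.
  have gg : (g c * (g c)^*%C = a%:C * a%:C)%R by rewrite normc_sqrE expr2 rmorphM.
  rewrite /th mulrAC (mulrC _ (g c)) gg mulfK//.
  by apply: contra_neq a0 => -[].
case: c @a a0 a_gt0 @th nth ga dg gM => c1 c2 a a0 a_gt0 th nth ga dg gM.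
pose Phi y := \int[mu]_x M (x, y).
pose Psi x := \int[mu]_y M (x, y).
have mPhi : measurable_fun setT Phi by exact: measurable_fun_fubini_tonelli_G.
have mPsi : measurable_fun setT Psi by exact: measurable_fun_fubini_tonelli_F.
have Phi0 y : 0 <= Phi y by exact: integral_ge0.
have Psi0 y : 0 <= Psi y by exact: integral_ge0.
have IPhi : \int[mu]_y Phi y = \int[leb2]_x M x by rewrite (fubini_tonelli2 M).
have IPsi : \int[mu]_y Psi y = \int[leb2]_x M x by rewrite (fubini_tonelli1 M).
have mM1 x : measurable_fun setT (fun y => M (x, y)).
  by apply: measurableT_comp => //; exact: measurable_pair1.
have mM2 y : measurable_fun setT (fun x => M (x, y)).
  by apply: measurableT_comp => //; exact: measurable_pair2.
have edges (s : R) : (0 < s <= r)%R ->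
    (4 * a * s)%:E <= Phi (c2 - s)%R + Phi (c2 + s)%R + (Psi (c1 - s)%R + Psi (c1 + s)%R).
  move=> /andP[s0 sr].
  have sqx (p q : R) : (`|p - c1| <= s)%R -> (`|q - c2| <= s)%R -> sq (c1 +i* c2) r (p, q).
    by move=> h1 h2; split => /=; exact: le_trans sr.
  have dg' (p q : R) : (`|p - c1| <= s)%R -> (`|q - c2| <= s)%R -> cdiff (fun z => th * g z)%R (p +i* q).
    by move=> h1 h2; apply: cdiff_mulc; exact: (dg (p, q) (sqx _ _ h1 h2)).
  have cg (p q : R) : (`|p - c1| <= s)%R -> (`|q - c2| <= s)%R ->
      cont2 (fun x y => nc (th * g (x +i* y))%R) p q.
    by move=> pc qc; have /cdiff_ccont/ccont_cont2[_ []] := dg' _ _ pc qc.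
  have sqi (t u : R) : (u - s <= t <= u - s + 2 * s)%R -> (`|t - u| <= s)%R.
    by move=> h; rewrite ler_norml; move: h; clear; lra.
  have uvu (u v : R) : (u + v - u = v)%R by ring.
  have ss : (`|s| <= s)%R by rewrite ger0_norm// ltW.
  have [cp cm cp' cm'] : [/\ `|c1 + s - c1| <= s, `|c1 - s - c1| <= s,
      `|c2 + s - c2| <= s & `|c2 - s - c2| <= s]%R.
    by rewrite !uvu normrN.
  have cm1 (u : R) : (`|u - c1| <= s)%R -> cont1 (fun t => nc (th * g (u +i* t)))%R (c2 - s) (2 * s).
    move=> us; apply: (@cont2_cont1r _ (fun x y => nc (th * g (x +i* y)))%R) => t /sqi.
    exact: cg.
  have cm2 (u : R) : (`|u - c2| <= s)%R -> cont1 (fun t => nc (th * g (t +i* u)))%R (c1 - s) (2 * s).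
    move=> us; apply: (@cont2_cont1l _ (fun x y => nc (th * g (x +i* y)))%R) => t /sqi.
    by move=> tc; exact: cg.
  have bound (p q : R) : (`|p - c1| <= s)%R -> (`|q - c2| <= s)%R ->
      (0 <= nc (th * g (p +i* q)))%R /\ (nc (th * g (p +i* q))%R)%:E <= M (p, q).
    move=> h1 h2; split; first exact: nc_ge0.
    rewrite Normc.normcM nth mul1r.
    exact: (gM (p, q) (sqx _ _ h1 h2)).
  have := @square_boundary_mean R (fun z => th * g z)%R c1 c2 s a s0 (ltW a_gt0) ga dg'.
  rewrite -lee_fin => /le_trans; apply; rewrite !EFinD [X in _ <= X]addeC.
  rewrite [Phi _ + _]addeC [Psi _ + _]addeC.
  apply: leeD; apply: leeD.
  - apply: edge_integral_le (mM1 _) _ _ => //; first exact: cm1.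
    by move=> t /sqi tc; exact: bound.
  - apply: edge_integral_le (mM1 _) _ _ => //; first exact: cm1.
    by move=> t /sqi tc; exact: bound.
  - apply: edge_integral_le (mM2 _) _ _ => //; first exact: cm2.
    by move=> t /sqi tc; exact: bound.
  - apply: edge_integral_le (mM2 _) _ _ => //; first exact: cm2.
    by move=> t /sqi tc; exact: bound.
have mPhiD : measurable_fun setT (fun s : R => Phi (c2 + s)%R).
  by apply: measurableT_comp => //; exact: measurable_funD.
have mPhiB : measurable_fun setT (fun s : R => Phi (c2 - s)%R).
  by apply: measurableT_comp => //; exact: measurable_funB.
have mPsiD : measurable_fun setT (fun s : R => Psi (c1 + s)%R).
  by apply: measurableT_comp => //; exact: measurable_funD.
have mPsiB : measurable_fun setT (fun s : R => Psi (c1 - s)%R).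
  by apply: measurableT_comp => //; exact: measurable_funB.
have mS : measurable_fun setT (fun s : R =>
    Phi (c2 - s)%R + Phi (c2 + s)%R + (Psi (c1 - s)%R + Psi (c1 + s)%R)).
  by apply: emeasurable_funD; apply: emeasurable_funD.
have -> : 4%:E * \int[leb2]_x M x =
    \int[mu]_s (Phi (c2 - s)%R + Phi (c2 + s)%R + (Psi (c1 - s)%R + Psi (c1 + s)%R)).
  rewrite (@ge0_integral_sum4 (fun s : R => Phi (c2 - s)%R)
    (fun s => Phi (c2 + s)%R) (fun s => Psi (c1 - s)%R) (fun s => Psi (c1 + s)%R))//.
  have I0 : 0 <= \int[leb2]_x M x by exact: integral_ge0.
  transitivity (\int[leb2]_x M x + \int[leb2]_x M x +
                (\int[leb2]_x M x + \int[leb2]_x M x)).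
    have -> : 4%:E = (1 + 1 + (1 + 1))%:E :> \bar R by congr EFin; ring.
    by rewrite !EFinD !ge0_muleDl ?mul1e ?adde_ge0//.
  have D4 (x1 x2 x3 x4 I : \bar R) : x1 = I -> x2 = I -> x3 = I -> x4 = I ->
      I + I + (I + I) = x1 + x2 + (x3 + x4) by move=> -> -> -> ->.
  apply: D4.
  - rewrite -IPhi; exact: ge0_integral_reflect.
  - rewrite -IPhi; exact: ge0_integral_shift.
  - rewrite -IPsi; exact: ge0_integral_reflect.
  - rewrite -IPsi; exact: ge0_integral_shift.
(* For [s] in [[r / 2, r]] the left-hand side [4 * a * s] is at least [2 * a * r], and the interval
   has length [r / 2]. *)
apply: (@le_trans _ _ (\int[mu]_(s in `[(r / 2)%R, r]) (2 * a * r)%:E)).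
  rewrite integral_cst//= lebesgue_measure_itv/= lte_fin.
  have -> : (r / 2 < r)%R by move: r0; clear; lra.
  by rewrite -EFinB -EFinM -/a lee_fin le_eqVlt; apply/orP; left; apply/eqP; field.
apply: (@le_trans _ _ (\int[mu]_(s in `[(r / 2)%R, r])
    (Phi (c2 - s)%R + Phi (c2 + s)%R + (Psi (c1 - s)%R + Psi (c1 + s)%R)))).
  apply: ge0_le_integral => //.
  - by move=> s _; rewrite lee_fin !mulr_ge0// ltW.
  - exact: measurable_funTS.
  - move=> s /=; rewrite in_itv/= => /andP[rs sr].
    apply: le_trans (edges s _); last by rewrite sr andbT; move: r0 rs; clear; lra.
    rewrite lee_fin; have -> : (4 * a * s = 2 * a * (2 * s))%R by ring.
    by rewrite ler_wpM2l ?mulr_ge0 ?(ltW a_gt0)//; move: rs; clear; lra.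
apply: ge0_subset_integral => //.
by move=> s _; apply: adde_ge0; apply: adde_ge0.
Qed.

(* Where [|g| >= |g c| / 32] one has [|g| <= (|g c| / 32) ^ (1 - p) |g| ^ p]; the
   remaining part of [|g|] is too small to matter. *)
Lemma area_mean_pow_ge1 (p : R) (g : R[i] -> R[i]) c (r : R) (M : R2 -> \bar R) :
  (1 <= p)%R -> (0 < r)%R ->
  (forall x, sq c r x -> cdiff g (r2c x)) ->
  measurable_fun setT M -> (forall x, 0 <= M x) ->
  (forall x, sq c r x -> (nc (g (r2c x)) `^ p)%:E <= M x) ->
  (r ^+ 2 * nc (g c) `^ p)%:E <= (8 * 32 `^ (p - 1))%:E * \int[leb2]_x M x.
Proof.
move=> p1 r0 dg mM M0 gM; set I := \int[leb2]_x M x.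
have p0 : (0 < p)%R by apply: lt_le_trans p1.
have I0 : 0 <= I by exact: integral_ge0.
have K0 : (0 < 8 * 32 `^ (p - 1))%R by rewrite mulr_gt0// powR_gt0.
pose a := nc (g c); rewrite -/a.
have [a0|a0] := eqVneq a 0%R.
  by rewrite a0 powR0 ?gt_eqF// mulr0 mule_ge0 ?lee_fin// ltW.
have a_gt0 : (0 < a)%R by rewrite lt_def a0 nc_ge0.
have eta0 : (0 < a / 32)%R by rewrite divr_gt0.
pose k := ((a / 32) `^ (1 - p))%R.
have k0 : (0 < k)%R by rewrite powR_gt0.
(* The first term integrates to [a / 32 * (4 * r ^+ 2)]; with the factor 4 of [area_mean] this is
   half of [r ^+ 2 * a], which the left-hand side absorbs. *)
pose M1 x := (a / 32 * \1_(sq c r) x)%:E + k%:E * M x.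
have mM1a : measurable_fun setT (fun x => (a / 32 * \1_(sq c r) x)%:E).
  apply/measurable_EFinP; apply: measurable_funM => //.
  exact: measurable_indic (measurable_sq _ _).
have mM1b : measurable_fun setT (fun x => k%:E * M x).
  exact: measurable_funeM.
have e1 x : 0 <= (a / 32 * \1_(sq c r) x)%:E by rewrite lee_fin mulr_ge0// ltW.
have e2 x : 0 <= k%:E * M x by rewrite mule_ge0// lee_fin ltW.
have /(_ _ _ _)/le_trans := @area_mean g c r M1 r0 dg.
have IM1 : \int[leb2]_x M1 x = (a / 32 * (4 * r ^+ 2))%:E + k%:E * I.
  rewrite ge0_integralD//; congr (_ + _).
    under eq_integral do rewrite EFinM.
    rewrite ge0_integralZl_EFin//; last 2 first.
    - by apply/measurable_EFinP; exact: measurable_indic (measurable_sq _ _).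
    - exact: ltW.
    rewrite integral_indic ?setIT//; last exact: measurable_sq.
    by rewrite [RHS]EFinM -(leb2_sq c (ltW r0)).
  by rewrite ge0_integralZl_EFin// ltW.
move=> H.
have {H} : (r ^+ 2 * a)%:E <= 4%:E * ((a / 32 * (4 * r ^+ 2))%:E + k%:E * I).
  rewrite -IM1; apply: H => //.
  - exact: emeasurable_funD.
  - by move=> x; exact: adde_ge0.
  move=> x qx; rewrite /M1 indicE mem_set// mulr1.
  have [gl|gl] := leP (nc (g (r2c x))) (a / 32)%R.
    by rewrite (le_trans _ (leeDl _ _))// lee_fin.
  apply: le_trans (leeDr _ _); last by rewrite lee_fin ltW.
  apply: le_trans (lee_wpmul2l _ (gM x qx)); last by rewrite lee_fin ltW.
  rewrite -EFinM lee_fin.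
  have gx0 : (0 < nc (g (r2c x)))%R by apply: lt_trans gl.
  have -> : (nc (g (r2c x)) `^ p = nc (g (r2c x)) `^ (p - 1) * nc (g (r2c x)))%R.
    by rewrite mulrC mulr_powRB1// ltW.
  rewrite mulrA ler_peMl ?(ltW gx0)//.
  rewrite /k -[(1 - p)%R]opprB powRN mulrC ler_pdivlMr ?powR_gt0// mul1r.
  by rewrite ge0_ler_powR ?subr_ge0// ?nnegrE ltW.
case: (I) I0 => [i||] //= i0; last first.
  by move=> _; rewrite gt0_muley ?leey// lte_fin.
rewrite -?EFinM -?EFinD -?EFinM !lee_fin => h.
have {}h : (r ^+ 2 * a <= 8 * (k * i))%R by move: h; clear; lra.
rewrite -(mulr_powRB1 (ltW a_gt0) p0).
have kA : (k * a `^ (p - 1) = 32 `^ (p - 1))%R.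
  have aE : (a `^ (p - 1) = (a / 32) `^ (p - 1) * 32 `^ (p - 1))%R.
    by rewrite -powRM ?divfK// ltW.
  by rewrite /k -[(1 - p)%R]opprB powRN aE mulKf// gt_eqF// powR_gt0.
have := ler_wpM2r (powR_ge0 a (p - 1)) h; rewrite -kA -!mulrA => /le_trans; apply.
by rewrite le_eqVlt; apply/orP; left; apply/eqP; ring.
Qed.

(** Continuity bounds [g] near each point, and the maximum of four bounds is a bound for the union:
    bisection does the work of compactness. This makes the supremum in the case [p < 1] finite. *)
Lemma cdiff_bounded (g : R[i] -> R[i]) c (r : R) : (0 < r)%R ->
  (forall x, sq c r x -> cdiff g (r2c x)) ->
  exists2 K : R, (0 <= K)%R & forall x, sq c r x -> (nc (g (r2c x)) <= K)%R.
Proof.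
case: c => c1 c2 r0 dg.
pose P x y s := exists K : R, forall u v, (x <= u <= x + s -> y <= v <= y + s ->
  nc (g (u +i* v)) <= K)%R.
have {dg} [K KP] : P (c1 - r)%R (c2 - r)%R (2 * r)%R.
  apply: square_bisection; first by rewrite mulr_gt0.
    move=> x y s s0 [K1 H1] [K2 H2] [K3 H3] [K4 H4].
    exists (Num.max (Num.max K1 K2) (Num.max K3 K4)) => u v xu yv.
    rewrite !le_max.
    have [us|us] := leP u (x + s / 2)%R; have [vs|vs] := leP v (y + s / 2)%R.
    - by rewrite H1//; move: xu yv us vs; clear; lra.
    - by rewrite H3 ?orbT//; move: xu yv us vs; clear; lra.
    - by rewrite H2 ?orbT//; move: xu yv us vs; clear; lra.
    - by rewrite H4 ?orbT//; move: xu yv us vs; clear; lra.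
  move=> p q pc qc.
  have /dg/cdiff_ccont/(_ _ ltr01)[d d0 D] : sq (c1 +i* c2) r (p, q).
    by split; rewrite /= ler_norml; move: pc qc; clear; lra.
  exists (d / 2)%R; first by rewrite divr_gt0.
  move=> x y s /andP[s0 sd] xp yq.
  exists (nc (g (p +i* q)) + 1)%R => u v xu yv.
  have gE : (g (u +i* v) = g (p +i* q) + (g (u +i* v) - g (p +i* q)))%R by ring.
  rewrite gE (le_trans (ncD _ _))// lerD2l ltW// D//.
  apply: (le_lt_trans (nc_le _)); rewrite /=.
  have up : (`|u - p| <= s)%R by rewrite ler_norml; move: xu xp; clear; lra.
  have vq : (`|v - q| <= s)%R by rewrite ler_norml; move: yv yq; clear; lra.
  by move: up vq sd; clear; lra.
exists (Num.max 0 K)%R; first by rewrite le_max lexx.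
move=> [u v] [/= uc vc]; rewrite le_max; apply/orP; right; apply: KP => /=.
  by move: uc; rewrite ler_norml; clear; lra.
by move: vc; rewrite ler_norml; clear; lra.
Qed.

(* The argument of Hardy-Littlewood and Fefferman-Stein: apply the mean value
   inequality for [|g|] around a point almost maximizing [|g| d ^ (2 / p)], where
   [d] is the distance to the boundary of the square. *)
Lemma area_mean_pow_lt1 (p : R) (g : R[i] -> R[i]) c (r : R) (M : R2 -> \bar R) :
  (0 < p)%R -> (p < 1)%R -> (0 < r)%R ->
  (forall x, sq c r x -> cdiff g (r2c x)) ->
  measurable_fun setT M -> (forall x, 0 <= M x) ->
  (forall x, sq c r x -> (nc (g (r2c x)) `^ p)%:E <= M x) ->
  (r ^+ 2 * nc (g c) `^ p)%:E <=
    (16 * 2 `^ p * (2 * 2 `^ (2 / p)) `^ (1 - p))%:E * \int[leb2]_x M x.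
Proof.
move=> p0 p1 r0 dg mM M0 gM; set I := \int[leb2]_x M x.
have I0 : 0 <= I by exact: integral_ge0.
pose K := (2 * 2 `^ (2 / p) : R)%R; rewrite -/K.
have K0 : (0 < K)%R by rewrite mulr_gt0// powR_gt0.
have C0 : (0 < 16 * 2 `^ p * K `^ (1 - p))%R by rewrite !mulr_gt0// powR_gt0.
pose a := nc (g c); rewrite -/a.
have [a0|a0] := eqVneq a 0%R.
  by rewrite a0 powR0 ?gt_eqF// mulr0 mule_ge0 ?lee_fin// ltW.
have a_gt0 : (0 < a)%R by rewrite lt_def a0 nc_ge0.
have [B B0 gB] := cdiff_bounded r0 dg.
pose d (x : R2) : R := (r - Num.max `|(x.1 : R) - complex.Re c| `|(x.2 : R) - complex.Im c|)%R.
(* With the exponent [2 / p], the p-th power of [v x] is that of [nc (g (r2c x))] times [d x ^+ 2],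
   the homogeneity of the inequality to be proved. *)
pose v x := (nc (g (r2c x)) * d x `^ (2 / p))%R.
have q0 : (0 < 2 / p)%R by rewrite divr_gt0.
have d_ge0 x : sq c r x -> (0 <= d x)%R.
  by move=> [h1 h2]; rewrite subr_ge0 ge_max h1 h2.
have d_le x : (d x <= r)%R by rewrite lerBlDr lerDl le_max normr_ge0.
have cc : r2c (complex.Re c, complex.Im c) = c by case: (c).
pose V := v @` sq c r.
have cin : sq c r (complex.Re c, complex.Im c) by split; rewrite /= subrr normr0 ltW.
have vc : v (complex.Re c, complex.Im c) = (a * r `^ (2 / p))%R.
  by rewrite /v cc /d /= !subrr normr0 maxxx subr0.
have v_gt0 : (0 < v (complex.Re c, complex.Im c))%R by rewrite vc mulr_gt0// powR_gt0.
have Vsup : has_sup V.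
  split; first by exists (v (complex.Re c, complex.Im c)), (complex.Re c, complex.Im c).
  exists (B * r `^ (2 / p))%R => _ [x qx <-].
  by rewrite ler_pM ?nc_ge0 ?powR_ge0 ?gB// ge0_ler_powR ?nnegrE ?d_ge0 ?(ltW r0) ?(ltW q0).
pose N := sup V.
have vN x : sq c r x -> (v x <= N)%R by move=> qx; apply: ub_le_sup; [exact: Vsup.2|exists x].
have N0 : (0 < N)%R by apply: lt_le_trans v_gt0 (vN _ cin).
have [_ [x qx <-] Nx] : exists2 y, V y & (N / 2 < y)%R.
  have N2 : (0 < N / 2)%R by rewrite divr_gt0.
  have [y Vy h] := sup_adherent N2 Vsup; exists y => //.
  by apply: le_lt_trans h; rewrite -/N; clear; lra.
have dx0 : (0 < d x)%R.
  rewrite lt_def d_ge0// andbT; apply/eqP => dx; move: Nx.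
  by rewrite /v dx powR0 ?gt_eqF// mulr0 ltNge ltW// divr_gt0.
pose b := nc (g (r2c x)).
have b_gt0 : (0 < b)%R.
  rewrite lt_def nc_ge0 andbT; apply/eqP => bx; move: Nx.
  by rewrite /v -/b bx mul0r ltNge ltW// divr_gt0.
pose rho := (d x / 2)%R; have rho0 : (0 < rho)%R by rewrite divr_gt0.
have sub y : sq (r2c x) rho y -> sq c r y /\ (rho <= d y)%R.
  rewrite /sq /r2c /= => -[h1 h2].
  have dd : (d x / 2 <= d y)%R.
    rewrite [d y]/d lerBrDr -lerBrDl ge_max.
    have : (`|(x.1 : R) - complex.Re c| <= r - d x)%R.
      by rewrite /d subKr le_max lexx.
    have : (`|(x.2 : R) - complex.Im c| <= r - d x)%R.
      by rewrite /d subKr le_max lexx orbT.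
    move: h1 h2; rewrite /rho !ler_distl => h1 h2 h3 h4.
    move: h1 h2 h3 h4; clear; lra.
  split => //; suff : (0 <= d y)%R by rewrite subr_ge0 ge_max => /andP[].
  by apply: le_trans dd; rewrite divr_ge0// ltW.
(* On this square [d y] is at least half of [d x], and [v y] is at most twice [v x]: the factor 2 of
   [K] comes from near-maximality, its power of 2 from [d]. *)
have gK y : sq (r2c x) rho y -> (nc (g (r2c y)) <= K * b)%R.
  move=> /sub[qy dy].
  have dy0 : (0 < d y)%R by apply: lt_le_trans dy.
  rewrite -(ler_pM2r (powR_gt0 (2 / p) dy0)).
  apply: (le_trans (vN y qy)); apply: (@le_trans _ _ (2 * v x)%R).
    by move: Nx; clear; lra.
  rewrite /v -/b /K -!mulrA ler_pM2l// mulrCA ler_pM2l//.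
  rewrite -powRM ?(ltW dy0)//.
  rewrite ge0_ler_powR ?(ltW q0) ?nnegrE ?mulr_ge0 ?(ltW dx0) ?(ltW dy0)//.
  by move: dy; rewrite /rho; clear; lra.
(* By [gK], the modulus of [g] on the small square is at most [k] times its p-th power, so the
   inequality for exponent 1 applies with the majorant [k * M]. *)
pose k := ((K * b) `^ (1 - p))%R.
have k0 : (0 < k)%R by rewrite powR_gt0// mulr_gt0.
have : (rho ^+ 2 * b)%:E <= 4%:E * \int[leb2]_y (k%:E * M y).
  apply: area_mean => //.
  - by move=> y /sub[qy _]; exact: dg.
  - exact: measurable_funeM.
  - by move=> y; rewrite mule_ge0// lee_fin ltW.
  move=> y qy; have [qy' _] := sub _ qy.
  apply: le_trans (lee_wpmul2l _ (gM y qy')); last by rewrite lee_fin ltW.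
  rewrite -EFinM lee_fin.
  have [->|gy] := eqVneq (nc (g (r2c y))) 0%R; first by rewrite mulr_ge0 ?powR_ge0.
  have gE : (nc (g (r2c y)) = nc (g (r2c y)) `^ (1 - p) * nc (g (r2c y)) `^ p)%R.
    by rewrite -powRD ?subrK ?powRr1 ?nc_ge0// gy implybT.
  rewrite [leLHS]gE ler_wpM2r ?powR_ge0//.
  by rewrite ge0_ler_powR ?subr_ge0 ?nnegrE ?nc_ge0 ?(ltW p1)// ?gK// mulr_ge0// ltW.
rewrite ge0_integralZl_EFin ?(ltW k0)//= -/I.
case: (I) I0 => [i||] //= i0; last first.
  by move=> _; rewrite gt0_muley ?leey// lte_fin.
rewrite -?EFinM !lee_fin => h.
have bE : (b * b `^ (p - 1) = b `^ p)%R by rewrite mulr_powRB1// ltW.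
have kE : (k * b `^ (p - 1) = K `^ (1 - p))%R.
  rewrite /k powRM ?(ltW K0) ?(ltW b_gt0)// -mulrA -powRD; last by apply/implyP => _; rewrite gt_eqF.
  have -> : (1 - p + (p - 1) = 0)%R by ring.
  by rewrite powRr0 mulr1.
have {}h : (rho ^+ 2 * b `^ p <= 4 * K `^ (1 - p) * i)%R.
  have H := ler_wpM2r (powR_ge0 b (p - 1)) h.
  rewrite -bE -kE [leLHS]mulrA; apply: le_trans H _.
  by rewrite le_eqVlt; apply/orP; left; apply/eqP; ring.
(* Back to the centre of the large square, where [v] is at most [2 * v x]; the inner 4 comes from
   [d x ^+ 2 = 4 * rho ^+ 2]. *)
have ab : (r ^+ 2 * a `^ p <= 2 `^ p * (4 * (rho ^+ 2 * b `^ p)))%R.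
  have : (a * r `^ (2 / p) <= 2 * (b * d x `^ (2 / p)))%R.
    rewrite -vc; apply: (le_trans (vN _ cin)).
    by move: Nx; rewrite /v -/b; clear; lra.
  have nn : (0 <= a * r `^ (2 / p))%R by rewrite mulr_ge0 ?powR_ge0// ltW.
  have nn' : (0 <= b * d x `^ (2 / p))%R by rewrite mulr_ge0 ?powR_ge0// ltW.
  move/(ge0_ler_powR (ltW p0)); rewrite !nnegrE => /(_ nn (mulr_ge0 (ler0n _ 2) nn')).
  rewrite !powRM ?powR_ge0 ?mulr_ge0 ?powR_ge0 ?(ltW a_gt0) ?(ltW b_gt0)//.
  rewrite -!powRrM divfK ?gt_eqF// -[2%R]/(2%:R)%R !powR_mulrn ?(ltW r0) ?(ltW dx0)//.
  rewrite mulrC => /le_trans; apply.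
  rewrite ler_wpM2l ?powR_ge0// /rho le_eqVlt; apply/orP; left; apply/eqP; field.
  by [].
apply: (le_trans ab).
have -> : (16 * 2 `^ p * K `^ (1 - p) * i = 2 `^ p * (4 * (4 * K `^ (1 - p) * i)))%R by ring.
by rewrite ler_wpM2l ?powR_ge0// ler_wpM2l.
Qed.

Lemma area_mean_pow (p : R) : (0 < p)%R -> exists2 C : R, (0 < C)%R &
  forall (g : R[i] -> R[i]) c (r : R) (M : R2 -> \bar R), (0 < r)%R ->
  (forall x, sq c r x -> cdiff g (r2c x)) ->
  measurable_fun setT M -> (forall x, 0 <= M x) ->
  (forall x, sq c r x -> (nc (g (r2c x)) `^ p)%:E <= M x) ->
  (r ^+ 2 * nc (g c) `^ p)%:E <= C%:E * \int[leb2]_x M x.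
Proof.
move=> p0; have [p1|p1] := leP 1%R p.
  exists (8 * 32 `^ (p - 1))%R; first by rewrite mulr_gt0// powR_gt0.
  by move=> *; exact: area_mean_pow_ge1.
exists (16 * 2 `^ p * (2 * 2 `^ (2 / p)) `^ (1 - p))%R.
  by rewrite !mulr_gt0// powR_gt0// mulr_gt0// powR_gt0.
by move=> *; exact: area_mean_pow_lt1.
Qed.

End area_mean.

(** * Mean value inequalities in several variables *)

Section tuple_integral.
Variable R : realType.
Local Notation mu := (@lebesgue_measure R).
Local Notation R2 := (measurableTypeR R * measurableTypeR R)%type.
Local Notation leb := (@lebesgue_tuple R).
Local Open Scope ereal_scope.

Let leb2_sigma_finite : sigma_finite setT (mu \x mu).
Proof. by apply: sigma_finite_product; exact: sigma_finiteT. Qed.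

(** The area measure of the plane, packaged with its sigma-finiteness for Tonelli's theorem. *)
Definition leb2 : {sigma_finite_measure set R2 -> \bar R} :=
  HB.pack (mu \x mu)%E (Measure_isSigmaFinite.Build _ _ _ (mu \x mu)%E leb2_sigma_finite).

Lemma tuple_integral0 (F : 0.-tuple R2 -> \bar R) : measurable_fun setT F ->
  \int[leb 0]_t F t = F [tuple].
Proof.
move=> mF; rewrite integral_dirac// -[RHS]mul1e; congr (_ * _).
exact: diracT.
Qed.

Lemma tuple_integral_cons n (F : n.+1.-tuple R2 -> \bar R) :
  measurable_fun setT F -> (forall t, 0 <= F t) ->
  \int[leb n.+1]_t F t = \int[leb2]_x \int[leb n]_t F [tuple of x :: t].
Proof.
move=> mF F0.
have mc : measurable_fun setT (fun x : R2 * n.-tuple R2 => [the n.+1.-tuple R2 of x.1 :: x.2]).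
  exact: measurable_cons.
transitivity (\int[leb2 \x leb n]_x F [the n.+1.-tuple R2 of x.1 :: x.2]).
  rewrite -[LHS]/(\int[pushforward (leb2 \x leb n)
     (fun x : R2 * n.-tuple R2 => [the n.+1.-tuple R2 of x.1 :: x.2])]_t F t).
  rewrite ge0_integral_pushforward//.
rewrite (fubini_tonelli1 (fun x : R2 * n.-tuple R2 => F [the n.+1.-tuple R2 of x.1 :: x.2]))//.
exact: measurableT_comp.
Qed.

(** The coordinate to be singled out will be the largest one of a given point, so [k] is arbitrary,
    whereas [lebesgue_tuple] is built by adding coordinate 0. *)
Definition ins n (k : 'I_n.+1) (x : R2) (t : n.-tuple R2) : n.+1.-tuple R2 :=
  [tuple if unlift k i is Some j then tnth t j else x | i < n.+1].

Lemma tnth_ins n (k : 'I_n.+1) x t : tnth (ins k x t) k = x.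
Proof. by rewrite tnth_mktuple unlift_none. Qed.

Lemma tnth_ins_lift n (k : 'I_n.+1) j x t : tnth (ins k x t) (lift k j) = tnth t j.
Proof. by rewrite tnth_mktuple liftK. Qed.

Lemma ins0 n x (t : n.-tuple R2) : ins ord0 x t = [tuple of x :: t].
Proof.
apply: eq_from_tnth => i; case: (unliftP ord0 i) => [j|] ->.
  by rewrite tnth_ins_lift tnthS.
by rewrite tnth_ins tnth0.
Qed.

Lemma ins_lift0 n (k : 'I_n.+1) x y (t : n.-tuple R2) :
  ins (lift ord0 k) x [tuple of y :: t] = [tuple of y :: ins k x t].
Proof.
apply: eq_from_tnth => i; case: (unliftP (lift ord0 k) i) => [j|] ->.
  rewrite tnth_ins_lift; case: (unliftP ord0 j) => [j'|] ->.
    rewrite tnthS (_ : lift (lift ord0 k) _ = lift ord0 (lift k j')).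
      by rewrite tnthS tnth_ins_lift.
    by apply: val_inj; rewrite /= /bump /=; lia.
  rewrite (_ : lift (lift ord0 k) (ord0 : 'I_n.+1) = ord0) ?tnth0//.
  by apply: val_inj.
by rewrite tnth_ins tnthS tnth_ins.
Qed.

Lemma measurable_ins d (T : measurableType d) n (k : 'I_n.+1) (f : T -> R2) (g : T -> n.-tuple R2) :
  measurable_fun setT f -> measurable_fun setT g ->
  measurable_fun setT (fun x => ins k (f x) (g x)).
Proof.
move=> mf mg; apply/measurable_fun_tnthP => i.
rewrite (_ : _ \o _ = fun x => if unlift k i is Some j then tnth (g x) j else f x).
  case: (unlift k i) => [j|] //.
  exact: (measurableT_comp (@measurable_tnth _ _ n j) mg).
by apply/funext => x /=; rewrite tnth_mktuple.
Qed.

(** For [k] other than 0, coordinate 0 is split off, the induction hypothesis extracts [k] from the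
    rest, and Tonelli's theorem interchanges the two planes. *)
Lemma tuple_integral_ins n (k : 'I_n.+1) (F : n.+1.-tuple R2 -> \bar R) :
  measurable_fun setT F -> (forall t, 0 <= F t) ->
  \int[leb n.+1]_t F t = \int[leb2]_x \int[leb n]_t F (ins k x t).
Proof.
elim: n => [|n IH] in k F * => mF F0.
  rewrite (tuple_integral_cons mF F0); apply: eq_integral => x _.
  by apply: eq_integral => t _; rewrite (ord1 k) ins0.
case: (unliftP ord0 k) => [k'|] ->; last first.
  rewrite (tuple_integral_cons mF F0); apply: eq_integral => x _.
  by apply: eq_integral => t _; rewrite ins0.
have mFy y : measurable_fun setT (fun t : n.+1.-tuple R2 => F [tuple of y :: t]).
  by apply: measurableT_comp => //; exact: measurable_cons.
have mF3 : measurable_fun setT (fun yxt : R2 * R2 * n.-tuple R2 =>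
    F [tuple of yxt.1.1 :: ins k' yxt.1.2 yxt.2]).
  apply: measurableT_comp => //; apply: measurable_cons.
    exact: measurableT_comp.
  by apply: measurable_ins => //; exact: measurableT_comp.
rewrite (tuple_integral_cons mF F0).
transitivity (\int[leb2]_y \int[leb2]_x \int[leb n]_t F [tuple of y :: ins k' x t]).
  by apply: eq_integral => y _; rewrite (IH k')//.
rewrite (fubini_tonelli (fun yx : R2 * R2 => \int[leb n]_t F [tuple of yx.1 :: ins k' yx.2 t])); last 2 first.
- exact: (measurable_fun_fubini_tonelli_F (m2 := leb n) _ mF3 (fun=> F0 _)).
- by move=> x; exact: integral_ge0.
apply: eq_integral => x _.
have mFx : measurable_fun setT (fun t => F (ins (lift ord0 k') x t)).
  by apply: measurableT_comp => //; exact: measurable_ins.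
rewrite (tuple_integral_cons mFx (fun=> F0 _)).
apply: eq_integral => y _; apply: eq_integral => t _.
by rewrite ins_lift0.
Qed.

(** The order suited to sheared boxes: the square for coordinate [k] has a centre depending on [t],
    so it is integrated innermost. *)
Lemma tuple_integral_insC n (k : 'I_n.+1) (F : n.+1.-tuple R2 -> \bar R) :
  measurable_fun setT F -> (forall t, 0 <= F t) ->
  \int[leb n.+1]_t F t = \int[leb n]_t \int[leb2]_x F (ins k x t).
Proof.
move=> mF F0; rewrite (tuple_integral_ins k)//.
rewrite (fubini_tonelli (fun xt : R2 * n.-tuple R2 => F (ins k xt.1 xt.2)))//.
by apply: measurableT_comp => //; exact: measurable_ins.
Qed.

Lemma measurable_integral_ins n (k : 'I_n.+1) (F : n.+1.-tuple R2 -> \bar R) :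
  measurable_fun setT F -> (forall t, 0 <= F t) ->
  measurable_fun setT (fun t => \int[leb2]_x F (ins k x t)).
Proof.
move=> mF F0.
apply: (measurable_fun_fubini_tonelli_G (m1 := leb2) (fun xt : R2 * n.-tuple R2 => F (ins k xt.1 xt.2))) => //.
by apply: measurableT_comp => //; exact: measurable_ins.
Qed.

End tuple_integral.

(** * Means over products of squares *)

Section polydisc.
Variable R : realType.
Local Notation mu := (@lebesgue_measure R).
Local Notation nc := (@Normc.normc R).
Local Notation R2 := (measurableTypeR R * measurableTypeR R)%type.
Local Notation leb := (@lebesgue_tuple R).

Definition c2r (z : R[i]) : R2 := (complex.Re z, complex.Im z).

Lemma r2cK : cancel (@r2c R) c2r. Proof. by case. Qed.

Lemma c2rK : cancel c2r (@r2c R). Proof. by case. Qed.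

Definition upd n (t : n.-tuple R2) (i : 'I_n) (x : R2) : n.-tuple R2 :=
  [tuple if j == i then x else tnth t j | j < n].

Lemma upd_cons0 n (t : n.-tuple R2) x y :
  upd [tuple of x :: t] ord0 y = [tuple of y :: t].
Proof.
apply: eq_from_tnth => j; rewrite tnth_mktuple.
by case: (unliftP ord0 j) => [j'|] -> /=; rewrite ?tnthS ?tnth0.
Qed.

Lemma upd_consS n (t : n.-tuple R2) x y i :
  upd [tuple of x :: t] (lift ord0 i) y = [tuple of x :: upd t i y].
Proof.
apply: eq_from_tnth => j; rewrite tnth_mktuple.
case: (unliftP ord0 j) => [j'|] -> /=; last by rewrite !tnth0.
by rewrite !tnthS tnth_mktuple (inj_eq (@lift_inj _ _)).
Qed.

Definition polysq n (c : n.-tuple R2) (r : R) : set (n.-tuple R2) :=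
  [set t | forall i, sq (r2c (tnth c i)) r (tnth t i)].

Lemma polysq_cons n (c t : n.-tuple R2) x y r :
  polysq [tuple of x :: c] r [tuple of y :: t] <-> sq (r2c x) r y /\ polysq c r t.
Proof.
split=> [H|[H1 H2] i].
  by split=> [|i]; [have := H ord0|have := H (lift ord0 i)]; rewrite ?tnthS ?tnth0.
by case: (unliftP ord0 i) => [j|] ->; rewrite ?tnthS ?tnth0.
Qed.

Lemma measurable_polysq n (c : n.-tuple R2) r : measurable (polysq c r).
Proof.
rewrite (_ : polysq c r = \bigcap_(i in [set: 'I_n]) ((@tnth n R2)^~ i @^-1` sq (r2c (tnth c i)) r)).
  apply: fin_bigcap_measurable => // i _; rewrite -[X in measurable X]setTI.
  by apply: measurable_tnth => //; exact: measurable_sq.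
by apply/seteqP; split => t /= H i; [move=> _|]; apply: H.
Qed.

Definition area_mean_const (p C : R) := forall (g : R[i] -> R[i]) c r (M : R2 -> \bar R),
  0 < r -> (forall x, sq c r x -> cdiff g (r2c x)) ->
  measurable_fun setT M -> (forall x, 0 <= M x)%E ->
  (forall x, sq c r x -> ((nc (g (r2c x)) `^ p)%:E <= M x)%E) ->
  ((r ^+ 2 * nc (g c) `^ p)%:E <= C%:E * \int[leb2 R]_x M x)%E.

Local Open Scope ereal_scope.

Lemma lebesgue_polysq n (c : n.-tuple R2) r : (0 <= r)%R ->
  leb n (polysq c r) = ((4 * r ^+ 2) ^+ n)%:E.
Proof.
move=> r0; rewrite -[LHS]mul1e -integral_cst; last exact: measurable_polysq.
rewrite integral_mkcond; elim: n c => [|n IH] c.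
  rewrite expr0 tuple_integral0; last first.
    by apply/(measurable_restrictT _ _).1 => //; exact: measurable_polysq.
  rewrite patchE mem_set// => i.
  by have := ltn_ord i.
case/tupleP: c => x c; rewrite tuple_integral_cons//; last 2 first.
- apply/(measurable_restrictT _ _).1 => //; exact: measurable_polysq.
- by move=> t; rewrite patchE; case: ifP.
have E y : \int[leb n]_t (cst 1 \_ (polysq [tuple of x :: c] r)) [tuple of y :: t] =
    ((4 * r ^+ 2) ^+ n)%:E * (\1_(sq (r2c x) r) y)%:E.
  rewrite -(IH c); have [yx|yx] := pselect (sq (r2c x) r y).
    rewrite indicE mem_set// mule1; apply: eq_integral => t _; rewrite !patchE.
    by congr (if _ then _ else _); apply/idP/idP; rewrite !inE;
      [by move=> /polysq_cons[]|by move=> ?; apply/polysq_cons].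
  rewrite indicE memNset// mule0; apply: integral0_eq => t _.
  by rewrite patchE memNset// => /polysq_cons[].
under eq_integral do rewrite E.
rewrite ge0_integralZl_EFin//; last 2 first.
- by apply/measurable_EFinP; exact: measurable_indic (measurable_sq _ _).
- by rewrite exprn_ge0// mulr_ge0// sqr_ge0.
rewrite integral_indic ?setIT//; last exact: measurable_sq.
by rewrite [(_ ^+ n.+1)%R]exprSr [RHS]EFinM -(leb2_sq (r2c x) r0).
Qed.

(** With the first coordinate frozen at [y], the induction hypothesis bounds the p-th power at
    [y :: c] by [k * J y], an integral over the other coordinates; [k * J] is then the majorant in
    the one-variable inequality for the first coordinate. *)
Lemma polysq_mean (p C : R) : (0 < C)%R -> area_mean_const p C ->
  forall n (G : n.-tuple R2 -> R[i]) c r (M : n.-tuple R2 -> \bar R), (0 < r)%R ->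
  (forall t i, polysq c r t -> cdiff (fun z => G (upd t i (c2r z))) (r2c (tnth t i))) ->
  measurable_fun setT M -> (forall t, 0 <= M t) ->
  (forall t, polysq c r t -> (nc (G t) `^ p)%:E <= M t) ->
  (r ^+ 2 ^+ n * nc (G c) `^ p)%:E <= (C ^+ n)%:E * \int[leb n]_t M t.
Proof.
move=> C0 HC; elim=> [|n IH] G c r M r0 dG mM M0 GM.
  rewrite !expr0 mul1e mul1r tuple_integral0// (tuple0 c).
  by apply: GM => i; have := ltn_ord i.
case/tupleP: c => x c in dG GM *.
have mMx y : measurable_fun setT (fun t : n.-tuple R2 => M [tuple of y :: t]).
  by apply: measurableT_comp => //; exact: measurable_cons.
have mM2 : measurable_fun setT (fun yt : R2 * n.-tuple R2 => M [tuple of yt.1 :: yt.2]).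
  by apply: measurableT_comp => //; exact: measurable_cons.
rewrite (tuple_integral_cons mM M0).
set J := fun y => \int[leb n]_t M [tuple of y :: t].
have J0 y : 0 <= J y by exact: integral_ge0.
have mJ : measurable_fun setT J.
  exact: (measurable_fun_fubini_tonelli_F (m2 := leb n) _ mM2 (fun=> M0 _)).
have cc : polysq c r c by move=> i; split; rewrite subrr normr0 ltW.
have rn0 : (0 < r ^+ 2 ^+ n)%R by rewrite !exprn_gt0.
pose k := (C ^+ n / r ^+ 2 ^+ n)%R; have k0 : (0 < k)%R by rewrite divr_gt0// exprn_gt0.
have key : (r ^+ 2 * nc (G [tuple of x :: c]) `^ p)%:E <= C%:E * \int[leb2 R]_y (k%:E * J y).
  have := HC (fun z => G [tuple of c2r z :: c]) (r2c x) r (fun y => k%:E * J y) r0.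
  rewrite r2cK; apply.
  - move=> y xy; have : polysq [tuple of x :: c] r [tuple of y :: c] by apply/polysq_cons.
    move=> /(dG _ ord0); rewrite tnth0.
    by under eq_fun do rewrite upd_cons0.
  - exact: measurable_funeM.
  - by move=> y; rewrite mule_ge0// lee_fin ltW.
  move=> y xy; rewrite r2cK.
  have := IH (fun t => G [tuple of y :: t]) c r (fun t => M [tuple of y :: t]) r0 _ (mMx y).
  move=> H; have {H} : (r ^+ 2 ^+ n * nc (G [tuple of y :: c]) `^ p)%:E <= (C ^+ n)%:E * J y.
    apply: H => //; last by move=> t ct; apply: GM; apply/polysq_cons.
    move=> t i ct; have : polysq [tuple of x :: c] r [tuple of y :: t] by apply/polysq_cons.
    move=> /(dG _ (lift ord0 i)); rewrite tnthS.
    by under eq_fun do rewrite upd_consS.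
  move=> H.
  have -> : k%:E = (r ^+ 2 ^+ n)^-1%:E * (C ^+ n)%:E by rewrite -EFinM mulrC.
  by rewrite -muleA lee_pdivlMl// -EFinM.
rewrite ge0_integralZl_EFin ?(ltW k0)// in key.
have := lee_wpmul2l (_ : 0 <= (r ^+ 2 ^+ n)%:E) key.
rewrite lee_fin => /(_ (ltW rn0)).
rewrite -EFinM mulrA -exprSr => /le_trans; apply.
rewrite !muleA -!EFinM; apply: lee_wpmul2r; first exact: integral_ge0.
rewrite lee_fin /k le_eqVlt; apply/orP; left; apply/eqP.
by rewrite [RHS]exprS -mulrA mulrCA; congr (_ * _)%R; rewrite mulrC divfK// gt_eqF.
Qed.

End polydisc.

Section complex_measurability.
Variables (R : realType) (d : measure_display) (T : measurableType d).
Local Notation R2 := (measurableTypeR R * measurableTypeR R)%type.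
Implicit Types (g h : T -> R[i]).

Definition cmeas h := measurable_fun setT (fun x => complex.Re (h x)) /\
                      measurable_fun setT (fun x => complex.Im (h x)).

Lemma cmeas_cst c : cmeas (fun=> c).
Proof. by split; exact: measurable_cst. Qed.

Lemma cmeas_add g h : cmeas g -> cmeas h -> cmeas (fun x => g x + h x).
Proof.
move=> [g1 g2] [h1 h2]; split.
  by under eq_fun do rewrite Re_add; exact: measurable_funD.
by under eq_fun do rewrite Im_add; exact: measurable_funD.
Qed.

Lemma cmeas_mul g h : cmeas g -> cmeas h -> cmeas (fun x => g x * h x).
Proof.
move=> [g1 g2] [h1 h2]; split.
  rewrite (_ : (fun _ => _) = fun x => complex.Re (g x) * complex.Re (h x) -
     complex.Im (g x) * complex.Im (h x)).
    by apply: measurable_funB; exact: measurable_funM.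
  by apply/funext => x; case: (g x) (h x) => a b [].
rewrite (_ : (fun _ => _) = fun x => complex.Re (g x) * complex.Im (h x) +
   complex.Im (g x) * complex.Re (h x)).
  by apply: measurable_funD; exact: measurable_funM.
by apply/funext => x; case: (g x) (h x) => a b [].
Qed.

Lemma cmeas_opp h : cmeas h -> cmeas (fun x => - h x).
Proof.
move=> mh; under eq_fun do rewrite -mulN1r; apply: cmeas_mul => //.
Qed.

Lemma cmeas_conj h : cmeas h -> cmeas (fun x => (h x)^*%C).
Proof.
move=> [h1 h2]; split.
  rewrite (_ : (fun _ => _) = fun x => complex.Re (h x))//.
  by apply/funext => x; case: (h x).
rewrite (_ : (fun _ => _) = fun x => - complex.Im (h x)); first exact: measurableT_comp.
by apply/funext => x; case: (h x).
Qed.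

Lemma cmeas_sum (I : Type) (s : seq I) (F : I -> T -> R[i]) :
  (forall i, cmeas (F i)) -> cmeas (fun x => \sum_(i <- s) F i x).
Proof.
move=> mF; elim: s => [|i s IH].
  by under eq_fun do rewrite big_nil; exact: cmeas_cst.
by under eq_fun do rewrite big_cons; exact: cmeas_add.
Qed.

Lemma cmeas_nc h : cmeas h -> measurable_fun setT (fun x => Normc.normc (h x)).
Proof.
move=> [h1 h2].
rewrite (_ : (fun _ => _) = @Num.sqrt R \o (fun x => complex.Re (h x) ^+ 2 + complex.Im (h x) ^+ 2)).
  apply: measurableT_comp; last by apply: measurable_funD; exact: measurable_funX.
  by apply: continuous_measurable_fun; exact: sqrt_continuous.
by apply/funext => x /=; case: (h x).
Qed.

End complex_measurability.

(** * Sheared products of squares *)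

Section region.
Variables (R : realType) (n : nat).
Local Notation nc := (@Normc.normc R).
Local Notation R2 := (measurableTypeR R * measurableTypeR R)%type.
Local Notation Cn1 := (Cn R n.+1).
Implicit Types (z w : Cn1) (k : 'I_n.+1) (b : 'I_n -> R[i]).

Definition csq (d : R[i]) (r : R) := `|complex.Re d| <= r /\ `|complex.Im d| <= r.

Lemma sq_csq c r (x : R2) : sq c r x <-> csq (r2c x - c) r.
Proof. by case: c x => c1 c2 [x1 x2]. Qed.

(** The linear form that replaces [w 0 k - z 0 k] in a unipotent change of variables, which
    preserves both holomorphy and volume. *)
Definition shear k b z w : R[i] :=
  w 0 k - z 0 k + \sum_j b j * (w 0 (lift k j) - z 0 (lift k j)).

Definition region k b z (rho r : R) : set Cn1 :=
  [set w : Cn1 | (forall j, csq (w 0 (lift k j) - z 0 (lift k j)) rho) /\ csq (shear k b z w) r].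

(** Directions off the coordinate axes matter: varying coordinate [lift k i] with the shear fixed
    moves [w] along [delta_mx 0 (lift k i) - b i *: delta_mx 0 k]. *)
Definition ldiff m (f : Cn R m -> R[i]) (w : Cn R m) :=
  forall e : Cn R m, cdiff (fun zeta => f (w + zeta *: e)) 0.

Lemma cdiff_shift (g : R[i] -> R[i]) a : cdiff g 0 -> cdiff (fun zeta => g (zeta - a)) a.
Proof.
move=> [d dg]; exists d => e e0; have [del del0 D] := dg e e0.
exists del => // w wa; have := D (w - a); rewrite !subr0 subrr.
exact.
Qed.

Lemma ge0_integral_lebesgue_Cn m (M : Cn R m -> \bar R) :
  measurable_fun setT M -> (forall w : Cn R m, 0 <= M w)%E ->
  (\int[@lebesgue_Cn R m]_w M w = \int[@lebesgue_tuple R m]_t M (Cn_of_coords t))%E.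
Proof.
by move=> mM M0; rewrite ge0_integral_pushforward//; exact: measurable_Cn_of_coords.
Qed.

Section fibers.
Variables (k : 'I_n.+1) (b : 'I_n -> R[i]) (z : Cn1).

Let W x (t : n.-tuple R2) : Cn1 := Cn_of_coords (ins k x t).

Let Wk x t : W x t 0 k = r2c x.
Proof. by rewrite /W mxE tnth_ins. Qed.

Let Wlift x t j : W x t 0 (lift k j) = r2c (tnth t j).
Proof. by rewrite /W mxE tnth_ins_lift. Qed.

(** Over a fixed [t] the shear is a translation in coordinate [k], which vanishes at this point: the
    fibre of the region is a square about it. *)
Let center (t : n.-tuple R2) : R[i] :=
  z 0 k - \sum_j b j * (r2c (tnth t j) - z 0 (lift k j)).

Let c' : n.-tuple R2 := [tuple c2r (z 0 (lift k j)) | j < n].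

Let lift_eqF j : (lift k j == k) = false.
Proof. by rewrite eq_sym (negbTE (neq_lift _ _)). Qed.

Let lift_eqF' j : (k == lift k j) = false.
Proof. by rewrite (negbTE (neq_lift _ _)). Qed.

Let shearW x t : shear k b z (W x t) = r2c x - center t.
Proof.
rewrite /shear Wk /center; under eq_bigr do rewrite Wlift.
by rewrite opprB addrCA addrC.
Qed.

Let regionW rho r x t : region k b z rho r (W x t) <-> polysq c' rho t /\ sq (center t) r x.
Proof.
split=> -[H1 H2]; split.
- by move=> j; rewrite tnth_mktuple c2rK; apply/sq_csq; rewrite -(Wlift x).
- by apply/sq_csq; rewrite -shearW.
- by move=> j; have := H1 j; rewrite tnth_mktuple c2rK => /sq_csq; rewrite Wlift.
- by rewrite shearW; apply/sq_csq.
Qed.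

Local Open Scope ereal_scope.

(** The mean over a fibre bounds [G t], the value of [f] at the centre of the fibre over [t]. These
    centres form the affine hyperplane where the shear vanishes, along which [G] is again
    differentiable in each coordinate; [polysq_mean] applies to [G], and [G c' = f z]. *)
Lemma region_mean (p C rho r : R) (f : Cn1 -> R[i]) (M : Cn1 -> \bar R) :
  (0 < C)%R -> area_mean_const p C -> (0 < rho)%R -> (0 < r)%R ->
  (forall w, region k b z rho r w -> ldiff f w) ->
  measurable_fun setT M -> (forall w, 0 <= M w) ->
  (forall w, region k b z rho r w -> (nc (f w) `^ p)%:E <= M w) ->
  (rho ^+ 2 ^+ n * r ^+ 2 * nc (f z) `^ p)%:E <=
    (C ^+ n.+1)%:E * \int[@lebesgue_Cn R n.+1]_w M w.
Proof.
move=> C0 HC rho0 r0 df mM M0 fM.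
rewrite ge0_integral_lebesgue_Cn//.
pose M' := fun t : n.+1.-tuple R2 => M (Cn_of_coords t).
have mM' : measurable_fun setT M'.
  by apply: measurableT_comp => //; exact: measurable_Cn_of_coords.
have M'0 t : 0 <= M' t by exact: M0.
rewrite -/(\int[@lebesgue_tuple R n.+1]_t M' t) (tuple_integral_insC k mM' M'0).
pose J t := \int[leb2 R]_x M' (ins k x t); rewrite -[X in _ * X]/(\int[@lebesgue_tuple R n]_t J t).
have mJ : measurable_fun setT J by exact: measurable_integral_ins.
have J0 t : 0 <= J t by exact: integral_ge0.
pose G t := f (W (c2r (center t)) t).
have inner t : polysq c' rho t -> (r ^+ 2 * nc (G t) `^ p)%:E <= C%:E * J t.
  move=> ct; apply: (HC (fun zeta => f (W (c2r zeta) t)) (center t) r) => //.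
  - move=> x xc; have /df : region k b z rho r (W x t) by apply/regionW.
    move=> /(_ (delta_mx 0%R k)) /(@cdiff_shift _ (r2c x)).
    congr cdiff; apply/funext => zeta; congr f; apply/rowP => i.
    rewrite !mxE eqxx /=; case: (unliftP k i) => [j|] ->.
      by rewrite !tnth_ins_lift lift_eqF mulr0 addr0.
    rewrite !tnth_ins eqxx mulr1 -/(r2c _) -/(r2c _) c2rK.
    by rewrite addrC subrK.
  - by apply: measurableT_comp => //; exact: measurable_ins.
  - by move=> x xc; rewrite r2cK; apply: fM; apply/regionW.
have := @polysq_mean R p C C0 HC n G c' rho (fun t => (C / r ^+ 2)%:E * J t) rho0.
have Gc : G c' = f z.
  congr f; apply/rowP => i; case: (unliftP k i) => [j|] ->.
    by rewrite Wlift tnth_mktuple c2rK.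
  rewrite Wk c2rK /center big1 ?subr0// => j _.
  by rewrite tnth_mktuple c2rK subrr mulr0.
rewrite Gc => H; have {H} : (rho ^+ 2 ^+ n * nc (f z) `^ p)%:E <=
    (C ^+ n)%:E * \int[@lebesgue_tuple R n]_t ((C / r ^+ 2)%:E * J t).
  apply: H.
  - move=> t i ct.
    have /df : region k b z rho r (W (c2r (center t)) t).
      by apply/regionW; split=> //; rewrite /sq /= !subrr normr0 ltW.
    (* The direction followed by the centres: [center t] moves by [- b i] times the increment of
       coordinate [i] of [t]. *)
    move=> /(_ (delta_mx 0 (lift k i) - b i *: delta_mx 0 k)%R) /(@cdiff_shift _ (r2c (tnth t i))).
    congr cdiff; apply/funext => zeta; congr f; apply/rowP => l.
    case: (unliftP k l) => [j|] ->.
      rewrite Wlift tnth_mktuple ![in LHS]mxE tnth_ins_lift -/(r2c _).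
      rewrite eqxx /= lift_eqF mulr0 subr0 (inj_eq (@lift_inj _ _)).
      by case: eqVneq => [->|_]; rewrite ?mulr1 ?mulr0 ?addr0// c2rK addrC subrK.
    rewrite Wk c2rK ![in LHS]mxE tnth_ins -/(r2c _) c2rK eqxx /= lift_eqF' eqxx /= mulr1n mulr0n.
    rewrite /center (bigD1 i)//= [in RHS](bigD1 i)//= tnth_mktuple eqxx c2rK.
    rewrite (eq_bigr (fun j => b j * (r2c (tnth (upd t i (c2r zeta)) j) - z 0%R (lift k j)))%R).
      by ring.
    by move=> j ji; rewrite tnth_mktuple (negbTE ji).
  - exact: measurable_funeM.
  - by move=> t; rewrite mule_ge0// lee_fin divr_ge0// ltW// exprn_gt0.
  - move=> t /inner h.
    have -> : (C / r ^+ 2)%:E = (r ^+ 2)^-1%:E * C%:E by rewrite -EFinM mulrC.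
    by rewrite -muleA lee_pdivlMl ?exprn_gt0// -EFinM.
have k0 : (0 < C / r ^+ 2)%R by rewrite divr_gt0// exprn_gt0.
rewrite ge0_integralZl_EFin ?(ltW k0)// => H.
have := lee_wpmul2l (_ : 0 <= (r ^+ 2)%:E) H.
rewrite lee_fin sqr_ge0 => /(_ isT).
rewrite -EFinM mulrA [(r ^+ 2 * _)%R]mulrC => /le_trans; apply.
rewrite !muleA -!EFinM; apply: lee_wpmul2r; first exact: integral_ge0.
rewrite lee_fin le_eqVlt; apply/orP; left; apply/eqP.
rewrite [RHS]exprSr -mulrA mulrCA; congr (_ * _)%R.
by rewrite mulrC divfK// gt_eqF// exprn_gt0.
Qed.

Lemma measurable_region rho r : measurable (region k b z rho r).
Proof.
have mw (j : 'I_n.+1) : cmeas (fun w : Cn1 => w 0%R j).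
  by split; [exact: measurable_Re_coord|exact: measurable_Im_coord].
have mcsq (g : Cn1 -> R[i]) s : cmeas g -> measurable [set w | csq (g w) s].
  move=> [g1 g2]; rewrite (_ : [set w | _] =
     (fun w => complex.Re (g w)) @^-1` `[(- s)%R, s] `&` (fun w => complex.Im (g w)) @^-1` `[(- s)%R, s]).
    apply: measurableI; rewrite -[X in measurable X]setTI.
      exact: g1.
    exact: g2.
  by apply/seteqP; split => w; rewrite /csq /= !in_itv/= !ler_norml.
rewrite (_ : region k b z rho r =
  (\bigcap_(j in [set: 'I_n]) [set w : Cn1 | csq (w 0 (lift k j) - z 0 (lift k j))%R rho]) `&`
  [set w | csq (shear k b z w) r]); last first.
  by apply/seteqP; split => w [/= H1 H2]; split => // j; [move=> _|]; exact: H1.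
apply: measurableI.
  apply: fin_bigcap_measurable => // j _; apply: mcsq.
  by apply: cmeas_add; [exact: mw|exact: cmeas_cst].
apply: mcsq; apply: cmeas_add.
  by apply: cmeas_add; [exact: mw|exact: cmeas_cst].
apply: cmeas_sum => j; apply: cmeas_mul; first exact: cmeas_cst.
by apply: cmeas_add; [exact: mw|exact: cmeas_cst].
Qed.

(** Every nonempty fibre is a square of area [4 * r ^+ 2], whatever its centre. *)
Lemma region_volume rho r : (0 <= rho)%R -> (0 <= r)%R ->
  @lebesgue_Cn R n.+1 (region k b z rho r) = ((4 * rho ^+ 2) ^+ n * (4 * r ^+ 2))%:E.
Proof.
move=> rho0 r0; have mE := measurable_region rho r.
rewrite -[LHS]mul1e -integral_cst// integral_mkcond.
pose M := (cst 1 \_ (region k b z rho r) : Cn1 -> \bar R).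
have mM : measurable_fun setT M by apply/(measurable_restrictT _ _).1.
have M0 w : 0 <= M w by rewrite /M patchE; case: ifP.
rewrite -[LHS]/(\int[@lebesgue_Cn R n.+1]_w M w) ge0_integral_lebesgue_Cn//.
pose M' := fun t : n.+1.-tuple R2 => M (Cn_of_coords t).
have mM' : measurable_fun setT M'.
  by apply: measurableT_comp => //; exact: measurable_Cn_of_coords.
have M'0 t : 0 <= M' t by exact: M0.
rewrite -/(\int[@lebesgue_tuple R n.+1]_t M' t) (tuple_integral_insC k mM' M'0).
have E t : \int[leb2 R]_x M' (ins k x t) = (4 * r ^+ 2)%:E * (\1_(polysq c' rho) t)%:E.
  have [ct|ct] := pselect (polysq c' rho t).
    rewrite indicE mem_set// mule1 -(leb2_sq (center t) r0) -[RHS]mul1e.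
    rewrite -(integral_cst (leb2 R) (measurable_sq (center t) r)) [RHS]integral_mkcond.
    apply: eq_integral => x _; rewrite /M' /M !patchE; congr (if _ then _ else _).
    by apply/idP/idP; rewrite !inE; [move=> /regionW[]|move=> h; apply/regionW].
  rewrite indicE memNset// mule0; apply: integral0_eq => x _.
  by rewrite /M' /M patchE memNset// => /regionW[].
under eq_integral do rewrite E.
rewrite ge0_integralZl_EFin//; last 2 first.
- by apply/measurable_EFinP; exact: measurable_indic (measurable_polysq _ _).
- by rewrite mulr_ge0// sqr_ge0.
rewrite integral_indic ?setIT//; last exact: measurable_polysq.
by rewrite [X in _ * X]lebesgue_polysq// -EFinM mulrC.
Qed.

End fibers.
End region.

(** * Open sets, continuity and Borel measurability *)

Section euclidean_topology.
Variables (R : realType) (n : nat).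
Local Notation nc := (@Normc.normc R).
Local Notation C_n := (Cn R n).
Implicit Types (w z u : C_n) (U V : set C_n) (h : C_n -> R).

(* Topological notions are stated with real-valued boxes, since the uniform
   structure of [Cn R n] has its radii in [R[i]]. *)
Definition box w (r : R) : set C_n := [set w' : C_n | forall j, csq (w' 0 j - w 0 j) r].

Definition eopen U := forall w, U w -> exists2 r : R, 0 < r & box w r `<=` U.

Definition econt h w := forall e, 0 < e -> exists2 r : R, 0 < r &
  forall w', box w r w' -> `|h w' - h w| < e.

Lemma box_le w (r s : R) : r <= s -> box w r `<=` box w s.
Proof. by move=> rs w' H j; have [h1 h2] := H j; split; exact: le_trans rs. Qed.

Lemma eopen_bigcup (I : Type) (D : set I) (F : I -> set C_n) :
  (forall i, D i -> eopen (F i)) -> eopen (\bigcup_(i in D) F i).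
Proof.
move=> oF w [i Di /(oF i Di)[r r0 rF]]; exists r => // w' /rF Fw'.
by exists i.
Qed.

Lemma econt_gt U h (c : R) : eopen U -> (forall w, U w -> econt h w) ->
  eopen [set w | U w /\ c < h w].
Proof.
move=> oU ch w [Uw cw]; have [r r0 rU] := oU w Uw.
have e0 : 0 < h w - c by rewrite subr_gt0.
have [s s0 sh] := ch w Uw _ e0.
exists (Num.min r s); first by rewrite lt_min r0 s0.
move=> w' H; split; first by apply: rU; apply: box_le H; rewrite ge_min lexx.
have := sh w' (box_le _ H); rewrite ge_min lexx orbT => /(_ isT).
by rewrite ltr_norml; clear; lra.
Qed.

Lemma econt_cst (c : R) w : econt (fun=> c) w.
Proof. by move=> e e0; exists 1 => // w' _; rewrite subrr normr0. Qed.

Lemma econt_add h g w : econt h w -> econt g w -> econt (fun u => h u + g u) w.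
Proof.
move=> ch cg e e0; have e2 : 0 < e / 2 by rewrite divr_gt0.
have [r r0 rh] := ch _ e2; have [s s0 sg] := cg _ e2.
exists (Num.min r s); first by rewrite lt_min r0 s0.
move=> w' H.
have := rh w' (box_le _ H); rewrite ge_min lexx => /(_ isT).
have := sg w' (box_le _ H); rewrite ge_min lexx orbT => /(_ isT).
by rewrite !ltr_norml; clear; lra.
Qed.

Lemma econt_mul h g w : econt h w -> econt g w -> econt (fun u => h u * g u) w.
Proof.
move=> ch cg e e0; pose K := 1 + `|h w| + `|g w|.
have K0 : 0 < K by rewrite /K -addrA ltr_wpDr// addr_ge0.
pose d := Num.min 1 (e / K); have d0 : 0 < d by rewrite /d lt_min ltr01 divr_gt0.
have [r r0 rh] := ch _ d0; have [s s0 sg] := cg _ d0.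
exists (Num.min r s); first by rewrite lt_min r0 s0.
move=> w' H.
have := rh w' (box_le _ H); rewrite ge_min lexx => /(_ isT).
have := sg w' (box_le _ H); rewrite ge_min lexx orbT => /(_ isT) h1 h2.
have -> : h w' * g w' - h w * g w =
  (h w' - h w) * (g w' - g w) + (h w' - h w) * g w + h w * (g w' - g w) by ring.
apply: (@lt_le_trans _ _ (d * K)); last first.
  by rewrite -ler_pdivlMr// /d ge_min lexx orbT.
have dh := ltW h2; have dg := ltW h1.
have -> : d * K = d + d * `|g w| + `|h w| * d by rewrite /K; ring.
apply: (le_lt_trans (ler_normD _ _)); rewrite [X in _ + X]normrM.
apply: ltr_leD; last exact: ler_wpM2l.
apply: (le_lt_trans (ler_normD _ _)); rewrite !normrM.
apply: ltr_leD; last exact: ler_wpM2r.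
apply: (le_lt_trans (ler_wpM2l (normr_ge0 _) dg)).
have d1 : d <= 1 by rewrite /d ge_min lexx.
apply: le_lt_trans (_ : `|h w' - h w| * 1 < d); last by rewrite mulr1.
exact: ler_wpM2l.
Qed.

Lemma econt_opp h w : econt h w -> econt (fun u => - h u) w.
Proof.
move=> ch e e0; have [r r0 rh] := ch _ e0; exists r => // w' /rh.
by rewrite -opprD normrN.
Qed.

Lemma econt_sum (I : Type) (s : seq I) (F : I -> C_n -> R) w :
  (forall i, econt (F i) w) -> econt (fun u => \sum_(i <- s) F i u) w.
Proof.
move=> cF; elim: s => [|i s IH].
  by under eq_fun do rewrite big_nil; exact: econt_cst.
by under eq_fun do rewrite big_cons; exact: econt_add.
Qed.

Lemma econt_Re j w : econt (fun u => complex.Re (u 0 j)) w.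
Proof.
move=> e e0; exists (e / 2); first by rewrite divr_gt0.
move=> w' /(_ j)[+ _]; rewrite Re_sub => /le_lt_trans; apply.
by move: e0; clear; lra.
Qed.

Lemma econt_Im j w : econt (fun u => complex.Im (u 0 j)) w.
Proof.
move=> e e0; exists (e / 2); first by rewrite divr_gt0.
move=> w' /(_ j)[_]; rewrite Im_sub => /le_lt_trans; apply.
by move: e0; clear; lra.
Qed.

Lemma cmeas_coord j : cmeas (fun w : C_n => w 0 j).
Proof. by split; [exact: measurable_Re_coord|exact: measurable_Im_coord]. Qed.

Lemma measurable_csq d (T : measurableType d) (g : T -> R[i]) s :
  cmeas g -> measurable [set x | csq (g x) s].
Proof.
move=> [g1 g2]; rewrite (_ : [set w | _] =
  (fun x => complex.Re (g x)) @^-1` `[- s, s] `&` (fun x => complex.Im (g x)) @^-1` `[- s, s]).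
  apply: measurableI; rewrite -[X in measurable X]setTI.
    exact: g1.
  exact: g2.
by apply/seteqP; split => w; rewrite /csq /= !in_itv/= !ler_norml.
Qed.

(** An open set is the union of the boxes it contains that have rational centres and radii
    [1 / (m + 1)], a countable family. Measurability of Bergman balls, of the modulus of [f] and of
    the maximal function all rest on this. *)
Lemma eopen_measurable U : eopen U -> measurable U.
Proof.
move=> oU.
pose c (q : {ffun 'I_n -> rat * rat} * nat) : C_n :=
  \row_j ((ratr (q.1 j).1 : R) +i* (ratr (q.1 j).2 : R)).
pose rad (q : {ffun 'I_n -> rat * rat} * nat) : R := q.2.+1%:R^-1.
pose F q := [set w : C_n | box (c q) (rad q) w /\ box (c q) (rad q) `<=` U].
have -> : U = \bigcup_q F q.
  apply/seteqP; split => [w Uw|w [q _ [wq]]]; last exact.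
  have [r r0 rU] := oU w Uw.
  (* Half of [r] is spent on moving [w] to a rational centre, the other half on the radius of the
     box. *)
  have [m mr] : exists m : nat, 2 / r < m.+1%:R.
    exists (Num.bound (2 / r)); apply: (lt_trans (archi_boundP _)).
      by rewrite divr_ge0// ltW.
    by rewrite ltr_nat.
  have m0 : 0 < m.+1%:R^-1 :> R by rewrite invr_gt0 ltr0n.
  have mr2 : 2 * m.+1%:R^-1 <= r.
    by rewrite ler_pdivrMr ?ltr0n// mulrC -ler_pdivrMr// ltW.
  have ap (x : R) : exists q : rat, `|x - ratr q| <= m.+1%:R^-1.
    have [|q] := @rat_in_itvoo R (x - m.+1%:R^-1) (x + m.+1%:R^-1).
      by rewrite ltrD2l; apply: lt_trans m0; rewrite oppr_lt0.
    rewrite in_itv/= => /andP[q1 q2]; exists q.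
    by rewrite ler_norml; move: q1 q2; set i := _^-1; clear; lra.
  pose q1 j := projT1 (cid (ap (complex.Re (w 0 j)))).
  pose q2 j := projT1 (cid (ap (complex.Im (w 0 j)))).
  exists ([ffun j => (q1 j, q2 j)], m) => //; split.
    move=> j; rewrite /csq Re_sub Im_sub !mxE /= !ffunE /=.
    by split; [exact: (projT2 (cid (ap _)))|exact: (projT2 (cid (ap _)))].
  move=> w' H; apply: rU; apply: (box_le mr2) => j.
  have := H j; rewrite /csq !Re_sub !Im_sub !mxE /= !ffunE /=.
  have := projT2 (cid (ap (complex.Re (w 0 j)))).
  have := projT2 (cid (ap (complex.Im (w 0 j)))).
  rewrite -/(q1 j) -/(q2 j) /rad /= !ler_norml.
  by move=> h1 h2 [h3 h4]; move: h1 h2 h3 h4; set i := _^-1; clear; split; lra.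
apply: countable_bigcupT_measurable; first exact: countableP.
move=> q; have [H|H] := pselect (box (c q) (rad q) `<=` U); last first.
  rewrite (_ : F q = set0)//; apply/seteqP; split => // w [_] //.
rewrite (_ : F q = \bigcap_(j in [set: 'I_n]) [set w : C_n | csq (w 0 j - c q 0 j) (rad q)]).
  apply: fin_bigcap_measurable => // j _; apply: measurable_csq.
  by apply: cmeas_add; [exact: cmeas_coord|exact: cmeas_cst].
apply/seteqP; split => w; first by move=> [wq _] j _; exact: wq.
by move=> wq; split => // j; exact: wq.
Qed.

End euclidean_topology.

(** * From Frechet differentiability to complex lines and real continuity *)

Section holomorphic_functions.
Variables (R : realType) (n : nat).
Local Notation nc := (@Normc.normc R).
Local Notation C_n := (Cn R n).
Implicit Types (w z u : C_n).

Lemma normC_nc (c : R[i]) : `|c| = (nc c)%:C.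
Proof. by rewrite normc_def; case: c. Qed.

Lemma differentiable_ldiff (f : C_n -> R[i]) z :
  differentiable (f : C_n -> R[i]^o) z -> ldiff f z.
Proof.
move=> df e; have /cvg_ex[/= l] := diff_derivable (v := e) df.
move=> /cvgrPdist_lt H; exists l => eps eps0.
have /H : 0 < eps%:C by rewrite ltcR.
move=> [del /= del0 D].
(* Positivity in the order of [R[i]] makes the radius [del] real, so its real part can serve as a
   radius. *)
have [dE] : complex.Im del = 0 /\ 0 < complex.Re del.
  by move: del0; rewrite ltcE /= => /andP[/eqP].
move=> dRe; exists (complex.Re del) => // t; rewrite !subr0 => t0.
have [->|tn0] := eqVneq t 0.
  by rewrite scale0r addr0 subrr mulr0 subrr !Normc.normc0 mulr0.
have /D : `|0 - t| < del.
  rewrite sub0r normrN normC_nc; case: (del) dE t0 => a b /= -> t0.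
  by rewrite ltcR.
move=> /(_ tn0); rewrite /= scale0r addr0.
rewrite normC_nc ltcR => /ltW h.
have -> : f (z + t *: e) - f z - l * t = - ((l - t^-1 * (f (t *: e + z) - f z)) * t).
  by rewrite (addrC z); field.
by rewrite ncN Normc.normcM ler_wpM2r ?nc_ge0.
Qed.

Lemma differentiable_econt (f : C_n -> R[i]) z :
  differentiable (f : C_n -> R[i]^o) z -> econt (fun w => nc (f w)) z.
Proof.
move=> /differentiable_continuous /cvgrPdist_lt cf e e0.
have /cf/nbhs_ballP[del /= del0 D] : 0 < e%:C by rewrite ltcR.
have [dE dRe] : complex.Im del = 0 /\ 0 < complex.Re del.
  by move: del0; rewrite ltcE /= => /andP[/eqP].
exists (complex.Re del / 3); first by rewrite divr_gt0.
move=> w' H; have /D : ball z del w'.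
  split => // i j; rewrite -ball_normE /ball_ /= normC_nc.
  have [h1 h2] := H j; rewrite (ord1 i).
  have : nc (z 0 j - w' 0 j) < complex.Re del.
    rewrite ncBC; apply: (le_lt_trans (nc_le _)).
    by apply: (le_lt_trans (lerD h1 h2)); move: dRe; clear; lra.
  by case: (del) dE => a b /= ->; rewrite ltcR.
rewrite /= normC_nc ltcR => h; apply: le_lt_trans h.
rewrite ler_norml; apply/andP; split.
  rewrite lerNl opprB lerBlDr -[X in nc X <= _](subrK (f w')).
  exact: ncD.
by rewrite lerBlDr ncBC -[X in nc X <= _](subrK (f z)) ncD.
Qed.

End holomorphic_functions.

(** * Geometry of Bergman balls *)

Section ball_geometry.
Variables (R : realType) (n : nat).
Local Notation nc := (@Normc.normc R).
Local Notation C_n := (Cn R n).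
Implicit Types (w z u : C_n) (th : R).

Definition defect z : R := 1 - enorm z ^+ 2.

Definition kern z w : R := nc (1 - cdot z w).

(* [near th z w] says that [1 - enorm (moebius z w) ^+ 2 > th], by [moebius_defect]. *)
Definition near th z w := [/\ unit_ball z, unit_ball w &
  th * kern z w ^+ 2 < defect z * defect w].

Lemma sqr_le (x y : R) : 0 <= x -> x <= y -> x ^+ 2 <= y ^+ 2.
Proof. by move=> x0 xy; rewrite lerXn2r// nnegrE// (le_trans x0). Qed.

Lemma enorm_ge0 z : 0 <= enorm z. Proof. exact: sqrtr_ge0. Qed.

Lemma enorm_sqr z : enorm z ^+ 2 = \sum_k nc (z 0 k) ^+ 2.
Proof. by rewrite /enorm sqr_sqrtr// sumr_ge0// => k _; exact: sqr_ge0. Qed.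

Lemma nc_coord_enorm z k : nc (z 0 k) <= enorm z.
Proof.
rewrite -(@ler_pXn2r _ 2)// ?nnegrE ?nc_ge0 ?enorm_ge0// enorm_sqr (bigD1 k)//=.
by rewrite lerDl sumr_ge0// => j _; exact: sqr_ge0.
Qed.

Lemma defect_gt0 z : unit_ball z -> 0 < defect z.
Proof. exact: ball_defect_gt0. Qed.

Lemma defect_le1 z : defect z <= 1.
Proof. by rewrite /defect gerBl sqr_ge0. Qed.

Lemma defect_gt0_ball z : 0 < defect z -> unit_ball z.
Proof.
rewrite /defect subr_gt0 /unit_ball /= => h.
by rewrite -(@ltr_pXn2r _ 2)// ?nnegrE ?enorm_ge0// expr1n.
Qed.

Lemma kernC z w : kern z w = kern w z.
Proof. by rewrite /kern cdotC -nc_J rmorphB rmorph1 /= conjcK. Qed.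

Lemma kern_ge0 z w : 0 <= kern z w. Proof. exact: nc_ge0. Qed.

Lemma near_sym th z w : near th z w -> near th w z.
Proof. by move=> [? ? h]; split; rewrite // kernC [defect w * _]mulrC. Qed.

(** [|1 - <z,w>| >= 1 - |z| |w| >= 1 - |z|], and [1 - |z|^2 <= 2 (1 - |z|)]. *)
Lemma defect_le_kern z w : unit_ball z -> unit_ball w -> defect z <= 2 * kern z w.
Proof.
move=> z1 w1.
have cs := cauchy_schwarz z w; rewrite /unit_ball /= in z1 w1.
have h : 1 <= kern z w + nc (cdot z w).
  rewrite -[leLHS](@Normc.normc1 R).
  by rewrite -[X in nc X <= _](subrK (cdot z w)) ncD.
have zw : enorm z * enorm w <= enorm z by rewrite ler_piMr ?enorm_ge0// ltW.
have z0 := enorm_ge0 z.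
rewrite /defect expr2; nra.
Qed.

Lemma kern_gt0 z w : unit_ball z -> unit_ball w -> 0 < kern z w.
Proof.
move=> z1 w1; have := defect_le_kern z1 w1; have := defect_gt0 z1; lra.
Qed.

(** Divide [th * kern z w ^+ 2 < defect z * defect w <= defect z * (2 * kern z w)] by [kern z w]. *)
Lemma near_kern_le th z w : 0 < th -> near th z w -> kern z w <= 2 / th * defect z.
Proof.
move=> th0 [z1 w1 h]; have K0 := kern_gt0 z1 w1.
have dw : defect w <= 2 * kern z w by rewrite kernC; exact: defect_le_kern.
have dz := defect_gt0 z1.
rewrite mulrAC ler_pdivlMr// -(ler_pM2r K0) mulrC.
have := ler_wpM2l (ltW dz) dw; rewrite expr2 in h; nra.
Qed.

Lemma near_defect_le th z w : 0 < th -> near th z w -> defect w <= 4 / th * defect z.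
Proof.
move=> th0 nzw; have [z1 w1 _] := nzw.
have := near_kern_le th0 nzw; have := defect_le_kern w1 z1; rewrite kernC.
have -> : 4 / th = 2 * (2 / th) by field; rewrite gt_eqF.
rewrite -mulrA; lra.
Qed.

Lemma enormB_sqr z w :
  enorm (z - w) ^+ 2 = enorm z ^+ 2 + enorm w ^+ 2 - 2 * complex.Re (cdot z w).
Proof.
apply: (@complexI R); rewrite -cdotE !(cdotDl, cdotDr, cdotNl, cdotNr).
rewrite (cdotC w z) !cdotE.
by case: (cdot z w) => a b; apply/eqP; rewrite eq_complex /=; apply/andP; split; apply/eqP; ring.
Qed.

(** In the ball, [|z|^2 + |w|^2 - 2 Re <z,w>] is at most [2 Re (1 - <z,w>)]. *)
Lemma enormB_kern z w : unit_ball z -> unit_ball w ->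
  enorm (z - w) ^+ 2 <= 2 * kern z w.
Proof.
move=> /defect_gt0 z1 /defect_gt0 w1; rewrite enormB_sqr.
have := nc_Re (1 - cdot z w); rewrite -/(kern z w) Re_sub /= ler_norml.
by move: z1 w1; rewrite /defect; clear; lra.
Qed.

(** From [1 - <z,u> = (1 - <z,w>) + (1 - <w,u>) - (1 - |w|^2) + <z - w, w - u>], where the last term
    is at most [kern z w + kern w u] by Cauchy-Schwarz, [enormB_kern] and the inequality of
    arithmetic and geometric means. *)
Lemma kern_quasi_triangle z w u : unit_ball z -> unit_ball w -> unit_ball u ->
  kern z u <= 2 * kern z w + 2 * kern w u + defect w.
Proof.
move=> z1 w1 u1.
have -> : kern z u = nc ((1 - cdot z w) + (1 - cdot w u) - (defect w)%:C + cdot (z - w) (w - u)).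
  rewrite /kern /defect; congr nc; rewrite !(cdotDl, cdotDr, cdotNl, cdotNr) cdotE.
  rewrite rmorphB rmorph1 /=; ring.
apply: (le_trans (ncD _ _)).
have h1 := le_trans (ncB _ _) (lerD (ncD (1 - cdot z w) (1 - cdot w u)) (lexx (nc (defect w)%:C))).
rewrite nc_real gtr0_norm ?defect_gt0// in h1.
have h2 := cauchy_schwarz (z - w) (w - u).
have h3 := enormB_kern z1 w1; have h4 := enormB_kern w1 u1.
have h5 : enorm (z - w) * enorm (w - u) <= kern z w + kern w u.
  have := sqr_ge0 (enorm (z - w) - enorm (w - u)); rewrite sqrrB.
  move: h3 h4; set x := enorm (z - w); set y := enorm (w - u); clear; lra.
by move: h1 h2 h5; rewrite -/(kern z w) -/(kern w u); clear; lra.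
Qed.

(** Does duty for the triangle inequality of the Bergman metric, with a non-sharp threshold. [L]
    bounds [kern z u / defect w]; comparing [defect w] with [defect z] and with [defect u] gives
    [kern z u ^+ 2 <= (Q - 1) / 2 * (defect z * defect u)]. *)
Lemma near_trans th th' : 0 < th -> 0 < th' -> exists2 th'', 0 < th'' < 1 &
  forall z w u, near th z w -> near th' w u -> near th'' z u.
Proof.
move=> t0 t0'.
pose L := 4 / th + 4 / th' + 1.
have L0 : 0 < L by rewrite /L ltr_wpDl// addr_ge0// divr_ge0// ltW.
pose Q := 2 * L ^+ 2 * (4 / th) * (4 / th') + 1.
have a1 : 0 < 4 / th by rewrite divr_gt0.
have a2 : 0 < 4 / th' by rewrite divr_gt0.
have QQ : 0 < 2 * L ^+ 2 * (4 / th) * (4 / th').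
  by apply: mulr_gt0 => //; apply: mulr_gt0 => //; apply: mulr_gt0 => //; exact: exprn_gt0.
have Q1 : 1 < Q by rewrite /Q ltrDr.
have Q0 : 0 < Q by apply: lt_trans Q1.
exists Q^-1; first by rewrite invr_gt0 Q0 invf_lt1.
move=> z w u nzw nwu; have [z1 w1 _] := nzw; have [_ u1 _] := nwu.
split=> //; have dw := defect_gt0 w1; have dz := defect_gt0 z1; have du := defect_gt0 u1.
have K : kern z u <= L * defect w.
  apply: (le_trans (kern_quasi_triangle z1 w1 u1)).
  have := near_kern_le t0 (near_sym nzw); have := near_kern_le t0' nwu; rewrite (kernC w z).
  have -> : L * defect w = 2 * (2 / th * defect w) + 2 * (2 / th' * defect w) + defect w.
    by rewrite /L; ring.
  by set x := 2 / th * _; set y := 2 / th' * _; clear; lra.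
have K2 : kern z u ^+ 2 <= L ^+ 2 * (defect w * defect w).
  by rewrite -(expr2 (defect w)) -exprMn; apply: sqr_le => //; exact: kern_ge0.
have dd : defect w * defect w <= (4 / th * defect z) * (4 / th' * defect u).
  apply: ler_pM; rewrite ?(ltW dw)//; first exact: near_defect_le nzw.
  exact: near_defect_le (near_sym nwu).
have zu : 0 < defect z * defect u by rewrite mulr_gt0.
rewrite mulrC ltr_pdivrMr//; apply: (le_lt_trans K2).
apply: (le_lt_trans (ler_wpM2l (sqr_ge0 L) dd)).
have -> : L ^+ 2 * (4 / th * defect z * (4 / th' * defect u)) =
  2^-1 * (Q - 1) * (defect z * defect u) by rewrite /Q; field; rewrite !gt_eqF.
rewrite mulrC ltr_pM2l//; move: Q1; clear; lra.
Qed.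

(** This is [1 - tanh(gamma)^2], as [beta(z,w) < gamma] means [|phi_z(w)| < tanh(gamma)]. *)
Definition tanh_sqr_compl (gamma : R) : R :=
  1 - ((expR (2 * gamma) - 1) / (expR (2 * gamma) + 1)) ^+ 2.

Lemma tanh_sqr_compl_itv gamma : 0 < gamma -> 0 < tanh_sqr_compl gamma < 1.
Proof.
move=> g0; have e1 : 1 < expR (2 * gamma) by rewrite expR_gt1 mulr_gt0.
have E0 : 0 < expR (2 * gamma) + 1 by apply: addr_gt0 => //; exact: expR_gt0.
rewrite /tanh_sqr_compl; set T := (expR (2 * gamma) - 1) / (expR (2 * gamma) + 1).
have T0 : 0 < T by rewrite divr_gt0// subr_gt0.
have T1 : T < 1 by rewrite ltr_pdivrMr// mul1r; lra.
apply/andP; split; first by rewrite subr_gt0 exprn_ilt1// ltW.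
by rewrite gtrBl exprn_gt0.
Qed.

(** By [moebius_defect] both sides are conditions on [rho = enorm (moebius z w)], and
    [(1 + rho) / (1 - rho) < expR (2 * gamma)] is solved for [rho]. *)
Lemma bergman_ball_near gamma z w : 0 < gamma -> unit_ball z ->
  bergman_ball z gamma w <-> near (tanh_sqr_compl gamma) z w.
Proof.
move=> g0 z1; rewrite /bergman_ball /near /=.
suff H : unit_ball w -> (bergman_dist z w < gamma) =
    (tanh_sqr_compl gamma * kern z w ^+ 2 < defect z * defect w).
  by split=> [[w1]|[_ w1]]; [rewrite H|rewrite -H].
move=> w1; have K0 := kern_gt0 w1 z1.
have := moebius_ball z1 w1; rewrite /unit_ball /= => rho1.
rewrite /defect -moebius_defect// -/(kern w z) kernC.
rewrite ltr_pM2r ?exprn_gt0 ?(kernC w z)//; last by rewrite kernC.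
rewrite /tanh_sqr_compl ltrD2l ltrN2 /bergman_dist.
have r0 := enorm_ge0 (moebius z w); set rho := enorm _ in rho1 r0 *.
have e1 : 1 < expR (2 * gamma) by rewrite expR_gt1 mulr_gt0.
have E0 : 0 < expR (2 * gamma) + 1 by apply: addr_gt0 => //; exact: expR_gt0.
set T := (expR (2 * gamma) - 1) / (expR (2 * gamma) + 1); have T0 : 0 < T by rewrite divr_gt0// subr_gt0.
have d0 : 0 < 1 - rho by rewrite subr_gt0.
have q0 : 0 < (1 + rho) / (1 - rho) by rewrite divr_gt0// ltr_pwDl.
rewrite ltr_pXn2r// ?nnegrE ?(ltW T0)//.
rewrite mulrC ltr_pdivrMr// [gamma * 2]mulrC -(ltr_expR) lnK ?posrE//.
rewrite ltr_pdivrMr// /T ltr_pdivlMr//.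
apply/idP/idP; lra.
Qed.

End ball_geometry.

(** * Boxes inside and around Bergman balls *)

Section regions_in_ball.
Variables (R : realType) (n : nat).
Local Notation nc := (@Normc.normc R).
Local Notation C_n := (Cn R n.+1).
Implicit Types (w z u : C_n) (th : R).

(* By [cdot_shear], [adapted z rho r] restricts [w - z] to size [r] in the complex
   direction of [z] and to size [rho] in the others. The coordinate eliminated is
   the largest one of [z], so that the slopes are at most 1; for [z = 0] they are
   [0 / 0 = 0]. *)
Definition maxk z : 'I_n.+1 := [arg max_(i > ord0) nc (z 0 i)]%O.

Definition slope z (j : 'I_n) : R[i] := (z 0 (lift (maxk z) j))^*%C / (z 0 (maxk z))^*%C.

Definition adapted z (rho r : R) := region (maxk z) (slope z) z rho r.

Lemma maxkP z i : nc (z 0 i) <= nc (z 0 (maxk z)).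
Proof. by rewrite /maxk; case: arg_maxP => // k _; apply. Qed.

Lemma maxk_eq0 z i : z 0 (maxk z) = 0 -> z 0 i = 0.
Proof.
move=> z0; apply/eqP; rewrite -nc_eq0 eq_le nc_ge0 andbT.
by apply: (le_trans (maxkP z i)); rewrite z0 Normc.normc0.
Qed.

Lemma slope_le1 z j : nc (slope z j) <= 1.
Proof.
rewrite /slope Normc.normcM Normc.normcV !nc_J.
have [z0|z0] := eqVneq (z 0 (maxk z)) 0; first by rewrite z0 Normc.normc0 invr0 mulr0.
by rewrite ler_pdivrMr ?nc_gt0// mul1r; exact: maxkP.
Qed.

Lemma cdot_shear z w : cdot (w - z) z = (z 0 (maxk z))^*%C * shear (maxk z) (slope z) z w.
Proof.
rewrite /cdot (bigD1_ord (maxk z))//= /shear mulrDr mulr_sumr !mxE; congr (_ + _).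
  by rewrite mulrC.
apply: eq_bigr => j _; rewrite !mxE /slope.
have [z0|z0] := eqVneq (z 0 (maxk z)) 0.
  by rewrite z0 (maxk_eq0 _ z0) conjc0 mulr0 mul0r.
by rewrite mulrA [_ * (_ / _)]mulrC divfK ?conjc_eq0// mulrC.
Qed.

Lemma csq_nc (d : R[i]) (r : R) : csq d r -> nc d <= 2 * r.
Proof. by move=> [h1 h2]; apply: (le_trans (nc_le _)); move: h1 h2; lra. Qed.

Lemma nc_csq (d : R[i]) (r : R) : nc d <= r -> csq d r.
Proof. by move=> h; split; apply: le_trans h; [exact: nc_Re|exact: nc_Im]. Qed.

Lemma nc_sum (I : Type) (s : seq I) (F : I -> R[i]) :
  nc (\sum_(i <- s) F i) <= \sum_(i <- s) nc (F i).
Proof.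
elim: s => [|i s IH]; first by rewrite !big_nil Normc.normc0.
by rewrite !big_cons (le_trans (ncD _ _))// lerD2l.
Qed.

(* The coefficient of [rho^2] in [4 n rho^2 + (2 r + 2 n rho)^2] for [r = rho]. *)
Let N : R := 4 * n%:R + (2 + 2 * n%:R) ^+ 2.

Lemma adapted_enorm z rho r w : 0 <= r -> r <= rho -> adapted z rho r w ->
  enorm (w - z) ^+ 2 <= N * rho ^+ 2.
Proof.
move=> r0 rrho [H1 H2]; have rho0 := le_trans r0 rrho.
have uj j : nc (w 0 (lift (maxk z) j) - z 0 (lift (maxk z) j)) <= 2 * rho by exact: csq_nc.
have uk : nc (w 0 (maxk z) - z 0 (maxk z)) <= (2 + 2 * n%:R) * rho.
  have -> : w 0 (maxk z) - z 0 (maxk z) = shear (maxk z) (slope z) z w -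
     \sum_j slope z j * (w 0 (lift (maxk z) j) - z 0 (lift (maxk z) j)).
    by rewrite /shear addrK.
  apply: (le_trans (ncB _ _)); rewrite mulrDl; apply: lerD.
    by apply: (le_trans (csq_nc H2)); rewrite ler_wpM2l.
  apply: (le_trans (nc_sum _ _)).
  apply: (@le_trans _ _ (\sum_(j < n) 2 * rho)).
    apply: ler_sum => j _; rewrite Normc.normcM -[leRHS]mul1r.
    by apply: ler_pM; rewrite ?nc_ge0// slope_le1.
  by rewrite sumr_const card_ord -mulr_natr le_eqVlt; apply/orP; left; apply/eqP; ring.
rewrite enorm_sqr (bigD1_ord (maxk z))//= !mxE.
have h1 : nc (w 0 (maxk z) - z 0 (maxk z)) ^+ 2 <= (2 + 2 * n%:R) ^+ 2 * rho ^+ 2.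
  by rewrite -exprMn; apply: sqr_le => //; exact: nc_ge0.
have h2 : \sum_(j < n) nc ((w - z) 0 (lift (maxk z) j)) ^+ 2 <= 4 * n%:R * rho ^+ 2.
  apply: (@le_trans _ _ (\sum_(j < n) (2 * rho) ^+ 2)).
    by apply: ler_sum => j _; rewrite !mxE; apply: sqr_le => //; exact: nc_ge0.
  by rewrite sumr_const card_ord -mulr_natr le_eqVlt; apply/orP; left; apply/eqP; ring.
by rewrite /N mulrDl addrC; apply: lerD.
Qed.

(** Displacement along [z] enters linearly, displacement orthogonal to [z] only quadratically: hence
    the two scales [defect z] and [Num.sqrt (defect z)] of the boxes. *)
Lemma defectE z w : defect w = defect z - 2 * complex.Re (cdot (w - z) z) - enorm (w - z) ^+ 2.
Proof.
rewrite /defect enormB_sqr cdotDl cdotNl Re_sub cdotE /=; ring.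
Qed.

Lemma kernE z w : kern w z = nc ((defect z)%:C - cdot (w - z) z).
Proof.
by rewrite /kern cdotDl cdotNl cdotE /defect rmorphB rmorph1 /=; congr nc; ring.
Qed.

(** With [d = defect z], the box gives [|<w - z, z>| <= 2 c d] and [|w - z|^2 <= N c^2 d], so that
    [defect w >= (1 - 4 c - N c) d] and [kern z w <= (1 + 2 c) d]. *)
Lemma adapted_near th : 0 < th < 1 -> exists2 c, 0 < c &
  forall z, unit_ball z ->
    adapted z (c * Num.sqrt (defect z)) (c * defect z) `<=` near th z.
Proof.
move=> /andP[th0 th1].
have N0 : 0 <= N by rewrite addr_ge0 ?sqr_ge0// mulr_ge0.
(* The goal will be [th * (1 + 8 * c) < 1 - 4 * c - N * c], where [1 + 8 * c] bounds
   [(1 + 2 * c) ^+ 2]; [c * (12 + N) < 1 - th] is enough. *)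
pose c := (1 - th) / (2 * (12 + N)).
have D0 : 0 < 2 * (12 + N) by rewrite mulr_gt0// ltr_wpDr.
have c0 : 0 < c by rewrite divr_gt0// subr_gt0.
have cN : c * (12 + N) = (1 - th) / 2 by rewrite /c; field; rewrite gt_eqF// ltr_wpDr.
have c1 : c <= 1 by rewrite /c ler_pdivrMr// mul1r; move: N0 th0; clear; lra.
exists c => // z z1 w wE; have dz := defect_gt0 z1; have dz1 := defect_le1 z.
set s := Num.sqrt (defect z) in wE.
have s2 : s ^+ 2 = defect z by rewrite sqr_sqrtr// ltW.
have s0 : 0 <= s by exact: sqrtr_ge0.
have s1 : s <= 1 by rewrite -[leRHS](@sqrtr1 R) ler_sqrt.
have ds : defect z <= s by rewrite -s2 expr2 ler_piMr.
have u2 : enorm (w - z) ^+ 2 <= N * (c ^+ 2 * defect z).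
  rewrite -s2 -exprMn; apply: adapted_enorm wE.
    by rewrite mulr_ge0// ltW.
  by rewrite ler_wpM2l// ltW.
have cd : nc (cdot (w - z) z) <= 2 * (c * defect z).
  rewrite cdot_shear Normc.normcM nc_J -[leRHS]mul1r.
  apply: ler_pM; rewrite ?nc_ge0//.
    by apply: (le_trans (nc_coord_enorm z _)); exact: ltW.
  by case: wE => _ /csq_nc.
have c2 : c ^+ 2 <= c by rewrite expr2 ler_piMr// ltW.
have cN2 : N * c ^+ 2 <= N * c by rewrite ler_wpM2l.
have dw : defect z * (1 - 4 * c - N * c) <= defect w.
  rewrite (defectE z w); have := le_trans (nc_Re _) cd; rewrite ler_norml => /andP[_ h].
  have := ler_wpM2r (ltW dz) cN2; rewrite -mulrA.
  by move: u2 h; clear; nra.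
have pos : 0 < 1 - 4 * c - N * c.
  by move: cN c0 th0 th1; rewrite mulrDr [c * N]mulrC; clear; lra.
have dw0 : 0 < defect w by apply: lt_le_trans dw; rewrite mulr_gt0.
split => //; first exact: defect_gt0_ball.
have kd : kern z w <= (1 + 2 * c) * defect z.
  rewrite kernC kernE; apply: (le_trans (ncB _ _)).
  by rewrite nc_real gtr0_norm//; move: cd; clear; lra.
have kd2 : kern z w ^+ 2 <= (1 + 8 * c) * defect z ^+ 2.
  apply: (@le_trans _ _ (((1 + 2 * c) * defect z) ^+ 2)).
    by apply: sqr_le => //; exact: kern_ge0.
  rewrite exprMn ler_wpM2r ?sqr_ge0//.
  by move: c2 c0 c1; rewrite !expr2; clear; nra.
apply: (le_lt_trans (ler_wpM2l (ltW th0) kd2)).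
apply: (@lt_le_trans _ _ (defect z * (defect z * (1 - 4 * c - N * c)))); last first.
  by rewrite ler_wpM2l// ltW.
rewrite expr2 (_ : th * _ = defect z * (defect z * (th * (1 + 8 * c)))); last by ring.
rewrite !ltr_pM2l//.
have : th * c <= c by rewrite ler_piMl// ltW.
by move: cN c0 th0 th1; rewrite mulrDr [c * N]mulrC; clear; lra.
Qed.

(** The shear is [<w - z, z>] divided by the conjugate of the largest coordinate of [z], whose
    modulus is bounded below when [|z|^2 >= 1/2]. Otherwise [defect z > 1/2], and the bound on
    [|w - z|] suffices. *)
Lemma near_adapted th : 0 < th -> th <= 1 -> exists2 C, 0 < C &
  forall z, unit_ball z ->
    near th z `<=` adapted z (C * Num.sqrt (defect z)) (C * defect z).
Proof.
move=> th0 th1; pose L := 2 / th.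
have L2 : 2 <= L by rewrite /L ler_pdivlMr// ler_piMr.
have L0 : 0 < L by apply: lt_le_trans L2.
(* For large [z], [2 * n.+1%:R] bounds the inverse of the largest modulus; for small [z], [n.+1]
   counts the terms of the shear and 2 comes from [1 <= 2 * defect z]. *)
pose C := (1 + L) * (2 * n.+1%:R).
have n0 : 1 <= n.+1%:R :> R by rewrite ler1n.
have C0 : 0 < C by rewrite /C !mulr_gt0 ?ltr0n// addr_gt0.
have LC : L <= C.
  by rewrite /C; move: L2 n0; set m := n.+1%:R; clear; nra.
exists C => // z z1 w nzw; have [_ w1 _] := nzw.
have dz := defect_gt0 z1; have dz1 := defect_le1 z.
have K := near_kern_le th0 nzw; rewrite -/L in K.
set s := Num.sqrt (defect z).
have s2 : s ^+ 2 = defect z by rewrite sqr_sqrtr// ltW.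
have s0 : 0 <= s by exact: sqrtr_ge0.
have s1 : s <= 1 by rewrite -[leRHS](@sqrtr1 R) ler_sqrt.
have us : enorm (w - z) <= L * s.
  have Ls0 : 0 <= L * s by rewrite mulr_ge0// ltW.
  rewrite -(@ler_pXn2r _ 2)// ?nnegrE ?enorm_ge0//.
  rewrite exprMn s2; apply: (le_trans (enormB_kern w1 z1)); rewrite kernC.
  apply: (@le_trans _ _ (2 * (L * defect z))); first by rewrite ler_wpM2l.
  by rewrite mulrA expr2 ler_wpM2r ?(ltW dz)// ler_wpM2r// ltW.
have uj j : nc ((w - z) 0 j) <= L * s by apply: le_trans us; exact: nc_coord_enorm.
split=> [j|]; apply: nc_csq.
  have := uj (lift (maxk z) j); rewrite !mxE => /le_trans; apply.
  by rewrite ler_wpM2r.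
have cd : nc (cdot (w - z) z) <= (1 + L) * defect z.
  have -> : cdot (w - z) z = (defect z)%:C - (1 - cdot w z).
    by rewrite cdotDl cdotNl cdotE /defect rmorphB rmorph1 /=; ring.
  apply: (le_trans (ncB _ _)); rewrite nc_real gtr0_norm// mulrDl mul1r lerD2l.
  by rewrite -/(kern w z) kernC.
have [zh|zh] := leP 2^-1 (enorm z ^+ 2).
  have zk : 1 <= 2 * n.+1%:R * nc (z 0 (maxk z)).
    have zk2 : enorm z ^+ 2 <= n.+1%:R * nc (z 0 (maxk z)) ^+ 2.
      rewrite enorm_sqr; apply: (@le_trans _ _ (\sum_(i < n.+1) nc (z 0 (maxk z)) ^+ 2)).
        by apply: ler_sum => i _; apply: sqr_le; [exact: nc_ge0|exact: maxkP].
      by rewrite sumr_const card_ord mulr_natl.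
    have zk1 : nc (z 0 (maxk z)) <= 1.
      by apply: (le_trans (nc_coord_enorm z _)); exact: ltW.
    have zkk : nc (z 0 (maxk z)) ^+ 2 <= nc (z 0 (maxk z)).
      by rewrite expr2 ler_piMr// nc_ge0.
    have := ler_wpM2l (ler0n R n.+1) zkk.
    by move: zk2 zh; rewrite -[2 * _ * _]mulrA; clear; lra.
  rewrite cdot_shear Normc.normcM nc_J in cd.
  set S := nc (shear _ _ _ _) in cd *; set a := nc _ in zk cd.
  have S0 : 0 <= S by exact: nc_ge0.
  apply: (@le_trans _ _ (2 * n.+1%:R * a * S)); first by rewrite ler_peMl.
  rewrite -mulrA; apply: (le_trans (ler_wpM2l _ cd)); first by rewrite mulr_ge0.
  by rewrite /C le_eqVlt; apply/orP; left; apply/eqP; ring.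
have dh : 1 <= 2 * defect z by move: zh; rewrite /defect; clear; lra.
apply: (@le_trans _ _ (n.+1%:R * (L * s))).
  rewrite /shear -natr1 mulrDl mul1r addrC; apply: (le_trans (ncD _ _)).
  apply: lerD; last by have := uj (maxk z); rewrite !mxE.
  apply: (le_trans (nc_sum _ _)).
  apply: (@le_trans _ _ (\sum_(j < n) (L * s))); last by rewrite sumr_const card_ord mulr_natl.
  apply: ler_sum => j _.
  rewrite Normc.normcM -[leRHS]mul1r; apply: ler_pM; rewrite ?nc_ge0// ?slope_le1//.
  by have := uj (lift (maxk z) j); rewrite !mxE.
have -> : C * defect z = n.+1%:R * ((1 + L) * (2 * defect z)) by rewrite /C; ring.
rewrite ler_wpM2l//; apply: ler_pM; rewrite ?(ltW L0)//; first by rewrite lerDr.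
exact: le_trans s1 dh.
Qed.

End regions_in_ball.

(** * Integration on the ball *)

Section density_integral.
Context d (T : measurableType d) (R : realType).
Variables (m m' : {measure set T -> \bar R}) (h : T -> R).
Local Open Scope ereal_scope.
Hypothesis h_ge0 : forall x, (0 <= h x)%R.
Hypothesis measurable_h : measurable_fun setT h.
Hypothesis m'E : forall A, measurable A -> m' A = \int[m]_(x in A) (h x)%:E.

Import HBNNSimple.

Let mh : measurable_fun setT (fun x => (h x)%:E).
Proof. exact/measurable_EFinP. Qed.

Let integral_density_nnsfun (g : {nnsfun T >-> R}) :
  \int[m']_x (g x)%:E = \int[m]_x ((g x)%:E * (h x)%:E).
Proof.
under [LHS]eq_integral do rewrite fimfunE -fsumEFin//.
rewrite [LHS]ge0_integral_fsum//; last 2 first.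
  - by move=> r; exact/measurable_EFinP/measurableT_comp.
  - by move=> n x _; rewrite EFinM nnfun_muleindic_ge0.
under [RHS]eq_integral.
  move=> x xD; rewrite fimfunE -fsumEFin// muleC ge0_mule_fsumr; last first.
    by move=> r; rewrite EFinM nnfun_muleindic_ge0.
  over.
rewrite [RHS]ge0_integral_fsum//; last 2 first.
  - move=> r; apply: emeasurable_funM => //.
    by apply/measurable_EFinP; apply/measurableT_comp => //.
  - move=> n x _; rewrite EFinM mule_ge0//; last by rewrite nnfun_muleindic_ge0.
    by rewrite lee_fin.
apply: eq_fsbigr => r _.
rewrite integralZl_indic_nnsfun//= integral_indic// setIT m'E//.
have [r0|r0] := leP 0%R r; last first.
  rewrite preimage_nnfun0// integral_set0 mule0 integral0_eq// => x _.
  by rewrite indic0 mulr0 mule0.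
under [RHS]eq_integral do rewrite EFinM muleCA.
rewrite ge0_integralZl_EFin//; last 2 first.
- by move=> x _; rewrite mule_ge0// lee_fin.
- by apply: emeasurable_funM => //; exact/measurable_EFinP/measurable_indic.
congr (_ * _); rewrite [LHS]integral_mkcond; apply: eq_integral => x _.
by rewrite patchE indicE; case: (x \in _); rewrite ?mule1 ?mule0.
Qed.

(** Stated for any [m'] with these values, so as to cover [dv_alpha] and [tau] over [dv], and also
    [dv] over [lebesgue_Cn], with density [kappa] times the indicator of the ball. *)
Lemma ge0_integral_density (f : T -> \bar R) :
  measurable_fun setT f -> (forall x, 0 <= f x) ->
  \int[m']_x f x = \int[m]_x (f x * (h x)%:E).
Proof.
move=> mf f0; pose f_ := nnsfun_approx measurableT mf.
transitivity (lim (\int[m']_x (f_ n x)%:E @[n --> \oo])).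
  rewrite -monotone_convergence//=.
  - apply: eq_integral => ? /[!inE] xD; apply/esym/cvg_lim => //=.
    exact: cvg_nnsfun_approx.
  - by move=> n; exact/measurable_EFinP/measurable_funTS.
  - by move=> n ? _; rewrite lee_fin.
  - by move=> ? _ ? ? mn; rewrite lee_fin; exact/lefP/nd_nnsfun_approx.
transitivity (lim (\int[m]_x ((f_ n x)%:E * (h x)%:E) @[n --> \oo])).
  by apply: congr_lim; apply/funext => n; exact: integral_density_nnsfun.
rewrite -monotone_convergence//=.
- apply: eq_integral => x _; apply/cvg_lim => //.
  rewrite muleC; under eq_fun do rewrite muleC.
  by apply: cvgeZl => //; exact: cvg_nnsfun_approx.
- by move=> n; apply: emeasurable_funM => //; exact/measurable_EFinP.
- by move=> n x _; rewrite mule_ge0// lee_fin.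
- move=> x _ a b ab; apply: lee_wpmul2r; first by rewrite lee_fin.
  by rewrite lee_fin; exact/lefP/nd_nnsfun_approx.
Qed.

End density_integral.

(** * The measures of the ball as densities *)

Section measures.
Variables (R : realType) (n : nat).
Local Notation nc := (@Normc.normc R).
Local Notation C_n := (Cn R n).
Local Notation B := (@unit_ball R n).
Local Notation kappa := ((fine (@lebesgue_Cn R n B))^-1).
Implicit Types (w z u : C_n).
Local Open Scope ereal_scope.

Lemma dvE A : dv R n A = kappa%:E * @lebesgue_Cn R n (A `&` B).
Proof. by []. Qed.

Lemma kappa_ge0 : (0 <= kappa)%R.
Proof. by rewrite invr_ge0 fine_ge0. Qed.

(** If the ball had infinite volume, [fine] and the inverse would make [kappa] equal to 0, and [dv]
    would be the zero measure: it is finite in either case. *)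
Lemma dv_fin_num A : measurable A -> dv R n A \is a fin_num.
Proof.
move=> mA; rewrite dvE.
have [LB|LB] := boolP (@lebesgue_Cn R n B \is a fin_num).
  apply: fin_numM => //; rewrite ge0_fin_numE//.
  apply: (@le_lt_trans _ _ (@lebesgue_Cn R n B)); last by rewrite -ge0_fin_numE.
  have mB := @measurable_unit_ball R n.
  apply: le_measure; last exact: subIsetr.
    by rewrite inE; exact: measurableI.
  by rewrite inE.
rewrite (_ : kappa = 0%R) ?mul0e//.
by move: LB; case: (lebesgue_Cn B) => //= *; rewrite invr0.
Qed.

(** A copy of [dv] that carries the finite measure structure, for Tonelli's theorem. *)
Definition dv_finite : set C_n -> \bar R := dv R n.

HB.instance Definition _ := Measure.copy dv_finite (dv R n).

HB.instance Definition _ := Measure_isFinite.Build _ _ _ dv_finite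
  (fun A mA => dv_fin_num mA).

Lemma integral_dv (F : C_n -> \bar R) : measurable_fun setT F -> (forall w, 0 <= F w) ->
  \int[dv R n]_w F w = kappa%:E * \int[@lebesgue_Cn R n]_(w in B) F w.
Proof.
move=> mF F0; have mB := @measurable_unit_ball R n.
rewrite (@ge0_integral_density _ _ _ (@lebesgue_Cn R n) (dv R n) (fun w => kappa * \1_B w)%R)//.
- rewrite [X in _ = _ * X]integral_mkcond -ge0_integralZl_EFin ?kappa_ge0//.
  + apply: eq_integral => w _; rewrite patchE indicE.
    by case: (w \in B); rewrite ?mulr1 ?mulr0 ?mule0// muleC.
  + by move=> w _; rewrite patchE; case: ifP.
  + exact/(measurable_restrictT _ _).1/measurable_funTS.
- by move=> w; rewrite mulr_ge0// kappa_ge0.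
- by apply: measurable_funM => //; exact: measurable_indic.
- move=> A mA; rewrite dvE.
  under eq_integral do rewrite EFinM.
  rewrite ge0_integralZl_EFin ?kappa_ge0//.
    by rewrite integral_indic// setIC.
  by apply/measurable_EFinP/measurable_funTS; exact: measurable_indic.
Qed.

Lemma integral_dv_alpha alpha (F : C_n -> \bar R) :
  measurable_fun setT F -> (forall w, 0 <= F w) ->
  \int[dv_alpha n alpha]_w F w = \int[dv R n]_w (F w * (dv_density alpha w)%:E).
Proof.
move=> mF F0; apply: ge0_integral_density => //.
- exact: dv_density_ge0.
- exact: measurable_dv_density.
Qed.

Lemma integral_tau (F : C_n -> \bar R) :
  measurable_fun setT F -> (forall w, 0 <= F w) ->
  \int[tau R n]_w F w = \int[dv R n]_w (F w * (tau_density w)%:E).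
Proof.
move=> mF F0; apply: ge0_integral_density => //.
- exact: tau_density_ge0.
- exact: measurable_tau_density.
Qed.

End measures.

(** * Measurability of Bergman balls and of powers of the modulus *)

Section near_measurability.
Variables (R : realType) (n : nat).
Local Notation nc := (@Normc.normc R).
Local Notation C_n := (Cn R n).
Local Notation B := (@unit_ball R n).
Implicit Types (w z u : C_n).

Lemma Re_sum (I : Type) (s : seq I) (F : I -> R[i]) :
  complex.Re (\sum_(i <- s) F i) = \sum_(i <- s) complex.Re (F i).
Proof.
elim: s => [|i s IH]; first by rewrite !big_nil.
by rewrite !big_cons Re_add IH.
Qed.

Lemma Im_sum (I : Type) (s : seq I) (F : I -> R[i]) :
  complex.Im (\sum_(i <- s) F i) = \sum_(i <- s) complex.Im (F i).
Proof.
elim: s => [|i s IH]; first by rewrite !big_nil.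
by rewrite !big_cons Im_add IH.
Qed.

Lemma econt_Re_cdot z w : econt (fun u => complex.Re (cdot z u)) w.
Proof.
rewrite (_ : (fun _ => _) = fun u : C_n => \sum_k
   (complex.Re (z 0 k) * complex.Re (u 0 k) + complex.Im (z 0 k) * complex.Im (u 0 k))).
  apply: econt_sum => k; apply: econt_add; apply: econt_mul; try exact: econt_cst.
    exact: econt_Re.
  exact: econt_Im.
apply/funext => u; rewrite /cdot Re_sum; apply: eq_bigr => k _.
by case: (z 0 k) (u 0 k) => a b [c d] /=; ring.
Qed.

Lemma econt_Im_cdot z w : econt (fun u => complex.Im (cdot z u)) w.
Proof.
rewrite (_ : (fun _ => _) = fun u : C_n => \sum_k
   (complex.Im (z 0 k) * complex.Re (u 0 k) + - complex.Re (z 0 k) * complex.Im (u 0 k))).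
  apply: econt_sum => k; apply: econt_add; apply: econt_mul; try exact: econt_cst.
    exact: econt_Re.
  exact: econt_Im.
apply/funext => u; rewrite /cdot Im_sum; apply: eq_bigr => k _.
by case: (z 0 k) (u 0 k) => a b [c d] /=; ring.
Qed.

Lemma econt_defect w : econt (@defect R n) w.
Proof.
rewrite (_ : @defect R n = fun u : C_n => 1 + - \sum_k
   (complex.Re (u 0 k) * complex.Re (u 0 k) + complex.Im (u 0 k) * complex.Im (u 0 k))).
  apply: econt_add; first exact: econt_cst.
  apply: econt_opp; apply: econt_sum => k; apply: econt_add; apply: econt_mul;
  by [exact: econt_Re|exact: econt_Im].
apply/funext => u; rewrite /defect enorm_sqr; congr (_ - _); apply: eq_bigr => k _.
by rewrite nc_sqr !expr2.
Qed.

Lemma econt_kern_sqr z w : econt (fun u => kern z u ^+ 2) w.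
Proof.
rewrite (_ : (fun _ => _) = fun u => (1 + - complex.Re (cdot z u)) * (1 + - complex.Re (cdot z u))
   + complex.Im (cdot z u) * complex.Im (cdot z u)).
  apply: econt_add; apply: econt_mul; try exact: econt_Im_cdot.
    by apply: econt_add; [exact: econt_cst|apply: econt_opp; exact: econt_Re_cdot].
  by apply: econt_add; [exact: econt_cst|apply: econt_opp; exact: econt_Re_cdot].
apply/funext => u; rewrite /kern nc_sqr Re_sub Im_sub /= sub0r sqrrN.
by rewrite !expr2.
Qed.

Lemma eopenT : eopen [set: C_n].
Proof. by move=> w _; exists 1. Qed.

Lemma eopen_unit_ball : eopen B.
Proof.
rewrite (_ : B = [set w | [set: C_n] w /\ 0 < defect w]).
  by apply: econt_gt; [exact: eopenT|move=> w _; exact: econt_defect].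
apply/seteqP; split => w; first by move=> /defect_gt0 dw; split.
by move=> [_ /defect_gt0_ball].
Qed.

Lemma eopen_near th z : eopen (near th z).
Proof.
have [zB|zB] := pselect (B z); last by move=> w [].
rewrite (_ : near th z = [set w | B w /\ 0 < defect z * defect w + - (th * kern z w ^+ 2)]).
  apply: econt_gt; first exact: eopen_unit_ball.
  move=> w _; apply: econt_add.
    by apply: econt_mul; [exact: econt_cst|exact: econt_defect].
  by apply: econt_opp; apply: econt_mul; [exact: econt_cst|exact: econt_kern_sqr].
apply/seteqP; split => w; first by move=> [_ wB h]; split; rewrite // subr_gt0.
by move=> [wB h]; split; rewrite // -subr_gt0.
Qed.

Lemma measurable_near th z : measurable (near th z).
Proof. by apply: eopen_measurable; exact: eopen_near. Qed.

Lemma measurable_defect : measurable_fun setT (@defect R n).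
Proof.
by apply: measurable_funB => //; apply: measurable_funX; exact: measurable_enorm.
Qed.

Lemma measurable_near2 th : measurable [set zw : C_n * C_n | near th zw.1 zw.2].
Proof.
have mcc (g : C_n * C_n -> C_n) k : measurable_fun setT g -> cmeas (fun x => g x 0 k).
  move=> mg; have [h1 h2] := @cmeas_coord R n k.
  split; [exact: (measurableT_comp h1)|exact: (measurableT_comp h2)].
have mK : measurable_fun setT (fun zw : C_n * C_n => kern zw.1 zw.2).
  apply: cmeas_nc; apply: cmeas_add; first exact: cmeas_cst.
  apply: cmeas_opp; apply: cmeas_sum => k; apply: cmeas_mul.
    exact: mcc.
  by apply: cmeas_conj; exact: mcc.
have mB := @measurable_unit_ball R n.
rewrite (_ : [set zw | _] = (fst @^-1` B `&` snd @^-1` B) `&`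
  ((fun zw : C_n * C_n => defect zw.1 * defect zw.2 - th * kern zw.1 zw.2 ^+ 2) @^-1` `]0, +oo[)).
  apply: measurableI; first apply: measurableI.
  - by rewrite -[X in measurable X]setTI; exact: measurable_fst.
  - by rewrite -[X in measurable X]setTI; exact: measurable_snd.
  rewrite -[X in measurable X]setTI.
  have mf : measurable_fun setT (fun zw : C_n * C_n => defect zw.1 * defect zw.2 - th * kern zw.1 zw.2 ^+ 2).
    apply: measurable_funB.
      apply: measurable_funM; apply: (measurableT_comp measurable_defect).
        exact: measurable_fst.
      exact: measurable_snd.
    by apply: measurable_funM => //; exact: measurable_funX.
  by apply: mf => //; exact: measurable_itv.
apply/seteqP; split => -[z w] /=; rewrite in_itv/= andbT subr_gt0.
  by move=> [].
by move=> [[]].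
Qed.

Variable f : C_n -> R[i].
Hypothesis hf : holomorphic f.
Local Open Scope ereal_scope.

(** Extended by 0, since [f] is arbitrary outside the ball: it is measurable on the whole space. *)
Definition modpow p : C_n -> \bar R := (fun w => (nc (f w) `^ p)%:E) \_ B.

Lemma modpow_ge0 p w : 0 <= modpow p w.
Proof. by rewrite /modpow patchE; case: ifP => // _; rewrite lee_fin powR_ge0. Qed.

Lemma modpowE p w : B w -> modpow p w = (nc (f w) `^ p)%:E.
Proof. by move=> wB; rewrite /modpow patchE mem_set. Qed.

Lemma measurable_holomorphic_modulus : measurable_fun B (fun w => nc (f w)).
Proof.
move=> mB; apply: (measurability _ (RGenOInfty.measurableE R)) => //.
move=> _ [_ [c ->] <-]; apply: eopen_measurable.
rewrite (_ : B `&` _ = [set w | B w /\ (c < nc (f w))%R]).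
  apply: econt_gt; first exact: eopen_unit_ball.
  by move=> w wB; apply: differentiable_econt; exact: hf.
by apply/seteqP; split => w /=; rewrite in_itv/= andbT.
Qed.

Lemma measurable_modpow p : measurable_fun setT (modpow p).
Proof.
apply/(measurable_restrictT _ _).1; first exact: measurable_unit_ball.
apply/measurable_EFinP.
apply: (measurableT_comp (measurable_powR p)); exact: measurable_holomorphic_modulus.
Qed.

End near_measurability.

(** * Volume, mean values and Tonelli's theorem on Bergman balls *)

Section estimates.
Variables (R : realType) (n : nat).
Local Notation nc := (@Normc.normc R).
Local Notation C_n := (Cn R n.+1).
Local Notation B := (@unit_ball R n.+1).
Local Notation Leb := (@lebesgue_Cn R n.+1).
Local Notation kappa := ((fine (Leb B))^-1).
Local Notation mu := (@dv_finite R n.+1).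
Implicit Types (w z u : C_n) (f : C_n -> R[i]).

Lemma powR_comparable (L a b alpha : R) : 0 < L -> 0 < a -> 0 < b ->
  a <= L * b -> b <= L * a -> a `^ alpha <= L `^ `|alpha| * b `^ alpha.
Proof.
move=> L0 a0 b0 ab ba.
have H (x y beta : R) : 0 < x -> 0 < y -> x <= L * y -> 0 <= beta ->
    x `^ beta <= L `^ beta * y `^ beta.
  move=> x0 y0 xy beta0; rewrite -powRM ?(ltW L0) ?(ltW y0)//.
  by apply: ge0_ler_powR => //; rewrite nnegrE ltW// mulr_gt0.
have [al|al] := leP 0 alpha; first by rewrite ger0_norm//; exact: H.
rewrite ltr0_norm//.
have := H b a (- alpha) b0 a0 ba; rewrite oppr_ge0 => /(_ (ltW al)) h.
rewrite -[in a `^ _](opprK alpha) -[in b `^ _](opprK alpha).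
rewrite (powRN a) (powRN b) ler_pdivlMr ?powR_gt0// mulrC ler_pdivrMr ?powR_gt0//.
Qed.

Local Open Scope ereal_scope.

(** The dimension is [n.+1]: in the enclosing box, [n] squares of area of order [defect z] and one
    of order [defect z ^+ 2] give the exponent [n.+2]. *)
Lemma near_volume (th : R) : (0 < th)%R -> (th <= 1)%R -> exists2 C : R, (0 < C)%R &
  forall z, B z -> mu (near th z) <= (C * defect z ^+ n.+2)%:E.
Proof.
move=> th0 th1; have [C C0 HC] := @near_adapted R n th th0 th1.
have k0 := @kappa_ge0 R n.+1.
(* Adding 1 makes the constant positive even if [kappa] is 0. *)
exists ((kappa + 1) * (4 * C ^+ 2) ^+ n.+1)%R.
  by rewrite mulr_gt0 ?exprn_gt0 ?mulr_gt0 ?exprn_gt0// ltr_wpDl.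
move=> z zB; have dz := defect_gt0 zB.
rewrite [leLHS]dvE.
have s2 : (Num.sqrt (defect z) ^+ 2 = defect z)%R by rewrite sqr_sqrtr// ltW.
set s := Num.sqrt (defect z) in s2.
have vol : Leb (near th z `&` B) <= ((4 * C ^+ 2) ^+ n.+1 * defect z ^+ n.+2)%:E.
  apply: (@le_trans _ _ (Leb (adapted z (C * s) (C * defect z)))).
    apply: le_measure; rewrite ?inE.
    - by apply: measurableI; [exact: measurable_near|exact: measurable_unit_ball].
    - exact: measurable_region.
    - by move=> w [/(HC z zB)].
  rewrite region_volume; last 2 first.
  - by rewrite mulr_ge0 ?(ltW C0)// sqrtr_ge0.
  - by rewrite mulr_ge0 ?(ltW C0) ?(ltW dz).
  rewrite lee_fin [((C * s) ^+ 2)%R]exprMn s2.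
  have -> : (4 * (C ^+ 2 * defect z) = 4 * C ^+ 2 * defect z)%R by ring.
  rewrite exprMn [((4 * C ^+ 2) ^+ n.+1)%R]exprS 2![(defect z ^+ _.+1)%R]exprS.
  by rewrite le_eqVlt; apply/orP; left; apply/eqP; ring.
apply: (le_trans (lee_wpmul2l _ vol)); first by rewrite lee_fin.
rewrite -EFinM lee_fin mulrA ler_wpM2r ?exprn_ge0 ?(ltW dz)//.
by rewrite ler_pM2r ?exprn_gt0 ?mulr_gt0 ?exprn_gt0// lerDl.
Qed.

(** The integral against [tau] over a Bergman ball, written with [dv_finite] so that Tonelli's
    theorem applies. *)
Definition Tau f (p th : R) z : \bar R :=
  \int[mu]_(w in near th z) (modpow f p w * (tau_density w)%:E).

Lemma tau_densityE w : B w -> tau_density w = (defect w ^- n.+2)%R.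
Proof. by move=> /defect_gt0 dw; rewrite /tau_density powR_invn// ltW. Qed.

Lemma modpow_tau_ge0 f (p : R) w : 0 <= modpow f p w * (tau_density w)%:E.
Proof. by rewrite mule_ge0 ?modpow_ge0// lee_fin tau_density_ge0. Qed.

Lemma measurable_modpow_tau f (p : R) : holomorphic f ->
  measurable_fun setT (fun w => modpow f p w * (tau_density w)%:E).
Proof.
move=> hf; apply: emeasurable_funM; first exact: measurable_modpow.
by apply/measurable_EFinP; exact: measurable_tau_density.
Qed.

Lemma Tau_ge0 f (p th : R) z : 0 <= Tau f p th z.
Proof. by apply: integral_ge0 => w _; exact: modpow_tau_ge0. Qed.

(** The box of [adapted_near] lies in the ball and has volume of order [defect z ^+ n.+2]; on the
    ball this is comparable to the inverse of [tau_density], up to [(4 / th) ^+ n.+2], while [kappa]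
    passes from Lebesgue measure to [dv]. *)
Lemma submean (p th : R) : (0 < kappa)%R -> (0 < p)%R -> (0 < th < 1)%R ->
  exists2 C : R, (0 < C)%R & forall f, holomorphic f -> forall z, B z ->
    modpow f p z <= C%:E * Tau f p th z.
Proof.
move=> k0 p0 /[dup] th01 /andP[th0 th1].
have [c c0 Hc] := @adapted_near R n th th01.
have [C1 C10 HC1] := @area_mean_pow R p p0.
pose L := (4 / th)%R; have L0 : (0 < L)%R by rewrite divr_gt0.
have cc0 : (0 < c ^+ 2 ^+ n.+1)%R by rewrite !exprn_gt0.
have K0 : (0 < C1 ^+ n.+1 * (L ^+ n.+2 / kappa) / c ^+ 2 ^+ n.+1)%R.
  by apply: divr_gt0 => //; apply: mulr_gt0; rewrite ?exprn_gt0// divr_gt0// exprn_gt0.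
exists (C1 ^+ n.+1 * (L ^+ n.+2 / kappa) / c ^+ 2 ^+ n.+1)%R => //.
move=> f hf z zB; have dz := defect_gt0 zB.
set s := Num.sqrt (defect z).
have s0 : (0 < s)%R by rewrite sqrtr_gt0.
have s2 : (s ^+ 2 = defect z)%R by rewrite sqr_sqrtr// ltW.
pose E := adapted z (c * s)%R (c * defect z)%R.
have EN : E `<=` near th z by exact: Hc.
have mE : measurable E by exact: measurable_region.
pose M := modpow f p \_ E.
have mM : measurable_fun setT M.
  by apply/(measurable_restrictT _ _).1 => //; apply: measurable_funTS; exact: measurable_modpow.
have M0 w : 0 <= M w by rewrite /M patchE; case: ifP => // _; exact: modpow_ge0.
pose G := (fun w => modpow f p w * (tau_density w)%:E) \_ (near th z).
have mG : measurable_fun setT G.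
  apply/(measurable_restrictT _ _).1; first exact: measurable_near.
  by apply: measurable_funTS; exact: measurable_modpow_tau.
have G0 w : 0 <= G w by rewrite /G patchE; case: ifP => // _; exact: modpow_tau_ge0.
have TE : Tau f p th z = kappa%:E * \int[Leb]_(w in B) G w.
  by rewrite /Tau integral_mkcond -/G; exact: integral_dv.
have mB := @measurable_unit_ball R n.+1.
have MG : \int[Leb]_w M w <= (L ^+ n.+2 * defect z ^+ n.+2)%:E * \int[Leb]_(w in B) G w.
  have Ld0 : (0 <= L ^+ n.+2 * defect z ^+ n.+2)%R by rewrite mulr_ge0// exprn_ge0// ltW.
  rewrite [X in _ * X]integral_mkcond -ge0_integralZl_EFin//; last 2 first.
  - by move=> w _; rewrite patchE; case: ifP.
  - by apply/(measurable_restrictT _ _).1 => //; exact: measurable_funTS.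
  rewrite [leRHS](_ : _ = \int[Leb]_w ((L ^+ n.+2 * defect z ^+ n.+2)%:E * (G \_ B) w))//.
  apply: ge0_le_integral => //.
  - apply: measurable_funeM.
    by apply/(measurable_restrictT _ _).1 => //; exact: measurable_funTS.
  move=> w _; rewrite /M patchE; case: ifP => wE; last first.
    by rewrite mule_ge0 ?lee_fin// patchE; case: ifP.
  rewrite inE in wE; have nw := EN w wE; have [_ wB _] := nw.
  rewrite patchE mem_set// /G patchE mem_set// muleCA -[leLHS]mule1.
  apply: lee_wpmul2l; first exact: modpow_ge0.
  rewrite tau_densityE// -EFinM lee_fin -exprMn.
  have dw := defect_gt0 wB.
  rewrite ler_pdivlMr ?exprn_gt0// mul1r.
  have := near_defect_le th0 nw; rewrite -/L => h.
  rewrite lerXn2r// nnegrE; first exact: ltW.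
  by rewrite mulr_ge0// ltW.
have := @region_mean R n (maxk z) (slope z) z p C1 (c * s)%R (c * defect z)%R f M C10 HC1.
move=> /(_ _ _ _ mM M0 _) H.
have {H} : ((c * s) ^+ 2 ^+ n * (c * defect z) ^+ 2 * nc (f z) `^ p)%:E <=
    (C1 ^+ n.+1)%:E * \int[Leb]_w M w.
  apply: H.
  - by rewrite mulr_gt0.
  - by rewrite mulr_gt0.
  - by move=> w /EN[_ wB _]; apply: differentiable_ldiff; exact: hf.
  - by move=> w wE; rewrite /M patchE mem_set//; have [_ wB _] := EN w wE; rewrite modpowE.
rewrite modpowE// TE => H.
have {H} := le_trans H (lee_wpmul2l _ MG).
rewrite lee_fin exprn_ge0 ?(ltW C10)// => /(_ isT).
have I0 : 0 <= \int[Leb]_(w in B) G w by exact: integral_ge0.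
have -> : ((c * s) ^+ 2 ^+ n * (c * defect z) ^+ 2 = c ^+ 2 ^+ n.+1 * defect z ^+ n.+2)%R.
  by rewrite [((c * s) ^+ 2)%R]exprMn s2 exprMn !exprS; ring.
have dd0 : (0 < defect z ^+ n.+2)%R by rewrite exprn_gt0.
case: (\int[Leb]_(w in B) G w) I0 => [i||] //= i0; last first.
  by move=> _; rewrite gt0_muley ?lte_fin// gt0_muley ?leey// lte_fin.
rewrite -!EFinM !lee_fin => H.
have cancel_k (x y k t D : R) : (k != 0 -> D != 0 -> x * (y / k) / D * (k * t) = x * y * t / D)%R.
  by move=> k0' D0; field; rewrite D0 k0'.
rewrite cancel_k ?gt_eqF//.
rewrite ler_pdivlMr// -(ler_pM2r dd0).
have -> : (nc (f z) `^ p * c ^+ 2 ^+ n.+1 * defect z ^+ n.+2 =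
  c ^+ 2 ^+ n.+1 * defect z ^+ n.+2 * nc (f z) `^ p)%R by ring.
by apply: (le_trans H); rewrite le_eqVlt; apply/orP; left; apply/eqP; ring.
Qed.

Lemma near_dv_density (th alpha : R) z w : (0 < th)%R -> near th z w ->
  (dv_density alpha w <= (4 / th) `^ `|alpha| * dv_density alpha z)%R.
Proof.
move=> th0 nzw; have [zB wB _] := nzw; rewrite /dv_density mulrCA.
apply: ler_wpM2l; first by rewrite divr_ge0 ?mulr_ge0 ?Gamma_ge0.
rewrite -!/(defect _); apply: powR_comparable; rewrite ?defect_gt0 ?divr_gt0//.
  exact: near_defect_le nzw.
exact: near_defect_le (near_sym nzw).
Qed.

(** As [near] is symmetric, exchanging the integrals leaves the [dv_alpha] mass of the ball about
    [w], at most of order [dv_density alpha w * defect w ^+ n.+2]; the last factor cancels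
    [tau_density w]. *)
Lemma fubini_near (alpha th : R) : (0 < th)%R -> (th <= 1)%R -> exists2 C : R, (0 < C)%R &
  forall f p, holomorphic f ->
    measurable_fun setT (Tau f p th) /\
    \int[dv_alpha n.+1 alpha]_z Tau f p th z <=
      C%:E * \int[dv_alpha n.+1 alpha]_z modpow f p z.
Proof.
move=> th0 th1; have [C C0 HC] := near_volume th0 th1.
have L0 : (0 < (4 / th) `^ `|alpha|)%R by rewrite powR_gt0// divr_gt0.
exists ((4 / th) `^ `|alpha| * C)%R; first by rewrite mulr_gt0.
move=> f p hf.
pose dens z := (dv_density alpha z)%:E : \bar R.
have mdens : measurable_fun setT (dens : C_n -> _).
  by apply/measurable_EFinP; exact: measurable_dv_density.
have dens0 z : 0 <= dens z by rewrite lee_fin dv_density_ge0.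
pose mt w := modpow f p w * (tau_density w)%:E.
have mt0 w : 0 <= mt w by exact: modpow_tau_ge0.
have mmt : measurable_fun setT mt by exact: measurable_modpow_tau.
pose N := [set zw : C_n * C_n | near th zw.1 zw.2].
have mN : measurable N by exact: measurable_near2.
pose G0 := (fun zw : C_n * C_n => mt zw.2) \_ N.
have G00 zw : 0 <= G0 zw by rewrite /G0 patchE; case: ifP.
have mG0 : measurable_fun setT G0.
  apply/(measurable_restrictT _ _).1 => //; apply: measurable_funTS.
  by apply: (measurableT_comp mmt); exact: measurable_snd.
have TauE z : Tau f p th z = \int[mu]_w G0 (z, w).
  rewrite /Tau integral_mkcond; apply: eq_integral => w _.
  rewrite /G0 !patchE.
  by have -> : (w \in (near th z : set C_n)) = ((z, w) \in N) by apply/idP/idP; rewrite !inE.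
have mTau : measurable_fun setT (Tau f p th).
  rewrite (_ : Tau f p th = fun z => \int[mu]_w G0 (z, w)); last exact/funext.
  exact: (measurable_fun_fubini_tonelli_F (m2 := mu) _ mG0 G00).
split => //.
rewrite integral_dv_alpha//; last by move=> z; exact: Tau_ge0.
rewrite integral_dv_alpha//; [|exact: measurable_modpow|by move=> z; exact: modpow_ge0].
pose G zw := G0 zw * dens zw.1.
have GG0 zw : 0 <= G zw by rewrite mule_ge0.
have mG : measurable_fun setT G.
  apply: emeasurable_funM => //; apply: (measurableT_comp mdens); exact: measurable_fst.
have -> : \int[dv R n.+1]_z (Tau f p th z * dens z) = \int[mu]_z \int[mu]_w G (z, w).
  apply: eq_integral => z _; rewrite TauE /G /= ge0_integralZr//.
  by apply: (measurableT_comp mG0); exact: measurable_pair1.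
rewrite (fubini_tonelli (m1 := mu) (m2 := mu) G)//.
have mmd : measurable_fun setT (fun w => modpow f p w * dens w).
  by apply: emeasurable_funM => //; exact: measurable_modpow.
have md0 w : 0 <= modpow f p w * dens w by rewrite mule_ge0// modpow_ge0.
have LC0 : (0 <= (4 / th) `^ `|alpha| * C)%R by rewrite ltW// mulr_gt0.
have E : \int[mu]_w (((4 / th) `^ `|alpha| * C)%:E * (modpow f p w * dens w)) =
    ((4 / th) `^ `|alpha| * C)%:E * \int[mu]_w (modpow f p w * dens w).
  by apply: ge0_integralZl_EFin.
apply: (@le_trans _ _ (\int[mu]_w (((4 / th) `^ `|alpha| * C)%:E * (modpow f p w * dens w))));
  last by rewrite E.
apply: ge0_le_integral => //.
- by move=> w _; exact: integral_ge0.
- exact: (measurable_fun_fubini_tonelli_G (m1 := mu) _ mG GG0).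
- exact: measurable_funeM.
move=> w _.
have [wB|wB] := pselect (B w); last first.
  rewrite integral0_eq; first by rewrite mule_ge0 ?mule_ge0 ?modpow_ge0// lee_fin ltW// mulr_gt0.
  by move=> z _; rewrite /G /G0 patchE memNset ?mul0e// => -[].
have dw := defect_gt0 wB.
apply: (@le_trans _ _ (\int[mu]_(z in near th w) (mt w * (((4 / th) `^ `|alpha|)%:E * dens w)))).
  rewrite [leRHS]integral_mkcond; apply: ge0_le_integral => //.
  - by apply: (measurableT_comp mG); exact: measurable_pair2.
  - apply/(measurable_restrictT _ _).1; first exact: measurable_near.
    exact: measurable_cst.
  move=> z _; rewrite /G /G0 !patchE; case: ifP => zw; last first.
    rewrite mul0e; case: ifP => // _.
    by apply: mule_ge0 => //; apply: mule_ge0 => //; rewrite lee_fin ltW.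
  rewrite inE in zw; have wz := near_sym zw.
  rewrite mem_set//=; apply: lee_wpmul2l => //.
  by rewrite /dens -EFinM lee_fin; exact: near_dv_density.
rewrite integral_cst; last exact: measurable_near.
apply: (le_trans (lee_wpmul2l _ (HC w wB))).
  by apply: mule_ge0 => //; apply: mule_ge0 => //; rewrite lee_fin ltW.
rewrite /mt tau_densityE// -!muleA [leRHS]muleCA; apply: lee_wpmul2l; first exact: modpow_ge0.
rewrite /dens -!EFinM lee_fin le_eqVlt; apply/orP; left; apply/eqP.
have d0 : (defect w ^+ n.+2 != 0)%R by rewrite gt_eqF// exprn_gt0.
by move: (dv_density alpha w) => D; field.
Qed.

End estimates.

(** * The operators [A] and [M] *)

Section comparison.
Variables (R : realType) (n : nat) (gamma q alpha p : R).
Hypotheses (gamma_gt0 : 0 < gamma) (q_ge1 : 1 <= q) (p_gt0 : 0 < p).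
Local Notation nc := (@Normc.normc R).
Local Notation C_n := (Cn R n.+1).
Local Notation B := (@unit_ball R n.+1).
Local Notation mu := (@dv_finite R n.+1).
Local Notation va := (dv_alpha n.+1 alpha).
Local Notation kappa := ((fine (@lebesgue_Cn R n.+1 B))^-1).
Local Notation norm := (norm_alpha p alpha).
Local Notation th := (tanh_sqr_compl gamma).
Implicit Types (w z u : C_n) (f : C_n -> R[i]) (g : C_n -> \bar R).
Local Open Scope ereal_scope.

Let q_gt0 : (0 < q)%R. Proof. exact: lt_le_trans q_ge1. Qed.

Let iq_ge0 : (0 <= q^-1)%R. Proof. by rewrite invr_ge0 ltW. Qed.

Let ip_ge0 : (0 <= p^-1)%R. Proof. by rewrite invr_ge0 ltW. Qed.

Let th01 : (0 < th < 1)%R. Proof. exact: tanh_sqr_compl_itv. Qed.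

Let th0 : (0 < th)%R. Proof. by have /andP[] := th01. Qed.

Let th1 : (th <= 1)%R. Proof. by have /andP[_ /ltW] := th01. Qed.

Let mB : measurable B. Proof. exact: measurable_unit_ball. Qed.

Lemma bergman_ballE z : B z -> bergman_ball z gamma = near th z.
Proof.
by move=> zB; apply/seteqP; split => w /(bergman_ball_near _ gamma_gt0 zB).
Qed.

Lemma near_refl z : B z -> near th z z.
Proof.
move=> zB; split => //; have dz := defect_gt0 zB.
have -> : kern z z = defect z.
  by rewrite /kern cdotE -(rmorph1 (real_complex R)) -rmorphB nc_real gtr0_norm.
by rewrite -expr2 gtr_pMl ?exprn_gt0//; have /andP[] := th01.
Qed.

Lemma measurable_restrict_near (F : C_n -> \bar R) (s : R) z :
  measurable_fun setT F -> measurable_fun setT (F \_ (near s z)).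
Proof.
move=> mF; apply/(measurable_restrictT _ _).1; first exact: measurable_near.
exact: measurable_funTS.
Qed.

Lemma restrict_ge0 (F : C_n -> \bar R) (D : set C_n) w :
  (forall w, 0 <= F w) -> 0 <= (F \_ D) w.
Proof. by move=> F0; rewrite patchE; case: ifP. Qed.

Lemma modulus_powE f r w : modulus f w `^ r = (nc (f w) `^ r)%:E.
Proof. by []. Qed.

Lemma A_opE f z : holomorphic f -> B z ->
  A_op gamma q f z = (Tau f q th z) `^ q^-1.
Proof.
move=> hf zB; rewrite /A_op bergman_ballE//; congr (_ `^ _).
rewrite (eq_integral (modpow f q)); last first.
  by move=> w; rewrite inE => -[_ wB _]; rewrite modulus_powE modpowE.
rewrite integral_mkcond integral_tau; last 2 first.
- by apply: measurable_restrict_near; exact: measurable_modpow.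
- by move=> w; apply: restrict_ge0 => u; exact: modpow_ge0.
rewrite /Tau [RHS]integral_mkcond; apply: eq_integral => w _.
by rewrite !patchE; case: ifP => //; rewrite mul0e.
Qed.

Definition near_mean f w := (va (near th w))^-1 * \int[va]_(u in near th w) modpow f q u.

Lemma M_opE f z : B z -> M_op alpha gamma q f z =
  ereal_sup [set (near_mean f w) `^ q^-1 | w in [set w | near th w z]].
Proof.
move=> zB; rewrite /M_op; congr ereal_sup.
have E w : B w -> ((va (bergman_ball w gamma))^-1 *
    \int[va]_(u in bergman_ball w gamma) (modulus f u `^ q)) = near_mean f w.
  move=> wB; rewrite bergman_ballE// /near_mean; congr (_ * _).
  by apply: eq_integral => u; rewrite inE => -[_ uB _]; rewrite modulus_powE modpowE.
apply/seteqP; split => t [w].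
  move=> [wB wz] <-; exists w; last by rewrite E.
  by rewrite /= -bergman_ballE.
move=> wz <-; have [wB _ _] := wz; exists w; last by rewrite E.
by split => //; rewrite bergman_ballE.
Qed.

Lemma near_mean_ge0 f w : 0 <= near_mean f w.
Proof.
rewrite /near_mean mule_ge0 ?inve_ge0 ?measure_ge0//.
by apply: integral_ge0 => u _; exact: modpow_ge0.
Qed.

Lemma Tau_le_near_mean : (0 < c_alpha n.+1 alpha)%R -> exists2 C : R, (0 < C)%R &
  forall f z, holomorphic f -> B z -> Tau f q th z <= C%:E * near_mean f z.
Proof.
move=> c0; have [C C0 HC] := @near_volume R n th th0 th1.
pose L := ((4 / th) `^ `|alpha|)%R.
have L0 : (0 < L)%R by rewrite powR_gt0// divr_gt0.
pose K := ((4 / th) ^+ n.+2 * L)%R.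
have K0 : (0 < K)%R by rewrite mulr_gt0// exprn_gt0// divr_gt0.
exists (K * (L * C))%R; first by apply: mulr_gt0 => //; apply: mulr_gt0.
move=> f z hf zB; have dz := defect_gt0 zB.
have D0 : (0 < dv_density alpha z)%R by rewrite mulr_gt0// powR_gt0.
(* The common scale of the two estimates: on the ball [tau_density] is at most [K / s] times
   [dv_density alpha], and the [dv_alpha] mass of the ball is at most [L * C * s]. *)
pose s := (dv_density alpha z * defect z ^+ n.+2)%R.
have s0 : (0 < s)%R by rewrite mulr_gt0// exprn_gt0.
have mdens : measurable_fun setT (fun w : C_n => (dv_density alpha w)%:E).
  by apply/measurable_EFinP; exact: measurable_dv_density.
pose I := \int[va]_(u in near th z) modpow f q u.
have I0 : 0 <= I by apply: integral_ge0 => u _; exact: modpow_ge0.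
have IE : I = \int[mu]_(w in near th z) (modpow f q w * (dv_density alpha w)%:E).
  rewrite /I integral_mkcond integral_dv_alpha; last 2 first.
  - by apply: measurable_restrict_near; exact: measurable_modpow.
  - by move=> w; apply: restrict_ge0 => u; exact: modpow_ge0.
  rewrite [RHS]integral_mkcond; apply: eq_integral => w _.
  by rewrite !patchE; case: ifP => //; rewrite mul0e.
have TI : Tau f q th z <= (K / s)%:E * I.
  rewrite IE -ge0_integralZl_EFin; last 4 first.
  - exact: measurable_near.
  - by move=> w _; apply: mule_ge0; [exact: modpow_ge0|rewrite lee_fin dv_density_ge0].
  - by apply: measurable_funTS; apply: emeasurable_funM => //; exact: measurable_modpow.
  - by rewrite divr_ge0// ltW.
  rewrite /Tau; apply: ge0_le_integral.
  - exact: measurable_near.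
  - by move=> w _; exact: modpow_tau_ge0.
  - by apply: measurable_funTS; exact: measurable_modpow_tau.
  - apply: measurable_funTS; apply: measurable_funeM.
    by apply: emeasurable_funM => //; exact: measurable_modpow.
  move=> w nzw; rewrite muleCA; apply: lee_wpmul2l; first exact: modpow_ge0.
  have [_ wB _] := nzw; have dw := defect_gt0 wB.
  rewrite tau_densityE// -EFinM lee_fin mulrAC ler_pdivlMr// /s.
  rewrite mulrC ler_pdivrMr ?exprn_gt0//.
  have h1 := near_dv_density alpha th0 (near_sym nzw).
  have h2 : (defect z ^+ n.+2 <= (4 / th) ^+ n.+2 * defect w ^+ n.+2)%R.
    rewrite -exprMn; apply: lerXn2r; rewrite ?nnegrE ?(ltW dz)//.
      by rewrite mulr_ge0 ?(ltW dw)// divr_ge0// ltW.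
    exact: near_defect_le (near_sym nzw).
  have := ler_pM (ltW D0) (exprn_ge0 n.+2 (ltW dz)) h1 h2.
  rewrite -/L => /le_trans; apply.
  by rewrite /K le_eqVlt; apply/orP; left; apply/eqP; ring.
have VE : va (near th z) <= (L * C * s)%:E.
  rewrite -[leLHS]mul1e -integral_cst; last exact: measurable_near.
  rewrite integral_mkcond integral_dv_alpha; last 2 first.
  - by apply: measurable_restrict_near.
  - by move=> w; exact: restrict_ge0.
  apply: (@le_trans _ _ (\int[mu]_(w in near th z) (L * dv_density alpha z)%:E)).
    rewrite [leRHS]integral_mkcond; apply: ge0_le_integral => //.
    - by move=> w _; rewrite mule_ge0 ?lee_fin ?dv_density_ge0//; exact: restrict_ge0.
    - by apply: emeasurable_funM => //; exact: measurable_restrict_near.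
    - exact: measurable_restrict_near.
    move=> w _; rewrite !patchE; case: ifP => [|_]; last by rewrite mul0e.
    by rewrite inE mul1e lee_fin => nzw; exact: near_dv_density.
  rewrite integral_cst; last exact: measurable_near.
  apply: (le_trans (lee_wpmul2l _ (HC z zB))); first by rewrite lee_fin mulr_ge0 ?ltW.
  by rewrite -EFinM lee_fin /s le_eqVlt; apply/orP; left; apply/eqP; ring.
have LCs : (0 < L * C * s)%R by apply: mulr_gt0 => //; apply: mulr_gt0.
have iV : (L * C * s)^-1%:E <= (va (near th z))^-1.
  have -> : (L * C * s)^-1%:E = ((L * C * s)%:E)^-1 by rewrite inver gt_eqF.
  rewrite inve_pge ?inE ?measure_ge0//; last by rewrite inve_ge0 lee_fin ltW.
  by rewrite inveK.
apply: (le_trans TI); rewrite /near_mean -/I muleA; apply: lee_wpmul2r => //.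
apply: le_trans (lee_wpmul2l _ iV); last first.
  by rewrite lee_fin ltW//; apply: mulr_gt0 => //; exact: mulr_gt0.
rewrite -EFinM lee_fin le_eqVlt; apply/orP; left; apply/eqP.
by field; rewrite !gt_eqF.
Qed.

(** The mean of a constant over a set of measure [V]. When [V] is 0 or infinite the left-hand side
    is 0, whence an inequality only. *)
Lemma inve_mul_le (V c : \bar R) : 0 <= V -> 0 <= c -> V^-1 * (c * V) <= c.
Proof.
move=> V0 c0; have [->|Vn0] := eqVneq V 0; first by rewrite !mule0.
move: V0 Vn0; case: V => [v||] //= v0 vn0; last by rewrite invey mul0e.
by rewrite muleCA mulVe ?mule1.
Qed.

Lemma le_poweR (x y : \bar R) r : (0 <= r)%R -> 0 <= x -> x <= y -> x `^ r <= y `^ r.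
Proof.
by move=> r0 x0 xy; apply: gt0_ler_poweR => //; rewrite in_itv/= leey andbT// (le_trans x0).
Qed.

(** For [u] in the ball about [w], [submean] with exponent [p] gives [|f u|^p <= Y], hence
    [|f u|^q <= Y^(q/p)], whichever exponent is larger; the mean of [|f|^q] inherits this bound. *)
Lemma M_op_le : (0 < kappa)%R -> exists C s : R, [/\ (0 < C)%R, (0 < s)%R, (s <= 1)%R &
  forall f z, holomorphic f -> B z ->
    M_op alpha gamma q f z <= (C%:E * Tau f p s z) `^ p^-1].
Proof.
move=> k0; have [C C0 HC] := @submean R n p th k0 p_gt0 th01.
(* [s1] joins [z] to [u] through the centre [w]; [s] then joins [z] to every [v] in the ball about
   [u]. *)
have [s1 /andP[s10 _] H1] := near_trans n.+1 th0 th0.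
have [s /andP[s0 s1'] H2] := near_trans n.+1 s10 th0.
exists C, s; split => //; first exact: ltW.
move=> f z hf zB; rewrite M_opE//; apply: ge_ereal_sup => _ [w wz <-].
set Y := C%:E * Tau f p s z.
have Y0 : 0 <= Y by rewrite mule_ge0 ?Tau_ge0// lee_fin ltW.
have bound u : near th w u -> modpow f q u <= Y `^ (q / p).
  move=> wu; have [_ uB _] := wu.
  have : modpow f p u <= Y.
    apply: (le_trans (HC f hf u uB)); apply: lee_wpmul2l; first by rewrite lee_fin ltW.
    apply: ge0_subset_integral.
    - exact: measurable_near.
    - exact: measurable_near.
    - by apply: measurable_funTS; exact: measurable_modpow_tau.
    - by move=> v _; exact: modpow_tau_ge0.
    by move=> v uv; apply: H2 uv; apply: H1 wu; exact: near_sym.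
  move=> /(le_poweR (_ : (0 <= q / p)%R)); rewrite divr_ge0 ?(ltW q_gt0) ?(ltW p_gt0)//.
  move=> /(_ isT (modpow_ge0 _ _ _)); rewrite !modpowE// poweR_EFin -powRrM.
  by rewrite mulrCA divff ?mulr1// gt_eqF.
have -> : Y `^ p^-1 = (Y `^ (q / p)) `^ q^-1.
  by rewrite -poweRrM mulrAC divff ?mul1r// gt_eqF.
apply: le_poweR; [by rewrite invr_ge0 ltW|exact: near_mean_ge0|].
apply: le_trans (inve_mul_le (measure_ge0 va (near th w)) (poweR_ge0 Y (q / p))).
apply: lee_wpmul2l; first by rewrite inve_ge0 measure_ge0.
rewrite -integral_cst; last exact: measurable_near.
apply: ge0_le_integral.
- exact: measurable_near.
- by move=> u _; exact: modpow_ge0.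
- by apply: measurable_funTS; exact: measurable_modpow.
- exact: measurable_cst.
- by move=> u; exact: bound.
Qed.

Lemma measurable_A_op f : holomorphic f -> measurable_fun B (A_op gamma q f).
Proof.
move=> hf; apply: (eq_measurable_fun (fun z => (Tau f q th z) `^ q^-1)).
  by move=> z; rewrite inE => zB; rewrite A_opE.
apply: measurable_funTS; apply: (measurableT_comp (measurable_poweR _)).
by have [C _ H] := @fubini_near R n alpha th th0 th1; have [] := H f q hf.
Qed.

(** The supremum is over uncountably many centres, but it is lower semicontinuous: where it exceeds
    [c] is the union of the open balls whose mean does. *)
Lemma measurable_M_op f : measurable_fun B (M_op alpha gamma q f).
Proof.
move=> _; apply: (measurability _ (ErealGenOInfty.measurableE R)) => //.
move=> _ [_ [c ->] <-]; apply: eopen_measurable.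
rewrite (_ : _ `&` _ = \bigcup_(w in [set w | c%:E < (near_mean f w) `^ q^-1]) near th w).
  by apply: eopen_bigcup => w _; exact: eopen_near.
apply/seteqP; split => z.
  move=> [zB]; rewrite /= in_itv/= andbT M_opE// => /ereal_sup_gt[_ [w wz <-] cw].
  by exists w.
move=> [w cw wz]; have [_ zB _] := wz; split => //=; rewrite in_itv/= andbT M_opE//.
by apply: (lt_le_trans cw); apply: ereal_sup_ubound; exists w.
Qed.

Lemma measurable_abse_poweR g (r : R) :
  measurable_fun B g -> measurable_fun B (fun z => `|g z| `^ r).
Proof.
move=> mg; apply: (measurableT_comp (measurable_poweR r)).
by apply: (measurableT_comp (@abse_measurable R setT)).
Qed.

Lemma le_norm_alpha (c : R) g1 g2 : (0 <= c)%R ->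
  measurable_fun B g1 -> measurable_fun B g2 ->
  (forall z, B z -> `|g1 z| <= c%:E * `|g2 z|) -> norm g1 <= c%:E * norm g2.
Proof.
move=> c0 mg1 mg2 g12; have p0 := ltW p_gt0.
have pow0 g (r : R) z : 0 <= `|g z| `^ r by exact: poweR_ge0.
have -> : c%:E * norm g2 =
    (\int[va]_(z in B) ((c%:E * `|g2 z|) `^ p)) `^ p^-1.
  have -> : \int[va]_(z in B) ((c%:E * `|g2 z|) `^ p) =
      (c `^ p)%:E * \int[va]_(z in B) (`|g2 z| `^ p).
    rewrite -ge0_integralZl_EFin ?powR_ge0//; last exact: measurable_abse_poweR.
    apply: eq_integral => z _; exact: poweRM.
  rewrite poweRM ?lee_fin ?powR_ge0//; last exact: integral_ge0.
  by rewrite poweR_EFin -powRrM divff ?gt_eqF// powRr1.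
apply: le_poweR => //; first exact: integral_ge0.
apply: ge0_le_integral => //.
- exact: measurable_abse_poweR.
- apply: (measurableT_comp (measurable_poweR p)); apply: measurable_funeM.
  by apply: (measurableT_comp (@abse_measurable R setT)).
- by move=> z zB; apply: le_poweR => //; exact: g12.
Qed.

(* If a normalizing constant vanishes, all the norms are 0: this spares us the
   positivity of [Gamma] and of the volume of the ball. *)
Lemma dv_alpha_ball_eq0 : ~ ((0 < kappa)%R /\ (0 < c_alpha n.+1 alpha)%R) -> va B = 0.
Proof.
have c0 : (0 <= c_alpha n.+1 alpha)%R by rewrite !(mulr_ge0, invr_ge0, Gamma_ge0).
move=> k0c0.
have [c1|] := ltP 0%R (c_alpha n.+1 alpha); last first.
  move=> cle; apply: integral0_eq => z _; rewrite /dv_density.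
  by have -> : c_alpha n.+1 alpha = 0%R; [apply/le_anti; rewrite cle c0|rewrite mul0r].
apply: null_set_integral => //.
  by apply/measurable_EFinP; apply: measurable_funTS; exact: measurable_dv_density.
have k1 : kappa = 0%R.
  apply/le_anti; rewrite kappa_ge0 andbT leNgt; apply/negP => k1.
  by apply: k0c0.
by rewrite dvE// k1 mul0e.
Qed.

Lemma norm_alpha_eq0 g : va B = 0 -> measurable_fun B g -> norm g = 0.
Proof.
move=> v0 mg; rewrite /norm_alpha null_set_integral//.
  by rewrite poweR0r// invr_eq0 gt_eqF.
exact: measurable_abse_poweR.
Qed.

Lemma measurable_modulus f : holomorphic f -> measurable_fun B (modulus f).
Proof. by move=> hf; apply/measurable_EFinP; exact: measurable_holomorphic_modulus. Qed.

Lemma integral_modpow f : \int[va]_z modpow f p z = \int[va]_(z in B) (`|modulus f z| `^ p).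
Proof.
rewrite [RHS]integral_mkcond; apply: eq_integral => z _.
rewrite /modpow !patchE; case: ifP => // _.
by rewrite /modulus abse_EFin ger0_norm ?nc_ge0.
Qed.

Lemma modulus_le_A_op : (0 < kappa)%R -> exists2 C : R, (0 < C)%R &
  forall f z, holomorphic f -> B z -> modulus f z <= C%:E * A_op gamma q f z.
Proof.
move=> k0; have [C C0 HC] := submean k0 q_gt0 th01.
exists (C `^ q^-1)%R; first exact: powR_gt0.
move=> f z hf zB; rewrite A_opE// -poweR_EFin -poweRM ?Tau_ge0 ?lee_fin ?(ltW C0)//.
apply: le_trans (le_poweR iq_ge0 (modpow_ge0 f q z) (HC f hf z zB)).
by rewrite modpowE// poweR_EFin -powRrM divff ?gt_eqF// powRr1 ?nc_ge0.
Qed.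

(** Among the balls in the supremum, the one centred at [z] itself is chosen. *)
Lemma A_op_le_M_op : (0 < c_alpha n.+1 alpha)%R -> exists2 C : R, (0 < C)%R &
  forall f z, holomorphic f -> B z ->
    A_op gamma q f z <= C%:E * M_op alpha gamma q f z.
Proof.
move=> c0; have [C C0 HC] := Tau_le_near_mean c0.
exists (C `^ q^-1)%R; first exact: powR_gt0.
move=> f z hf zB; rewrite A_opE// M_opE//.
apply: (le_trans (le_poweR iq_ge0 (Tau_ge0 _ _ _ _) (HC f z hf zB))).
rewrite poweRM ?near_mean_ge0 ?lee_fin ?(ltW C0)// poweR_EFin; apply: lee_wpmul2l.
  by rewrite lee_fin powR_ge0.
by apply: ereal_sup_ubound; exists z => //; exact: near_refl.
Qed.

Lemma M_op_ge0 f z : B z -> 0 <= M_op alpha gamma q f z.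
Proof.
move=> zB; rewrite M_opE//; apply: (le_trans (poweR_ge0 (near_mean f z) q^-1)).
by apply: ereal_sup_ubound; exists z => //; exact: near_refl.
Qed.

(** Raising to the power [p] undoes the exponent [p^-1] of [M_op_le] and leaves [Tau] with exponent
    [p], which [fubini_near] integrates. *)
Lemma norm_M_op_le : (0 < kappa)%R -> exists2 C : R, (0 < C)%R &
  forall f, holomorphic f -> norm (M_op alpha gamma q f) <= C%:E * norm (modulus f).
Proof.
move=> k0; have [C [s [C0 s0 s1 HC]]] := M_op_le k0.
have [C' C'0 HC'] := fubini_near n alpha s0 s1.
have CC0 : (0 < C * C')%R by exact: mulr_gt0.
exists ((C * C') `^ p^-1)%R; first exact: powR_gt0.
move=> f hf; have [mT HT] := HC' f p hf.
rewrite /norm_alpha -integral_modpow -poweR_EFin -poweRM ?lee_fin ?(ltW CC0)//; last first.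
  by apply: integral_ge0 => z _; exact: modpow_ge0.
apply: le_poweR => //; first by apply: integral_ge0 => z _; exact: poweR_ge0.
apply: (@le_trans _ _ (\int[va]_z (C%:E * Tau f p s z))); last first.
  rewrite ge0_integralZl_EFin ?(ltW C0)//; last by move=> z _; exact: Tau_ge0.
  by rewrite EFinM -muleA; apply: lee_wpmul2l => //; rewrite lee_fin ltW.
have T0 z : 0 <= C%:E * Tau f p s z by rewrite mule_ge0 ?Tau_ge0// lee_fin ltW.
have mCT : measurable_fun setT (fun z => C%:E * Tau f p s z) by exact: measurable_funeM.
apply: (@le_trans _ _ (\int[va]_(z in B) (C%:E * Tau f p s z))); last first.
  exact: ge0_subset_integral.
apply: ge0_le_integral => //.
- by move=> z _; exact: poweR_ge0.
- by apply: measurable_abse_poweR; exact: measurable_M_op.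
- exact: measurable_funTS.
move=> z zB; rewrite gee0_abs ?M_op_ge0//.
apply: (le_trans (le_poweR (ltW p_gt0) (M_op_ge0 f zB) (HC f z hf zB))).
by rewrite -poweRrM mulVf ?gt_eqF// poweRe1.
Qed.

Lemma norm_cycle : exists2 C : R, (0 < C)%R & forall f, holomorphic f ->
  [/\ norm (modulus f) <= C%:E * norm (A_op gamma q f),
      norm (A_op gamma q f) <= C%:E * norm (M_op alpha gamma q f) &
      norm (M_op alpha gamma q f) <= C%:E * norm (modulus f)].
Proof.
have [[k0 c0]|k0c0] := pselect ((0 < kappa)%R /\ (0 < c_alpha n.+1 alpha)%R); last first.
  have v0 := dv_alpha_ball_eq0 k0c0.
  exists 1%R => // f hf; rewrite !norm_alpha_eq0 ?mule0//.
  - exact: measurable_M_op.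
  - exact: measurable_A_op.
  - exact: measurable_modulus.
have [C1 C10 H1] := modulus_le_A_op k0.
have [C2 C20 H2] := A_op_le_M_op c0.
have [C3 C30 H3] := norm_M_op_le k0.
have norm0 g : 0 <= norm g by exact: poweR_ge0.
exists (C1 + C2 + C3)%R; first by rewrite !addr_gt0.
move=> f hf; have mm := measurable_modulus hf.
have mA : measurable_fun B (A_op gamma q f) by exact: measurable_A_op.
have mM : measurable_fun B (M_op alpha gamma q f) by exact: measurable_M_op.
have A0 z : B z -> 0 <= A_op gamma q f z by move=> _; exact: poweR_ge0.
split.
- apply: (@le_trans _ _ (C1%:E * norm (A_op gamma q f))).
    apply: le_norm_alpha => // [|z zB]; first exact: ltW.
    by rewrite !gee0_abs ?A0 ?lee_fin ?nc_ge0//; exact: H1.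
  by apply: lee_wpmul2r => //; rewrite lee_fin; lra.
- apply: (@le_trans _ _ (C2%:E * norm (M_op alpha gamma q f))).
    apply: le_norm_alpha => // [|z zB]; first exact: ltW.
    by rewrite !gee0_abs ?A0 ?M_op_ge0//; exact: H2.
  by apply: lee_wpmul2r => //; rewrite lee_fin; lra.
- apply: (le_trans (H3 f hf)).
  by apply: lee_wpmul2r => //; rewrite lee_fin; lra.
Qed.

Lemma comparable_withP (C : R) (X Y : \bar R) : (0 < C)%R ->
  X <= C%:E * Y -> Y <= C%:E * X -> comparable_with C X Y.
Proof. by move=> C0 XY YX; rewrite /comparable_with XY andbT lee_pdivrMl. Qed.

Lemma comparable_with_lty (C : R) (X Y : \bar R) : (0 < C)%R ->
  comparable_with C X Y -> X < +oo <-> Y < +oo.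
Proof.
move=> C0 /andP[]; rewrite lee_pdivrMl// => YX XY.
have fin Z : Z < +oo -> C%:E * Z < +oo by move=> Zoo; rewrite lte_mul_pinfty ?lee_fin// ltW.
by split=> /fin; exact: le_lt_trans.
Qed.

Lemma norms_comparable : exists2 C : R, (0 < C)%R & forall f, holomorphic f ->
  comparable_with C (norm (modulus f)) (norm (A_op gamma q f)) /\
  comparable_with C (norm (A_op gamma q f)) (norm (M_op alpha gamma q f)).
Proof.
have [C C0 HC] := norm_cycle; have CC0 : (0 < C * C)%R by exact: mulr_gt0.
(* A reverse inequality takes the other two steps of the cycle and costs [C * C]. *)
have D0 : (0 < C + C * C)%R by exact: addr_gt0.
have norm0 g : 0 <= norm g by exact: poweR_ge0.
have le1 (Y : \bar R) : 0 <= Y -> C%:E * Y <= (C + C * C)%:E * Y.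
  by move=> Y0; apply: lee_wpmul2r => //; rewrite lee_fin; lra.
have le2 (Y : \bar R) : 0 <= Y -> C%:E * (C%:E * Y) <= (C + C * C)%:E * Y.
  by move=> Y0; rewrite muleA -EFinM; apply: lee_wpmul2r => //; rewrite lee_fin; lra.
have C0' : 0 <= C%:E by rewrite lee_fin ltW.
exists (C + C * C)%R => // f hf; have [H1 H2 H3] := HC f hf.
split; apply: comparable_withP => //.
- exact: le_trans (le1 _ _).
- by apply: (le_trans H2); apply: le_trans (le2 _ _) => //; exact: lee_wpmul2l.
- exact: le_trans (le1 _ _).
- by apply: (le_trans H3); apply: le_trans (le2 _ _) => //; exact: lee_wpmul2l.
Qed.

End comparison.

Theorem theorem3p1 (R : realType) (n : nat) (gamma q alpha p : R)
    (n_ge1 : (1 <= n)%N) (gamma_gt0 : 0 < gamma) (q_ge1 : 1 <= q)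
    (alpha_gtN1 : -1 < alpha) (p_gt0 : 0 < p) :
  (forall f : Cn R n -> R[i], holomorphic f ->
     (bergman_space p alpha f <-> in_Lp p alpha (A_op gamma q f)) /\
     (in_Lp p alpha (A_op gamma q f) <->
      in_Lp p alpha (M_op alpha gamma q f))) /\
  (exists C : R, 0 < C /\
     forall f : Cn R n -> R[i], holomorphic f ->
       comparable_with C (norm_alpha p alpha (modulus f))
                         (norm_alpha p alpha (A_op gamma q f)) /\
       comparable_with C (norm_alpha p alpha (A_op gamma q f))
                         (norm_alpha p alpha (M_op alpha gamma q f))).
Proof.
(* The estimates are stated in dimension [n.+1], where a largest coordinate can be singled out. *)
case: n n_ge1 => // n _.
have [C C0 HC] := @norms_comparable R n gamma q alpha p gamma_gt0 q_ge1 p_gt0.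
split; last by exists C.
move=> f hf; have [fA AM] := HC f hf.
have mA : measurable_fun (unit_ball (n:=n.+1)) (A_op gamma q f) by exact: measurable_A_op.
have mM : measurable_fun (unit_ball (n:=n.+1)) (M_op alpha gamma q f).
  exact: measurable_M_op.
have [fA1 fA2] := comparable_with_lty C0 fA.
have [AM1 AM2] := comparable_with_lty C0 AM.
by split; split => -[_ ?]; split => //; auto.
Qed.
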